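(* Let $F_0$ be a smooth ($C^\infty$ or analytic) area-preserving map of a neighbourhood of the origin of $\mathbb{R}^2$ into $\mathbb{R}^2$ with a resonant elliptic fixed point at the origin, let $n\ge 3$ be the order of the resonance and let $\alpha$ be the rotation angle of $DF_0(0)$. Let $A(0)$ and $B(0)$ be the leading coefficients of the leading-order resonant normal form of $F_0$ (see context), and assume that $A(0)B(0)\neq 0$ if $n\ge 4$, and that $B(0)\ne 0$ if $n=3$. Then there are a formal Hamiltonian $H$ and a formal canonical change of variables which conjugates $F_0$ with $R_\alpha\circ\Phi^1_H$, where $H$ has the following form in the symplectic polar coordinates $(I,\varphi)$: (i) if $n\ge4$ (and $A(0)B(0)\neq0$), $$H(I,\varphi)=I^2A(I)+I^{n/2}B(I)\cos n\varphi,\qquad A(I)=\sum_{k\ge0}a_kI^k,\qquad B(I)=\sum_{k\ge0}b_kI^{2k};$$ (ii) if $n=3$ (and $B(0)\ne0$), $$H(I,\varphi)=I^3A(I)+I^{3/2}B(I)\cos3\varphi,\qquad A(I)=\sum_{\substack{k\ge0\\ k\not\equiv2\ (\mathrm{mod}\ 3)}}a_kI^k,\qquad B(I)=\sum_{\substack{k\ge0\\ k\not\equiv2\ (\mathrm{mod}\ 3)}}b_kI^k.$$ Here all $a_k,b_k$ are real. Moreover, the coefficients of the series $A$ and $B$ are defined uniquely by the map $F_0$ provided the leading order is normalised so that $b_0>0$.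
   Context: A fixed point at the origin of an area-preserving map $F_0$ (so $\det DF_0(0)=1$) is elliptic if the eigenvalues $\mu,\mu^{-1}$ of $DF_0(0)$ are not real; then $|\mu|=1$. By a linear area- and orientation-preserving change of variables $DF_0(0)$ takes the form of the rotation $R_\alpha=\begin{pmatrix}\cos\alpha&-\sin\alpha\\ \sin\alpha&\cos\alpha\end{pmatrix}$, $\mu=e^{i\alpha}$; $\alpha$ is the rotation angle. The fixed point is resonant if $\mu^n=1$ for some $n\in\mathbb{N}$; the least positive such $n$ is the order of the resonance ($n\ge3$ for an elliptic point). Symplectic polar coordinates: $x=\sqrt{2I}\cos\varphi$, $y=\sqrt{2I}\sin\varphi$. Thus $I=(x^2+y^2)/2$ and $I^{n/2}\cos n\varphi=2^{-n/2}\,\mathrm{Re}\,(x+iy)^n$, so the expressions for $H$ are formal power series in $(x,y)$ with real coefficients. A formal canonical change of variables is an invertible pair of formal power series in $(x,y)$ with real coefficients, without constant terms, which preserves the form $dx\wedge dy$ (i.e. is area- and orientation-preserving). All series may diverge, and $F_0$ is identified with its Taylor series at the origin. For a formal Hamiltonian $H$ (with terms of order at least 3 in $(x,y)$), $\Phi^1_H$ is the formal time-one map of $\dot x=\partial H/\partial y$, $\dot y=-\partial H/\partial x$, i.e. $\Phi^1_H=\exp(L_H)\,\mathrm{id}$ (applied componentwise), where $L_Hg=\frac{\partial g}{\partial x}\frac{\partial H}{\partial y}-\frac{\partial g}{\partial y}\frac{\partial H}{\partial x}$. Leading-order resonant normal form: by the classical theory, $F_0$ is conjugate by a formal canonical change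 of variables to $R_\alpha\circ\Phi^1_H$ with $H\circ R_\alpha=H$ and $$H(I,\varphi)=I^2A(I)+I^{n/2}B(I)\cos n\varphi+O(I^{1+n/2}),$$ where $A$ and $B$ are polynomials in $I$ with real coefficients. The nondegeneracy assumptions refer to the values $A(0)$, $B(0)$ in this form. *)

(* Defs.v *)
From Stdlib Require Import Rdefinitions Rtrigo_def.
From Coquelicot Require Hierarchy Derive Derive_2d.
From mathcomp Require Import all_boot all_order all_algebra.
From mathcomp Require Import complex Rstruct.

Set Implicit Arguments.
Unset Strict Implicit.
Unset Printing Implicit Defensive.

Import Order.TTheory GRing.Theory Num.Theory.
Local Open Scope ring_scope.

(* A formal power series in (x, y): [f i j] is the coefficient of x^i y^j.
   Equality of series is the pointwise [=2]. *)
Definition series (K : Type) : Type := nat -> nat -> K.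

Definition ser_mono (K : fieldType) (a b : nat) : series K :=
  fun i j => ((i == a) && (j == b))%:R.

Definition ser_one (K : fieldType) : series K := ser_mono K 0 0.
Definition ser_x (K : fieldType) : series K := ser_mono K 1 0.
Definition ser_y (K : fieldType) : series K := ser_mono K 0 1.

Definition ser_add (K : fieldType) (f g : series K) : series K :=
  fun i j => f i j + g i j.

Definition ser_sub (K : fieldType) (f g : series K) : series K :=
  fun i j => f i j - g i j.

Definition ser_scale (K : fieldType) (c : K) (f : series K) : series K :=
  fun i j => c * f i j.

Definition ser_mul (K : fieldType) (f g : series K) : series K :=
  fun i j => \sum_(k < i.+1) \sum_(l < j.+1) f k l * g (i - k)%N (j - l)%N.

Definition ser_exp (K : fieldType) (f : series K) (n : nat) : series K :=
  iter n (ser_mul f) (ser_one K).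

Definition ser_dx (K : fieldType) (f : series K) : series K :=
  fun i j => f i.+1 j *+ i.+1.

Definition ser_dy (K : fieldType) (f : series K) : series K :=
  fun i j => f i j.+1 *+ j.+1.

Definition ser_order_ge (K : fieldType) (d : nat) (f : series K) : Prop :=
  forall i j, (i + j < d)%N -> f i j = 0.

Definition ser_jac (K : fieldType) (f g : series K) : series K :=
  ser_sub (ser_mul (ser_dx f) (ser_dy g)) (ser_mul (ser_dy f) (ser_dx g)).

(* L_H g = g_x H_y - g_y H_x, which is the Jacobian determinant of (g, H). *)
Definition ser_lie (K : fieldType) (H g : series K) : series K := ser_jac g H.

Definition smap (K : Type) : Type := (series K * series K)%type.

Definition smap_eq (K : Type) (F G : smap K) : Prop :=
  F.1 =2 G.1 /\ F.2 =2 G.2.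

Definition smap_id (K : fieldType) : smap K := (ser_x K, ser_y K).

Definition no_constant (K : fieldType) (P : smap K) : Prop :=
  P.1 0%N 0%N = 0 /\ P.2 0%N 0%N = 0.

(* f(P.1, P.2) for P without constant terms: P.1^k P.2^l has order at least
   k + l, so the monomials x^k y^l of f with k + l > i + j do not contribute
   to the coefficient of x^i y^j, and the truncated sum is exact. *)
Definition ser_subst (K : fieldType) (f : series K) (P : smap K) : series K :=
  fun i j => \sum_(k < (i + j).+1) \sum_(l < (i + j).+1)
    f k l * ser_mul (ser_exp P.1 k) (ser_exp P.2 l) i j.

Definition smap_comp (K : fieldType) (F P : smap K) : smap K :=
  (ser_subst F.1 P, ser_subst F.2 P).

(* \sum_k a_k S^k for a one-variable series a and S without constant term
   (the truncation is exact for the same reason). *)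
Definition ser_subst1 (K : fieldType) (a : nat -> K) (S : series K) :
    series K :=
  fun i j => \sum_(k < (i + j).+1) a k * ser_exp S k i j.

(* exp(L_H) g for H of order at least 3: L_H raises the order by at least one,
   so (L_H)^m g has order at least m and the truncated sum is exact. *)
Definition ser_exp_lie (K : fieldType) (H g : series K) : series K :=
  fun i j => \sum_(m < (i + j).+1) (m`!%:R)^-1 * iter m (ser_lie H) g i j.

Definition time_one_map (K : fieldType) (H : series K) : smap K :=
  (ser_exp_lie H (ser_x K), ser_exp_lie H (ser_y K)).

Definition formal_canonical (K : fieldType) (P : smap K) : Prop :=
  [/\ no_constant P,
      exists Q : smap K, [/\ no_constant Q,
        smap_eq (smap_comp P Q) (smap_id K) &
        smap_eq (smap_comp Q P) (smap_id K)]
    & ser_jac P.1 P.2 =2 ser_one K].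

Definition formally_conjugate (K : fieldType) (F G : smap K) : Prop :=
  exists P : smap K,
    formal_canonical P /\ smap_eq (smap_comp F P) (smap_comp P G).

(* I = (x^2 + y^2) / 2 *)
Definition ser_I (K : fieldType) : series K :=
  ser_scale 2^-1 (ser_add (ser_mono K 2 0) (ser_mono K 0 2)).

(* (Re (x + i y)^n, Im (x + i y)^n) *)
Definition ser_zpow (K : fieldType) (n : nat) : smap K :=
  iter n (fun w : smap K =>
      (ser_sub (ser_mul (ser_x K) w.1) (ser_mul (ser_y K) w.2),
       ser_add (ser_mul (ser_x K) w.2) (ser_mul (ser_y K) w.1)))
    (ser_one K, fun _ _ => 0).

(* I^(n/2) cos (n phi) = 2^(-n/2) Re (x + i y)^n *)
Definition ser_Icos (K : rcfType) (n : nat) : series K :=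
  ser_scale ((Num.sqrt 2 ^+ n)^-1) (ser_zpow K n).1.

(* I^m A(I) + I^(n/2) B(I) cos (n phi) *)
Definition resonant_ham (K : rcfType) (m n : nat) (A B : nat -> K) :
    series K :=
  ser_add (ser_mul (ser_exp (ser_I K) m) (ser_subst1 A (ser_I K)))
          (ser_mul (ser_Icos K n) (ser_subst1 B (ser_I K))).

(* The coefficients, in powers of t, of \sum_k b_k t^(2k). *)
Definition even_coefs (K : fieldType) (b : nat -> K) : nat -> K :=
  fun k => if odd k then 0 else b k./2.

Definition mx2 (K : Type) (a b c d : K) : 'M[K]_2 :=
  \matrix_(i < 2, j < 2)
    if i == 0 then (if j == 0 then a else b) else (if j == 0 then c else d).

Definition smap_linear (K : fieldType) (M : 'M[K]_2) : smap K :=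
  (ser_add (ser_scale (M 0 0) (ser_x K)) (ser_scale (M 0 1) (ser_y K)),
   ser_add (ser_scale (M 1 0) (ser_x K)) (ser_scale (M 1 1) (ser_y K))).

Definition rotation_mx (alpha : R) : 'M[R]_2 :=
  mx2 (cos alpha) (- sin alpha) (sin alpha) (cos alpha).

Definition rotation (alpha : R) : smap R := smap_linear (rotation_mx alpha).

Definition taylor (f : R -> R -> R) : series R :=
  fun i j => Derive_2d.partial_derive i j f 0%R 0%R / (i`!%:R * j`!%:R).

Definition jacobian_mx (f g : R -> R -> R) (x y : R) : 'M[R]_2 :=
  mx2 (Derive.Derive (fun t => f t y) x) (Derive.Derive (fun t => f x t) y)
      (Derive.Derive (fun t => g t y) x) (Derive.Derive (fun t => g x t) y).

Definition smooth_near0 (f : R -> R -> R) : Prop :=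
  Hierarchy.locally_2d
    (fun x y => forall k : nat, Derive_2d.ex_diff_n f k x y) 0%R 0%R.

(* (f, g) preserves the form dx /\ dy near the origin. *)
Definition area_preserving_near0 (f g : R -> R -> R) : Prop :=
  Hierarchy.locally_2d (fun x y => \det (jacobian_mx f g x y) = 1) 0%R 0%R.

Definition elliptic (D : 'M[R]_2) : Prop :=
  forall mu : R[i],
    eigenvalue (map_mx (real_complex R) D) mu -> complex.Im mu != 0.

(* The base change has determinant 1: it preserves area and orientation, so
   that alpha is determined modulo 2 pi, sign included. *)
Definition rotation_angle (D : 'M[R]_2) (alpha : R) : Prop :=
  exists P : 'M[R]_2, \det P = 1 /\ D *m P = P *m rotation_mx alpha.

(* The leading-order resonant normal form of the formal map F.
   O(I^(1+n/2)) stands for terms of order at least n + 2 in (x, y). *)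
Definition leading_normal_form (F : smap R) (alpha : R) (n : nat)
    (A B : {poly R}) : Prop :=
  exists H : series R,
    [/\ ser_order_ge 3 H,
        ser_subst H (rotation alpha) =2 H,
        ser_order_ge n.+2
          (ser_sub H (resonant_ham 2 n (fun k => A`_k) (fun k => B`_k)))
      & formally_conjugate F (smap_comp (rotation alpha) (time_one_map H))].

Definition normal_form_ge4 (F : smap R) (alpha : R) (n : nat)
    (a b : nat -> R) : Prop :=
  formally_conjugate F (smap_comp (rotation alpha)
    (time_one_map (resonant_ham 2 n a (even_coefs b)))).

Definition normal_form_3 (F : smap R) (alpha : R) (a b : nat -> R) : Prop :=
  [/\ forall k : nat, (k %% 3 = 2)%N -> a k = 0,
      forall k : nat, (k %% 3 = 2)%N -> b k = 0
    & formally_conjugate F (smap_comp (rotation alpha)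
        (time_one_map (resonant_ham 3 3 a b)))].

Definition exists_unique_normalised (P : (nat -> R) -> (nat -> R) -> Prop) :
    Prop :=
  (exists a b, P a b /\ 0 < b 0%N) /\
  (forall a b a' b', P a b -> 0 < b 0%N -> P a' b' -> 0 < b' 0%N ->
     a =1 a' /\ b =1 b').

(* Main.v *)
(* If H is invariant under R = R_alpha then (R o Phi_H)^n = Phi_(n H); since
   formal logarithms are unique, S conjugates R o Phi_H with R o Phi_H' if and
   only if H o S = H' and S commutes with R. Such an S is a rotation followed by
   exp(L_chi) with chi invariant, so it remains to classify invariant
   Hamiltonians under these changes of variables.

   Put z = x + i y, w = x - i y and let the weight of z^k w^l be the smaller of
   p k + q l and q k + p l, where (p, q) = (2, n - 2) if n >= 4 and (1, 1) if
   n = 3. The part of lowest weight of H is H0 = a (z w)^2 + b (z^n + w^n), with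
   a = 0 if n = 3. In each weight, chi |-> {chi, H0} is a three-term recursion
   in the index j of the monomials (z w)^l z^(n j) and their conjugates; its
   kernel is spanned by a power of H0 and the monomials of the normal form span
   a complement of its image. Solving weight by weight gives one chi that
   normalises H. For uniqueness, an exp(L_chi) between two normal forms can be
   corrected by powers of H until the weight of chi is arbitrarily high. *)
Require Import Defs.
From Stdlib Require Import Rdefinitions Rtrigo_def.
From Stdlib Require Rtrigo1.
From HB Require Import structures.
From mathcomp Require Import all_boot all_order all_algebra.
From mathcomp Require Import complex Rstruct.
From mathcomp Require Import boolp ring zify.
Import Order.TTheory GRing.Theory Num.Theory.
Set Implicit Arguments.
Unset Strict Implicit.
Unset Printing Implicit Defensive.
Local Open Scope ring_scope.

(** * The ring of formal power series *)

(** The exchange of z and w fixes H0 and reverses the sign of the bracket, so chi |-> {chi, H0}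
    exchanges symmetric and antisymmetric series. Symmetric chi remove the sine terms and are never
    obstructed. Antisymmetric chi remove diagonal and cosine monomials, but vanish on the diagonal,
    which costs one unknown. The recursion is solved from large j downwards. Its only freedom is the
    value at a corner z^(n j), which exists when the weight of chi is a multiple of that of H0. For
    symmetric chi this freedom is the power of H0 in the kernel. For antisymmetric chi and n >= 4 it
    pays for the missing unknown and removes one more cosine monomial, provided that the last
    equation does not degenerate; a sign argument with a real and b > 0 excludes this, and b is
    first made positive by a rotation. For n = 3 these weights are solved upwards from the diagonal
    instead. The weight is a minimum of two linear forms so that exchanging z and w preserves it;
    for n >= 4, p and q make z^n as heavy as (z w)^2. The Baker-Campbell-Hausdorff series is
    avoided: generators are added, or recovered as logarithms. *)

Section SeriesZmodule.
Variable K : fieldType.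
Implicit Types f g h : series K.

HB.instance Definition _ := gen_eqMixin (series K).
HB.instance Definition _ := gen_choiceMixin (series K).

Lemma serP f g : f =2 g <-> f = g.
Proof.
by split=> [fg|->] //; apply/funext => i; apply/funext => j; exact: fg.
Qed.

Definition ser_zero : series K := fun _ _ => 0.
Definition ser_opp f : series K := fun i j => - f i j.

Fact ser_addA : associative (@ser_add K).
Proof. by move=> f g h; apply/serP => i j; rewrite /ser_add addrA. Qed.
Fact ser_addC : commutative (@ser_add K).
Proof. by move=> f g; apply/serP => i j; rewrite /ser_add addrC. Qed.
Fact ser_add0 : left_id ser_zero (@ser_add K).
Proof. by move=> f; apply/serP => i j; rewrite /ser_add add0r. Qed.
Fact ser_addN : left_inverse ser_zero ser_opp (@ser_add K).
Proof. by move=> f; apply/serP => i j; rewrite /ser_add addNr. Qed.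

HB.instance Definition _ :=
  GRing.isZmodule.Build (series K) ser_addA ser_addC ser_add0 ser_addN.

(** Ring laws and the product rule are imported from iterated polynomials: a coefficient of a
    product depends on finitely many coefficients of the factors, so it may be computed on
    truncations. *)
Definition ser_poly N f : {poly {poly K}} :=
  \poly_(i < N) \poly_(j < N) f i j.

Lemma coef_ser_poly N f i j :
  (i < N)%N -> (j < N)%N -> (ser_poly N f)`_i`_j = f i j.
Proof. by move=> iN jN; rewrite coef_poly iN coef_poly jN. Qed.

Lemma coef_ser_poly_mul N (p q : {poly {poly K}}) f g :
  (forall i j, (i < N)%N -> (j < N)%N -> p`_i`_j = f i j) ->
  (forall i j, (i < N)%N -> (j < N)%N -> q`_i`_j = g i j) ->
  forall i j, (i < N)%N -> (j < N)%N -> (p * q)`_i`_j =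
    ser_mul f g i j.
Proof.
move=> pf qg i j iN jN; rewrite coefM coef_sum; apply: eq_bigr => k _.
rewrite coefM; apply: eq_bigr => l _.
rewrite pf ?qg //; first by apply: leq_ltn_trans iN; rewrite leq_subr.
- by apply: leq_ltn_trans jN; rewrite leq_subr.
- by apply: leq_trans iN.
- by apply: leq_trans jN.
Qed.

Fact ser_mulA : associative (@ser_mul K).
Proof.
move=> f g h; apply/serP => i j.
pose N := (i + j).+1.
have iN : (i < N)%N by rewrite ltnS leq_addr.
have jN : (j < N)%N by rewrite ltnS leq_addl.
have c f := @coef_ser_poly N f.
rewrite -(coef_ser_poly_mul (c f) (coef_ser_poly_mul (c g) (c h)) iN jN).
by rewrite mulrA (coef_ser_poly_mul (coef_ser_poly_mul (c f) (c g)) (c h)).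
Qed.

Fact ser_mulC : commutative (@ser_mul K).
Proof.
move=> f g; apply/serP => i j.
pose N := (i + j).+1.
have iN : (i < N)%N by rewrite ltnS leq_addr.
have jN : (j < N)%N by rewrite ltnS leq_addl.
have c f := @coef_ser_poly N f.
by rewrite -(coef_ser_poly_mul (c f) (c g) iN jN) mulrC
  (coef_ser_poly_mul (c g) (c f)).
Qed.

Fact ser_mul1 : left_id (ser_one K) (@ser_mul K).
Proof.
move=> f; apply/serP => i j.
rewrite /ser_mul big_ord_recl big_ord_recl /= !subn0 mul1r.
rewrite big1 ?addr0; last by move=> l _; rewrite /ser_one /ser_mono mul0r.
by rewrite big1 ?addr0 // => k _; rewrite big1 // => l _;
  rewrite /ser_one /ser_mono mul0r.
Qed.

Fact ser_mulDl : left_distributive (@ser_mul K) (@ser_add K).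
Proof.
move=> f g h; apply/serP => i j; rewrite /ser_mul /ser_add.
rewrite -big_split; apply: eq_bigr => k _; rewrite -big_split.
by apply: eq_bigr => l _; rewrite mulrDl.
Qed.

Fact ser_one_neq0 : ser_one K != 0.
Proof.
apply/eqP => /serP /(_ 0%N 0%N) /eqP.
by rewrite /ser_one /ser_mono /= oner_eq0.
Qed.

HB.instance Definition _ :=
  GRing.Zmodule_isComNzRing.Build (series K) ser_mulA ser_mulC ser_mul1
    ser_mulDl ser_one_neq0.

Fact ser_scaleA (a b : K) f : ser_scale a (ser_scale b f) = ser_scale (a * b) f.
Proof. by apply/serP => i j; rewrite /ser_scale mulrA. Qed.
Fact ser_scale1 : left_id 1 (@ser_scale K).
Proof. by move=> f; apply/serP => i j; rewrite /ser_scale mul1r. Qed.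
Fact ser_scaleDr : right_distributive (@ser_scale K) (@ser_add K).
Proof. by move=> a f g; apply/serP => i j; rewrite /ser_scale mulrDr. Qed.
Fact ser_scaleDl f : {morph (fun a => ser_scale a f) : a b / a + b >-> ser_add a b}.
Proof. by move=> a b; apply/serP => i j; rewrite /ser_scale mulrDl. Qed.

HB.instance Definition _ := GRing.Zmodule_isLmodule.Build K (series K)
  ser_scaleA ser_scale1 ser_scaleDr ser_scaleDl.

Fact ser_scaleAl (a : K) f g : a *: (f * g) = a *: f * g.
Proof.
apply/serP => i j; rewrite /= /GRing.scale /GRing.mul /= /ser_scale /ser_mul.
rewrite mulr_sumr; apply: eq_bigr => k _; rewrite mulr_sumr.
by apply: eq_bigr => l _; rewrite mulrA.
Qed.

HB.instance Definition _ :=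
  GRing.Lmodule_isLalgebra.Build K (series K) ser_scaleAl.

Lemma serD f g i j : (f + g) i j = f i j + g i j. Proof. by []. Qed.
Lemma serN f i j : (- f) i j = - f i j. Proof. by []. Qed.
Lemma serB f g i j : (f - g) i j = f i j - g i j. Proof. by []. Qed.
Lemma ser0 i j : (0 : series K) i j = 0. Proof. by []. Qed.
Lemma serZ a f i j : (a *: f) i j = a * f i j. Proof. by []. Qed.
Lemma serM f g i j :
  (f * g) i j = \sum_(k < i.+1) \sum_(l < j.+1) f k l * g (i - k)%N (j - l)%N.
Proof. by []. Qed.
Lemma ser1 i j : (1 : series K) i j = ((i == 0%N) && (j == 0%N))%:R.
Proof. by []. Qed.
Lemma ser_sum I (r : seq I) (P : pred I) (F : I -> series K) i j :
  (\sum_(k <- r | P k) F k) i j = \sum_(k <- r | P k) F k i j.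
Proof. by elim/big_rec2 : _ => // k _ y _ <-. Qed.

Lemma ser_addE f g : ser_add f g = f + g. Proof. by []. Qed.
Lemma ser_mulE f g : ser_mul f g = f * g. Proof. by []. Qed.
Lemma ser_scaleE c f : ser_scale c f = c *: f. Proof. by []. Qed.
Lemma ser_expE f n : ser_exp f n = f ^+ n.
Proof. by elim: n => //= n IH; rewrite exprS -IH. Qed.

Fact ser_scaleAr (a : K) f g : a *: (f * g) = f * (a *: g).
Proof. by rewrite mulrC scalerAl mulrC. Qed.
HB.instance Definition _ :=
  GRing.Lalgebra_isAlgebra.Build K (series K) ser_scaleAr.

End SeriesZmodule.

(** * The order of a series and operators continuous for it *)

Section Order.
Variable K : fieldType.
Implicit Types f g h : series K.
Local Notation ord := (@ser_order_ge K).

Lemma ord_0 d : ord d 0. Proof. by []. Qed.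
Lemma ordD d f g : ord d f -> ord d g -> ord d (f + g).
Proof. by move=> df dg i j ij; rewrite serD df ?dg ?addr0. Qed.
Lemma ordN d f : ord d f -> ord d (- f).
Proof. by move=> df i j ij; rewrite serN df ?oppr0. Qed.
Lemma ordB d f g : ord d f -> ord d g -> ord d (f - g).
Proof. by move=> df /ordN; exact: ordD. Qed.
Lemma ordZ d a f : ord d f -> ord d (a *: f).
Proof. by move=> df i j ij; rewrite serZ df ?mulr0. Qed.
Lemma ord_sum d I (r : seq I) (P : pred I) (F : I -> series K) :
  (forall k, P k -> ord d (F k)) -> ord d (\sum_(k <- r | P k) F k).
Proof. by move=> dF; elim/big_ind: _ => // f g; exact: ordD. Qed.
Lemma ord_le d e f : (d <= e)%N -> ord e f -> ord d f.
Proof. by move=> de ef i j ij; apply: ef; exact: leq_trans ij de. Qed.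
Lemma ord_any f : ord 0 f. Proof. by []. Qed.
Lemma ordM d e f g : ord d f -> ord e g -> ord (d + e) (f * g).
Proof.
move=> df eg i j ij; rewrite serM big1 // => -[k /= ki] _.
rewrite big1 // => -[l /= lj] _.
case: (ltnP (k + l) d) => kld; first by rewrite df // mul0r.
by rewrite eg ?mulr0 //; lia.
Qed.
Lemma ordX d f n : ord d f -> ord (n * d) (f ^+ n).
Proof.
move=> df; elim: n => // n IH; rewrite exprS mulSn; exact: ordM.
Qed.
Lemma ord_eq0 f : (forall d, ord d f) -> f = 0.
Proof. by move=> df; apply/serP => i j; exact: (df (i + j).+1). Qed.
Lemma ord_eq f g : (forall d, ord d (f - g)) -> f = g.
Proof. by move/ord_eq0/eqP; rewrite subr_eq0 => /eqP. Qed.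

Lemma mul_mono f c d k l :
  (f * ser_mono K c d) k l = if ((c <= k) && (d <= l))%N then f (k - c)%N (l - d)%N else 0.
Proof.
rewrite mulrC serM; case: ifP => [/andP[ck dl]|H].
  have ck' : (c < k.+1)%N by [].
  have dl' : (d < l.+1)%N by [].
  rewrite (bigD1 (Ordinal ck')) //= (bigD1 (Ordinal dl')) //= {1}/ser_mono.
  rewrite !eqxx mul1r big1 ?addr0; last first.
    move=> l' /eqP ll'; rewrite /ser_mono; case: (_ =P d) => [E|_].
      by case: ll'; apply/val_inj.
    by rewrite andbF mul0r.
  rewrite big1 ?addr0 // => k' /eqP kk'; rewrite big1 // => l' _.
  rewrite /ser_mono; case: (_ =P c) => [E|_]; last by rewrite mul0r.
  by case: kk'; apply/val_inj.
rewrite big1 // => -[k' /= k'k] _; rewrite big1 // => -[l' /= l'l] _.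
rewrite /ser_mono; case: (k' =P c) => [E|_]; last by rewrite mul0r.
case: (l' =P d) => [E'|_]; last by rewrite mul0r.
by move: H; rewrite -E -E' -ltnS k'k -ltnS l'l.
Qed.

Lemma mono_mul a b c d :
  ser_mono K a b * ser_mono K c d = ser_mono K (a + c) (b + d).
Proof.
apply/serP => i j; rewrite mul_mono /ser_mono; case: ifP => [/andP[ci dj]|H].
  by rewrite -(eqn_add2r c (i - c)%N) -(eqn_add2r d (j - d)%N) !subnK.
case: (i =P _) => [E|//]; case: (j =P _) => [E'|//].
by move: H; rewrite E E' !leq_addl.
Qed.

Lemma mono00 : ser_mono K 0 0 = 1. Proof. by []. Qed.

Lemma monoE a b : ser_mono K a b = ser_x K ^+ a * ser_y K ^+ b.
Proof.
have X n : ser_x K ^+ n = ser_mono K n 0.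
  by elim: n => // n IH; rewrite exprS IH mono_mul.
have Y n : ser_y K ^+ n = ser_mono K 0 n.
  by elim: n => // n IH; rewrite exprS IH mono_mul.
by rewrite X Y mono_mul addn0.
Qed.

Definition ser_trunc N f : series K :=
  \sum_(k < N) \sum_(l < N) f k l *: ser_mono K k l.

Lemma ser_trunc_ord N f : ord N (f - ser_trunc N f).
Proof.
move=> i j ij; rewrite serB /ser_trunc ser_sum.
have iN : (i < N)%N by apply: leq_ltn_trans ij; rewrite leq_addr.
have jN : (j < N)%N by apply: leq_ltn_trans ij; rewrite leq_addl.
rewrite (bigD1 (Ordinal iN)) //= ser_sum (bigD1 (Ordinal jN)) //= serZ.
rewrite /ser_mono !eqxx mulr1 big1 ?addr0; last first.
  move=> l /eqP lj; rewrite serZ /= eqxx /=.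
  case: eqP => [jl|]; last by rewrite mulr0.
  by case: lj; apply/val_inj.
rewrite big1 ?addr0 ?subrr //.
move=> k /eqP ki; rewrite ser_sum big1 // => l _; rewrite serZ.
case: eqP => [ik|]; last by rewrite mulr0.
by case: ki; apply/val_inj.
Qed.

(* Continuity for the adic topology given by the order. *)
Definition contlin (A : series K -> series K) :=
  (forall c f g, A (c *: f + g) = c *: A f + A g) /\
  (forall d, exists e, forall f, ord e f -> ord d (A f)).

Lemma contlinD A f g : contlin A -> A (f + g) = A f + A g.
Proof. by case=> lA _; have := lA 1 f g; rewrite !scale1r. Qed.
Lemma contlin0 A : contlin A -> A 0 = 0.
Proof.
by move=> cA; apply: (@addrI _ (A 0)); rewrite -contlinD // !addr0.
Qed.
Lemma contlinZ A c f : contlin A -> A (c *: f) = c *: A f.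
Proof.
by move=> cA; have := cA.1 c f 0; rewrite (contlin0 cA) !addr0.
Qed.
Lemma contlin_sum A I (r : seq I) (P : pred I) (F : I -> series K) :
  contlin A -> A (\sum_(k <- r | P k) F k) = \sum_(k <- r | P k) A (F k).
Proof.
move=> cA; apply: (big_morph A) => [f g|]; [exact: contlinD|exact: contlin0].
Qed.
Lemma contlinB A f g : contlin A -> A (f - g) = A f - A g.
Proof.
by move=> cA; rewrite addrC -scaleN1r cA.1 scaleN1r addrC.
Qed.

(** A truncation differs from f by a series of high order, so continuity reduces the claim to
    monomials. Identities between operators on series are proved in this way rather than on
    coefficients. *)
Lemma contlin_ext A B : contlin A -> contlin B ->
  (forall a b, A (ser_mono K a b) = B (ser_mono K a b)) -> forall f, A f = B f.
Proof.
move=> cA cB AB f; apply: ord_eq => d.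
have [e1 Ae] := cA.2 d; have [e2 Be] := cB.2 d.
pose N := maxn e1 e2.
have AN : A (ser_trunc N f) = B (ser_trunc N f).
  rewrite !contlin_sum //; apply: eq_bigr => k _.
  rewrite !contlin_sum //; apply: eq_bigr => l _.
  by rewrite !contlinZ // AB.
have -> : A f - B f = A (f - ser_trunc N f) - B (f - ser_trunc N f).
  by rewrite (contlinB _ _ cA) (contlinB _ _ cB) AN opprB addrA subrK.
apply: ordB; [apply: Ae|apply: Be]; apply: ord_le (@ser_trunc_ord N f).
- exact: leq_maxl.
- exact: leq_maxr.
Qed.

(** For homomorphisms and derivations, agreement at 1 spreads to all monomials by multiplication by
    x and y. *)
Lemma contlin_ext_xy A B : contlin A -> contlin B -> A 1 = B 1 ->
  (forall f, A f = B f -> A (ser_x K * f) = B (ser_x K * f)) ->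
  (forall f, A f = B f -> A (ser_y K * f) = B (ser_y K * f)) ->
  forall f, A f = B f.
Proof.
move=> cA cB AB1 ABx ABy; apply: contlin_ext => // a b; rewrite monoE.
elim: a => [|a IH]; last by rewrite exprS -mulrA; apply: ABx.
elim: b => [|b IH]; first by rewrite !expr0 mulr1.
by move: IH; rewrite !expr0 !mul1r exprS; exact: ABy.
Qed.

Lemma contlin_id : contlin id.
Proof. by split=> // d; exists d. Qed.
Lemma contlin_comp A B : contlin A -> contlin B -> contlin (fun f => A (B f)).
Proof.
move=> cA cB; split=> [c f g|d]; first by rewrite cB.1 cA.1.
have [e Ae] := cA.2 d; have [e' Be] := cB.2 e.
by exists e' => f /Be /Ae.
Qed.
Lemma contlin_mulr A g : contlin A -> contlin (fun f => A f * g).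
Proof.
move=> cA; split=> [c f h|d]; first by rewrite cA.1 mulrDl scalerAl.
by have [e Ae] := cA.2 d; exists e => f /Ae Af; rewrite -[d]addn0; apply: ordM.
Qed.
Lemma contlin_mull A g : contlin A -> contlin (fun f => g * A f).
Proof.
move=> cA; have := contlin_mulr g cA.
by under eq_fun do rewrite mulrC.
Qed.
Lemma contlin_add A B : contlin A -> contlin B -> contlin (fun f => A f + B f).
Proof.
move=> cA cB; split=> [c f g|d]; first by rewrite cA.1 cB.1 scalerDr addrACA.
have [e Ae] := cA.2 d; have [e' Be] := cB.2 d.
exists (maxn e e') => f ef; apply: ordD; [apply: Ae|apply: Be];
  apply: ord_le ef; [exact: leq_maxl|exact: leq_maxr].
Qed.

End Order.

(** * Partial derivatives and the Jacobian bracket *)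

Section Derivations.
Variable K : fieldType.
Implicit Types f g h : series K.
Local Notation ord := (@ser_order_ge K).
Local Notation dx := (@ser_dx K).
Local Notation dy := (@ser_dy K).

Definition ser_swap (f : series K) : series K := fun i j => f j i.

Lemma ser_swapK f : ser_swap (ser_swap f) = f. Proof. by []. Qed.

Lemma ser_swapM f g : ser_swap (f * g) = ser_swap f * ser_swap g.
Proof. by apply/serP => i j; rewrite /ser_swap !serM exchange_big. Qed.

Lemma ser_dy_swap f : dy f = ser_swap (dx (ser_swap f)).
Proof. by []. Qed.

Lemma ser_dxM f g : dx (f * g) = dx f * g + f * dx g.
Proof.
apply/serP => i j; rewrite /ser_dx serD.
pose N := (i + j).+2.
have c u := @coef_ser_poly K N u.
rewrite -[(f * g) _ _](coef_ser_poly_mul (c f) (c g)); try lia.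
have -> : (ser_poly N f * ser_poly N g)`_i.+1`_j *+ i.+1 =
          ((ser_poly N f * ser_poly N g)^`())`_i`_j.
  by rewrite coef_deriv coefMn.
rewrite derivM coefD coefD.
have d (u : series K) : forall i j, (i < N.-1)%N -> (j < N.-1)%N ->
    (ser_poly N u)^`()`_i`_j = dx u i j.
  by move=> i' j' /= i'N j'N; rewrite coef_deriv coefMn c //; lia.
have c' (u : series K) : forall i j, (i < N.-1)%N -> (j < N.-1)%N ->
    (ser_poly N u)`_i`_j = u i j.
  by move=> i' j' /= i'N j'N; rewrite c //; lia.
by rewrite (coef_ser_poly_mul (d f) (c' g)) ?(coef_ser_poly_mul (c' f) (d g)) //=; lia.
Qed.

Lemma ser_dyM f g : dy (f * g) = dy f * g + f * dy g.
Proof.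
by rewrite !ser_dy_swap ser_swapM ser_dxM -[g in LHS]ser_swapK
  -[f in LHS]ser_swapK; apply/serP => i j; rewrite !serD /ser_swap !serD;
  congr (_ + _); rewrite !serM exchange_big.
Qed.

Lemma ser_dx_lin c f g : dx (c *: f + g) = c *: dx f + dx g.
Proof.
by apply/serP => i j; rewrite /ser_dx !serD !serZ mulrnDl mulrnAr.
Qed.
Lemma ser_dy_lin c f g : dy (c *: f + g) = c *: dy f + dy g.
Proof.
by apply/serP => i j; rewrite /ser_dy !serD !serZ mulrnDl mulrnAr.
Qed.
Lemma ser_dx_ord d f : ord d f -> ord d.-1 (dx f).
Proof. by move=> df i j ij; rewrite /ser_dx df ?mul0rn //; lia. Qed.
Lemma ser_dy_ord d f : ord d f -> ord d.-1 (dy f).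
Proof. by move=> df i j ij; rewrite /ser_dy df ?mul0rn //; lia. Qed.
Lemma contlin_dx : contlin dx.
Proof. by split=> [|d]; [exact: ser_dx_lin|exists d.+1 => f; exact: ser_dx_ord]. Qed.
Lemma contlin_dy : contlin dy.
Proof. by split=> [|d]; [exact: ser_dy_lin|exists d.+1 => f; exact: ser_dy_ord]. Qed.
Lemma ser_dxB f g : dx (f - g) = dx f - dx g.
Proof. exact: contlinB contlin_dx. Qed.
Lemma ser_dyB f g : dy (f - g) = dy f - dy g.
Proof. exact: contlinB contlin_dy. Qed.
Lemma ser_dxy f : dx (dy f) = dy (dx f).
Proof. by apply/serP => i j; rewrite /ser_dx /ser_dy -!mulrnA mulnC. Qed.
Lemma ser_dx_1 : dx 1 = 0.
Proof. by apply/serP => i j; rewrite /ser_dx ser1 /= mul0rn. Qed.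
Lemma ser_dy_1 : dy 1 = 0.
Proof. by apply/serP => i j; rewrite /ser_dy ser1 andbF mul0rn. Qed.
Lemma ser_dx_x : dx (ser_x K) = 1.
Proof.
apply/serP => i j; rewrite /ser_dx /ser_x /ser_mono ser1 eqSS.
by case: eqP => [->|]; rewrite ?mulr1n ?mul0rn.
Qed.
Lemma ser_dy_x : dy (ser_x K) = 0.
Proof. by apply/serP => i j; rewrite /ser_dy /ser_x /ser_mono andbF mul0rn. Qed.
Lemma ser_dx_y : dx (ser_y K) = 0.
Proof. by apply/serP => i j; rewrite /ser_dx /ser_y /ser_mono mul0rn. Qed.
Lemma ser_dy_y : dy (ser_y K) = 1.
Proof.
apply/serP => i j; rewrite /ser_dy /ser_y /ser_mono ser1 eqSS.
by case: (j =P 0%N) => [->|]; rewrite ?mulr1n ?andbF ?mul0rn.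
Qed.

Local Notation jac := (@ser_jac K).

Lemma jacE f g : jac f g = dx f * dy g - dy f * dx g. Proof. by []. Qed.
Lemma jacC f g : jac f g = - jac g f.
Proof. by rewrite !jacE; ring. Qed.
Lemma jacff f : jac f f = 0.
Proof. by rewrite jacE mulrC subrr. Qed.
Lemma jac_linl c f g h : jac (c *: f + g) h = c *: jac f h + jac g h.
Proof.
rewrite !jacE ser_dx_lin ser_dy_lin !mulrDl -!scalerAl scalerBr; ring.
Qed.
Lemma jac_linr c f g h : jac h (c *: f + g) = c *: jac h f + jac h g.
Proof. by rewrite jacC jac_linl (jacC h f) (jacC h g) scalerN opprD. Qed.
Lemma jacDl f g h : jac (f + g) h = jac f h + jac g h.
Proof. by have := jac_linl 1 f g h; rewrite !scale1r. Qed.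
Lemma jacDr f g h : jac h (f + g) = jac h f + jac h g.
Proof. by have := jac_linr 1 f g h; rewrite !scale1r. Qed.
Lemma jacZl c f h : jac (c *: f) h = c *: jac f h.
Proof.
by rewrite !jacE (contlinZ _ _ contlin_dx) (contlinZ _ _ contlin_dy)
  -!scalerAl scalerBr.
Qed.
Lemma jacZr c f h : jac h (c *: f) = c *: jac h f.
Proof. by rewrite jacC jacZl (jacC h f) scalerN. Qed.
Lemma jacBl f g h : jac (f - g) h = jac f h - jac g h.
Proof. by rewrite jacDl -scaleN1r jacZl scaleN1r. Qed.
Lemma jacBr f g h : jac h (f - g) = jac h f - jac h g.
Proof. by rewrite jacDr -scaleN1r jacZr scaleN1r. Qed.
Lemma jacNr f h : jac h (- f) = - jac h f.
Proof. by rewrite -scaleN1r jacZr scaleN1r. Qed.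
Lemma jacNl f h : jac (- f) h = - jac f h.
Proof. by rewrite -scaleN1r jacZl scaleN1r. Qed.
Lemma jac0r h : jac h 0 = 0.
Proof. by rewrite -(scale0r 0) jacZr !scale0r. Qed.
Lemma jac0l h : jac 0 h = 0.
Proof. by rewrite -(scale0r 0) jacZl !scale0r. Qed.
Lemma jacMl f g h : jac (f * g) h = jac f h * g + f * jac g h.
Proof. by rewrite !jacE ser_dxM ser_dyM; ring. Qed.
(** In this form the Jacobi identity says that bracketing with h is a derivation of the bracket,
    which is how it enters [exp_lie_mu]. *)
Lemma jac_jacobi f g h : jac (jac f g) h = jac (jac f h) g + jac f (jac g h).
Proof.
rewrite !jacE !ser_dxB !ser_dyB !ser_dxM !ser_dyM !ser_dxy; ring.
Qed.
Lemma ord_jac a b f g : ord a f -> ord b g -> ord (a + b - 2) (jac f g).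
Proof.
move=> fa gb; apply: (@ord_le _ _ (a.-1 + b.-1)); first by lia.
by apply: ordB; apply: ordM; (apply: ser_dx_ord || apply: ser_dy_ord).
Qed.
Lemma contlin_jacl g : contlin (fun f => jac f g).
Proof.
split=> [c f h|d]; first exact: jac_linl.
by exists d.+2 => f df; apply: ord_le (@ord_jac _ 0 f g df _) => //; lia.
Qed.
Lemma contlin_jacr g : contlin (fun f => jac g f).
Proof.
split=> [c f h|d]; first exact: jac_linr.
by exists d.+2 => f df; apply: ord_le (@ord_jac 0 _ g f _ df) => //; lia.
Qed.

End Derivations.

(** * Substitution *)

Section Substitution.
Variable K : fieldType.
Implicit Types (f g h : series K) (P Q F : smap K).
Local Notation ord := (@ser_order_ge K).
Local Notation dx := (@ser_dx K).
Local Notation dy := (@ser_dy K).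
Local Notation jac := (@ser_jac K).
Local Notation "f \o' P" := (ser_subst f P) (at level 40, left associativity).

Lemma smapP F G : smap_eq F G <-> F = G.
Proof.
split=> [[/serP F1 /serP F2]|->]; last by split.
by case: F G F1 F2 => [F1 F2] [G1 G2] /= -> ->.
Qed.

Lemma ord1_no_constant P : no_constant P <-> ord 1 P.1 /\ ord 1 P.2.
Proof.
split=> [[P1 P2]|[P1 P2]]; last by split; [apply: P1|apply: P2].
by split=> -[|i] [|j].
Qed.

Section NoConstant.
Variables (P : smap K) (P0 : no_constant P).

Let ordP k l : ord (k + l) (P.1 ^+ k * P.2 ^+ l).
Proof.
have [P1 P2] := (ord1_no_constant P).1 P0.
by have := ordM (@ordX _ _ _ k P1) (@ordX _ _ _ l P2); rewrite !muln1.
Qed.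

Lemma ser_substE N f i j : (i + j < N)%N ->
  (f \o' P) i j = (\sum_(k < N) \sum_(l < N) f k l *: (P.1 ^+ k * P.2 ^+ l)) i j.
Proof.
move=> ijN; rewrite ser_sum.
pose G k l := f k l * (P.1 ^+ k * P.2 ^+ l) i j.
have G0 k l : (i + j < k + l)%N -> G k l = 0.
  by move=> kl; rewrite /G ordP // mulr0.
transitivity (\sum_(k < (i + j).+1) \sum_(l < (i + j).+1) G k l).
  by apply: eq_bigr => k _; apply: eq_bigr => l _; rewrite /G !ser_expE.
rewrite (big_ord_widen N (fun k => \sum_(l < (i + j).+1) G k l)) //.
rewrite big_mkcond; apply: eq_bigr => k _; rewrite ser_sum.
rewrite [RHS](eq_bigr (fun l : 'I_N => G k l)) //.
case: ifP => [|/negbT]; rewrite ltnS.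
  move=> _; rewrite (big_ord_widen N (fun l => G k l)) // big_mkcond.
  apply: eq_bigr => l _; case: ifP => // /negbT; rewrite ltnS => lij.
  by rewrite G0 //; lia.
by move=> kij; rewrite big1 // => l _; rewrite G0 //; lia.
Qed.

Lemma ser_subst_ord d f : ord d f -> ord d (f \o' P).
Proof.
move=> df i j ij; rewrite (@ser_substE (i + j).+1) // ser_sum big1 // => k _.
rewrite ser_sum big1 // => l _; rewrite serZ.
case: (ltnP (k + l) d) => kl; first by rewrite df ?mul0r.
by rewrite ordP ?mulr0 //; exact: leq_trans ij kl.
Qed.

Lemma contlin_subst : contlin (fun f => f \o' P).
Proof.
split=> [c f g|d]; last by exists d => f; exact: ser_subst_ord.
apply/serP => i j; rewrite serD serZ !(@ser_substE (i + j).+1) //.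
rewrite -serZ -serD; congr (_ i j); rewrite scaler_sumr -big_split.
apply: eq_bigr => k _ /=; rewrite scaler_sumr -big_split.
by apply: eq_bigr => l _ /=; rewrite scalerA -scalerDl.
Qed.

Lemma ser_subst_mono a b : ser_mono K a b \o' P = P.1 ^+ a * P.2 ^+ b.
Proof.
apply/serP => i j; rewrite (@ser_substE (i + j + a + b).+1); last by lia.
have aN : (a < (i + j + a + b).+1)%N by lia.
have bN : (b < (i + j + a + b).+1)%N by lia.
congr (_ i j); rewrite (bigD1 (Ordinal aN)) //= (bigD1 (Ordinal bN)) //=.
rewrite /ser_mono !eqxx scale1r big1 ?addr0; last first.
  move=> l /eqP lj; rewrite ?eqxx /=; case: eqP => [jl|]; last by rewrite scale0r.
  by case: lj; apply/val_inj.
rewrite big1 ?addr0 // => k /eqP ki; rewrite big1 // => l _.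
case: eqP => [ik|]; last by rewrite scale0r.
by case: ki; apply/val_inj.
Qed.

Lemma ser_subst1E : (1 : series K) \o' P = 1.
Proof. by rewrite -mono00 ser_subst_mono !expr0 mulr1. Qed.
Lemma ser_substx : ser_x K \o' P = P.1.
Proof. by rewrite ser_subst_mono expr1 expr0 mulr1. Qed.
Lemma ser_substy : ser_y K \o' P = P.2.
Proof. by rewrite ser_subst_mono expr0 expr1 mul1r. Qed.

Lemma ser_substM f g : (f * g) \o' P = (f \o' P) * (g \o' P).
Proof.
have cS := contlin_subst.
move: f; apply: contlin_ext.
- exact: (contlin_comp cS (contlin_mulr g (@contlin_id K))).
- exact: contlin_mulr.
move=> a b; move: g; apply: contlin_ext.
- exact: (contlin_comp cS (contlin_mull _ (@contlin_id K))).
- exact: contlin_mull.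
move=> c d; rewrite mono_mul !ser_subst_mono !exprD; ring.
Qed.

Lemma ser_substD f g : (f + g) \o' P = f \o' P + g \o' P.
Proof. exact: contlinD contlin_subst. Qed.
Lemma ser_substB f g : (f - g) \o' P = f \o' P - g \o' P.
Proof. exact: contlinB contlin_subst. Qed.
Lemma ser_substZ c f : (c *: f) \o' P = c *: (f \o' P).
Proof. exact: contlinZ contlin_subst. Qed.
Lemma ser_subst0 : (0 : series K) \o' P = 0.
Proof. exact: contlin0 contlin_subst. Qed.

(** Universal property of substitution. The swap of variables, iterated substitution and exp(L_H)
    are all recognised as substitutions through it. *)
Lemma ser_subst_hom (A : series K -> series K) : contlin A -> A 1 = 1 ->
  (forall f g, A (f * g) = A f * A g) ->
  A (ser_x K) = P.1 -> A (ser_y K) = P.2 -> forall f, A f = f \o' P.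
Proof.
move=> cA A1 AM Ax Ay; apply: contlin_ext_xy => //.
- exact: contlin_subst.
- by rewrite ser_subst1E.
- by move=> f Af; rewrite AM ser_substM Af Ax ser_substx.
- by move=> f Af; rewrite AM ser_substM Af Ay ser_substy.
Qed.

(** Chain rule for an arbitrary continuous derivation: both sides obey the same product rule along
    the substitution, so they only have to agree on 1, x and y. *)
Lemma derivation_subst (D : series K -> series K) : contlin D -> D 1 = 0 ->
  (forall f g, D (f * g) = D f * g + f * D g) -> forall f,
  D (f \o' P) = (dx f \o' P) * D P.1 + (dy f \o' P) * D P.2.
Proof.
move=> cD D1 DM; have cS := contlin_subst.
apply: contlin_ext_xy.
- exact: contlin_comp.
- exact: (contlin_add (contlin_mulr _ (contlin_comp cS (contlin_dx K)))
    (contlin_mulr _ (contlin_comp cS (contlin_dy K)))).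
- rewrite ser_subst1E D1 ser_dx_1 ser_dy_1 !ser_subst0; ring.
- move=> f; rewrite ser_substM DM !ser_dxM !ser_dyM !ser_substD !ser_substM => ->.
  rewrite ser_substx ser_dx_x ser_dy_x ser_subst0 ser_subst1E; ring.
- move=> f; rewrite ser_substM DM !ser_dxM !ser_dyM !ser_substD !ser_substM => ->.
  rewrite ser_substy ser_dx_y ser_dy_y ser_subst0 ser_subst1E; ring.
Qed.

Lemma jac_subst f g : jac (f \o' P) (g \o' P) = (jac f g \o' P) * jac P.1 P.2.
Proof.
have dxS := derivation_subst (contlin_dx K) (ser_dx_1 K) (@ser_dxM K).
have dyS := derivation_subst (contlin_dy K) (ser_dy_1 K) (@ser_dyM K).
rewrite !jacE !dxS !dyS ser_substB !ser_substM; ring.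
Qed.

End NoConstant.


Lemma ser_subst_id f : f \o' smap_id K = f.
Proof. by symmetry; apply: ser_subst_hom => //; exact: contlin_id. Qed.

Lemma no_constant_comp F P : no_constant F -> no_constant P ->
  no_constant (smap_comp F P).
Proof.
rewrite !ord1_no_constant => -[F1 F2] P0.
by split=> /=; apply: ser_subst_ord => //; apply/ord1_no_constant.
Qed.

Lemma ser_subst_comp Q P f : no_constant Q -> no_constant P ->
  f \o' Q \o' P = f \o' smap_comp Q P.
Proof.
move=> Q0 P0; have PQ0 := no_constant_comp Q0 P0.
move: f; apply: ser_subst_hom => //.
- exact: (contlin_comp (contlin_subst P0) (contlin_subst Q0)).
- by rewrite !ser_subst1E.
- by move=> f g; rewrite !ser_substM.
- by rewrite ser_substx.
- by rewrite ser_substy.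
Qed.

Lemma smap_compA F P Q : no_constant P -> no_constant Q ->
  smap_comp (smap_comp F P) Q = smap_comp F (smap_comp P Q).
Proof. by move=> P0 Q0; rewrite /smap_comp /= !ser_subst_comp. Qed.

Lemma smap_comp1 F : smap_comp F (smap_id K) = F.
Proof. by rewrite /smap_comp !ser_subst_id; case: F. Qed.
Lemma smap_comp1l P : no_constant P -> smap_comp (smap_id K) P = P.
Proof. by move=> P0; rewrite /smap_comp ser_substx // ser_substy //; case: P {P0}. Qed.

Lemma smap_ext F G : no_constant F -> no_constant G ->
  (forall f, f \o' F = f \o' G) -> F = G.
Proof.
move=> F0 G0 FG; have := FG (ser_x K); have := FG (ser_y K).
rewrite !ser_substx // !ser_substy //.
by case: F G {F0 G0 FG} => [F1 F2] [G1 G2] /= -> ->.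
Qed.

(** The inverse is again area-preserving: the chain rule for Q o P = id, with the Jacobian of P
    equal to 1, leaves the Jacobian of Q composed with P, and P can be undone. *)
Lemma formal_canonicalP P : formal_canonical P ->
  [/\ no_constant P, jac P.1 P.2 = 1 &
   exists Q, [/\ no_constant Q, smap_comp P Q = smap_id K,
     smap_comp Q P = smap_id K & formal_canonical Q]].
Proof.
case=> P0 [Q [Q0 /smapP PQ /smapP QP]] /serP jP; split=> //.
exists Q; split => //; split=> //.
  by exists P; split=> //; apply/smapP.
apply/serP; have : jac (Q.1 \o' P) (Q.2 \o' P) = 1.
  case: (QP) => -> ->.
  by rewrite jacE ser_dx_x ser_dx_y ser_dy_x ser_dy_y; ring.
rewrite jac_subst // jP mulr1 => /(congr1 (fun f => f \o' Q)).
by rewrite ser_subst_comp // PQ ser_subst_id ser_subst1E.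
Qed.

Lemma formal_canonical_comp P Q : formal_canonical P -> formal_canonical Q ->
  formal_canonical (smap_comp P Q).
Proof.
move=> /formal_canonicalP[P0 jP [P' [P'0 PP' P'P _]]].
move=> /formal_canonicalP[Q0 jQ [Q' [Q'0 QQ' Q'Q _]]].
split; first exact: no_constant_comp.
  exists (smap_comp Q' P'); split; first exact: no_constant_comp.
    apply/smapP; rewrite smap_compA //; last exact: no_constant_comp.
    by rewrite -(smap_compA Q) // QQ' smap_comp1l.
  apply/smapP; rewrite smap_compA //; last exact: no_constant_comp.
  by rewrite -(smap_compA P') // P'P smap_comp1l.
by apply/serP; rewrite /= jac_subst // jP ser_subst1E // jQ mul1r.
Qed.

End Substitution.

(** * Formal flows *)

Section Exponential.
Variable K : numFieldType.
Implicit Types (f g h H : series K) (P Q F : smap K).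
Local Notation ord := (@ser_order_ge K).
Local Notation jac := (@ser_jac K).
Local Notation "f \o' P" := (ser_subst f P) (at level 40, left associativity).

(** Both sides run over the pairs (a, b) with a + b < M. This turns a truncated Cauchy product into
    truncations whose length depends on the first index. *)
Lemma sum_triangle (V : zmodType) (F : nat -> nat -> V) M :
  \sum_(m < M) \sum_(a < m.+1) F a (m - a)%N =
  \sum_(a < M) \sum_(b < M - a) F a b.
Proof.
elim: M => [|M IH]; first by rewrite !big_ord0.
rewrite big_ord_recr IH /=.
have -> : \sum_(a < M.+1) \sum_(b < M.+1 - a) F a b =
    \sum_(a < M.+1) \sum_(b < M - a) F a b + \sum_(a < M.+1) F a (M - a)%N.
  rewrite -big_split; apply: eq_bigr => a _ /=.
  by rewrite subSn ?big_ord_recr //= -ltnS.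
by congr (_ + _); rewrite big_ord_recr /= subnn big_ord0 addr0.
Qed.

(** Divided powers of L_H: with the factorial built in, the Leibniz formula carries no binomial
    coefficients. *)
Definition lie_dp H m g : series K := (m`!%:R)^-1 *: iter m (ser_lie H) g.

Lemma lie_dp0 H g : lie_dp H 0 g = g.
Proof. by rewrite /lie_dp invr1 scale1r. Qed.

Lemma lie_dp1 H g : lie_dp H 1 g = jac g H.
Proof. by rewrite /lie_dp invr1 scale1r. Qed.

Lemma lie_dpS H m g : m.+1%:R *: lie_dp H m.+1 g = jac (lie_dp H m g) H.
Proof.
rewrite /lie_dp iterS jacZl scalerA factS natrM invfM mulrA divff ?mul1r //.
by rewrite pnatr_eq0.
Qed.

Lemma contlin_lie_dp H m : contlin (lie_dp H m).
Proof.
have cL : contlin (iter m (ser_lie H)).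
  elim: m => [|m IH]; first exact: contlin_id.
  exact: (contlin_comp (contlin_jacl H) IH).
split=> [c f g|d]; first by rewrite /lie_dp cL.1 scalerDr !scalerA mulrC.
by have [e He] := cL.2 d; exists e => f /He; exact: ordZ.
Qed.

Section Leibniz.
Variables (H : series K) (mu : series K -> series K -> series K).
Hypothesis mul : forall g, contlin (fun f => mu f g).
Hypothesis mur : forall f, contlin (mu f).
Hypothesis mu_der : forall f g,
  jac (mu f g) H = mu (jac f H) g + mu f (jac g H).

Lemma lie_dp_leibniz m f g :
  lie_dp H m (mu f g) = \sum_(a < m.+1) mu (lie_dp H a f) (lie_dp H (m - a) g).
Proof.
elim: m => [|m IH]; first by rewrite big_ord1 !lie_dp0.
have mS0 : m.+1%:R != 0 :> K by rewrite pnatr_eq0.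
apply: (scalerI mS0); rewrite lie_dpS IH.
rewrite (contlin_sum _ _ _ (contlin_jacl H)).
rewrite (eq_bigr (fun a : 'I_m.+1 =>
    a.+1%:R *: mu (lie_dp H a.+1 f) (lie_dp H (m.+1 - a.+1) g) +
    (m.+1 - a)%:R *: mu (lie_dp H a f) (lie_dp H (m.+1 - a) g))); last first.
  move=> a _; rewrite mu_der -!lie_dpS (contlinZ _ _ (mul _)) subSS.
  by rewrite (contlinZ _ _ (mur _)) -subSn // -ltnS.
rewrite big_split /= scaler_sumr.
(* On the right the factor m.+1 is split as a + (m.+1 - a). The summand a = 0 drops from the first
   half and a = m.+1 from the second, which matches the two halves on the left. *)
rewrite (eq_bigr (fun a : 'I_m.+2 =>
    a%:R *: mu (lie_dp H a f) (lie_dp H (m.+1 - a) g) +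
    (m.+1 - a)%:R *: mu (lie_dp H a f) (lie_dp H (m.+1 - a) g))); last first.
  by move=> a _; rewrite -scalerDl -natrD subnKC // -ltnS.
rewrite big_split /= [X in _ = X + _]big_ord_recl /= scale0r add0r.
by rewrite [X in _ = _ + X]big_ord_recr /= subnn scale0r addr0.
Qed.

End Leibniz.

Section OrderThree.
Variables (H : series K) (H3 : ord 3 H).
Local Notation E := (ser_exp_lie H).

Lemma lie_ord d g : ord d g -> ord d.+1 (jac g H).
Proof. by move=> dg; have := ord_jac dg H3; rewrite addnS addnS addn1 subn2. Qed.

Lemma lie_iter_ord d m g : ord d g -> ord (m + d) (iter m (ser_lie H) g).
Proof. by move=> dg; elim: m => //= m IH; exact: lie_ord. Qed.

Lemma lie_dp_ord d m g : ord d g -> ord (m + d) (lie_dp H m g).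
Proof. by move=> dg; apply/ordZ/lie_iter_ord. Qed.

(** Each bracket with H raises the order by one, so the summands from index M on have order at least
    M + d. *)
Lemma exp_lie_trunc M d g : ord d g -> 
  ord (M + d) (E g - \sum_(m < M) lie_dp H m g).
Proof.
move=> dg i j ij; rewrite serB ser_sum.
have -> : E g i j = \sum_(m < (i + j).+1) lie_dp H m g i j by [].
pose N := (i + j + M).+1; pose G (m : nat) := lie_dp H m g i j.
have G0 m : (i + j < m + d)%N -> G m = 0 by exact: (lie_dp_ord dg).
have widen k : (k <= N)%N -> (i + j < k + d)%N ->
    \sum_(m < k) G m = \sum_(m < N) G m.
  move=> kN ijk; rewrite (big_ord_widen _ G kN) big_mkcond; apply: eq_bigr => m _.
  by case: ltnP => // km; rewrite G0 //; lia.
by rewrite !widen ?subrr // /N; lia.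
Qed.

Lemma exp_lie_truncN M g : ord M (E g - \sum_(m < M) lie_dp H m g).
Proof. by have := @exp_lie_trunc M 0 g; rewrite addn0; apply. Qed.

Lemma exp_lie_ord d g : ord d g -> ord d (E g).
Proof.
move=> dg; have := @exp_lie_trunc 0 d g dg.
by rewrite big_ord0 subr0.
Qed.

Lemma contlin_exp_lie : contlin E.
Proof.
split=> [c f g|d]; last by exists d; exact: exp_lie_ord.
apply/serP => i j; rewrite serD serZ /ser_exp_lie mulr_sumr -big_split.
apply: eq_bigr => m _ /=.
have := congr1 (fun u : series K => u i j) ((contlin_lie_dp H m).1 c f g).
by rewrite serD serZ /lie_dp !serZ.
Qed.

(** An abstract bilinear [mu] on which L_H acts as a derivation treats the product and the bracket
    together. The bound a + b - 2 is the loss of the bracket; the product satisfies it a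
    fortiori. *)
Lemma exp_lie_mu (mu : series K -> series K -> series K) :
  (forall g, contlin (fun f => mu f g)) -> (forall f, contlin (mu f)) ->
  (forall f g, jac (mu f g) H = mu (jac f H) g + mu f (jac g H)) ->
  (forall a b f g, ord a f -> ord b g -> ord (a + b - 2) (mu f g)) ->
  forall f g, E (mu f g) = mu (E f) (E g).
Proof.
move=> mul mur mud muo f g; apply: ord_eq => d.
(* Truncating two orders further makes up for the 2 lost in [mu]. *)
pose M := d.+2; have dM : (d = M - 2)%N by rewrite /M subn2.
have ->: E (mu f g) - mu (E f) (E g) =
    (E (mu f g) - \sum_(m < M) lie_dp H m (mu f g)) -
    (mu (E f - \sum_(a < M) lie_dp H a f) (E g) +
     \sum_(a < M) mu (lie_dp H a f) (E g - \sum_(b < M - a) lie_dp H b g)).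
  rewrite (contlinB _ _ (mul _)) (contlin_sum _ _ _ (mul _)).
  rewrite [X in _ - _ - (_ - _ + X)](eq_bigr (fun a : 'I_M =>
    mu (lie_dp H a f) (E g) -
      \sum_(b < M - a) mu (lie_dp H a f) (lie_dp H b g))); last first.
    by move=> a _; rewrite (contlinB _ _ (mur _)) (contlin_sum _ _ _ (mur _)).
  rewrite sumrB -(sum_triangle (fun a b => mu (lie_dp H a f) (lie_dp H b g))).
  rewrite (eq_bigr _ (fun (m : 'I_M) _ => lie_dp_leibniz mul mur mud m f g)).
  by rewrite addrA subrK opprB addrA subrK.
rewrite dM; apply: ordB.
  apply: ord_le (@exp_lie_truncN M _); exact: leq_subr.
apply: ordD.
  have := muo M 0 _ _ (@exp_lie_truncN M f) (@ord_any _ (E g)).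
  by rewrite addn0.
apply: ord_sum => a _.
have da : ord a (lie_dp H a f).
  by rewrite -[X in ord X _]addn0; exact: lie_dp_ord.
have := muo a (M - a)%N _ _ da (@exp_lie_truncN (M - a) g).
by rewrite subnKC // ltnW.
Qed.

Lemma exp_lieM f g : E (f * g) = E f * E g.
Proof.
apply: (exp_lie_mu (mu := *%R)).
- by move=> h; exact: (contlin_mulr h (@contlin_id K)).
- by move=> h; exact: (contlin_mull h (@contlin_id K)).
- by move=> u v; rewrite jacMl.
- by move=> a b u v au bv; apply: ord_le (ordM au bv); exact: leq_subr.
Qed.

Lemma exp_lie_jac f g : E (jac f g) = jac (E f) (E g).
Proof.
apply: (exp_lie_mu (mu := jac)).
- by move=> h; exact: contlin_jacl.
- by move=> h; exact: contlin_jacr.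
- by move=> u v; exact: jac_jacobi.
- by move=> a b u v; exact: ord_jac.
Qed.

Lemma exp_lie_fix g : jac g H = 0 -> E g = g.
Proof.
move=> gH; apply: ord_eq => d.
have := @exp_lie_truncN d.+1 g; rewrite big_ord_recl lie_dp0.
rewrite big1 ?addr0; last first.
  move=> m _; rewrite lift0 /lie_dp iterSr.
  have -> : ser_lie H g = 0 by exact: gH.
  have -> : iter m (ser_lie H) 0 = 0.
    by elim: (nat_of_ord m) => //= k ->; rewrite /ser_lie jac0l.
  by rewrite scaler0.
by apply: ord_le; exact: leqnSn.
Qed.

Lemma exp_lie1 : E 1 = 1.
Proof.
by apply: exp_lie_fix; rewrite jacE ser_dx_1 ser_dy_1 !mul0r subr0.
Qed.

Lemma time_one_no_constant : no_constant (time_one_map H).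
Proof. by apply/ord1_no_constant; split; apply: exp_lie_ord => -[|i] [|j]. Qed.

Lemma exp_lieE g : E g = g \o' time_one_map H.
Proof.
apply: ser_subst_hom => //; first exact: time_one_no_constant.
- exact: contlin_exp_lie.
- exact: exp_lie1.
- exact: exp_lieM.
Qed.

End OrderThree.

(** Powers of the single operator L_H commute, so this is the binomial theorem on divided powers.
    The double sum is cut along a + b < M, and what is cut off has order at least M. *)
Lemma exp_lie_add s t H g : ord 3 H ->
  ser_exp_lie (s *: H) (ser_exp_lie (t *: H) g) = ser_exp_lie ((s + t) *: H) g.
Proof.
move=> H3; apply: ord_eq => M.
have scale_iter c m u : lie_dp (c *: H) m u = (c ^+ m) *: lie_dp H m u.
  rewrite /lie_dp scalerA mulrC -scalerA; congr (_ *: _).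
  elim: m => [|m IH]; rewrite ?expr0 ?scale1r //= IH /ser_lie jacZl jacZr.
  by rewrite scalerA -exprSr.
have comp a b u : lie_dp H a (lie_dp H b u) =
    'C(a + b, a)%:R *: lie_dp H (a + b) u.
  have fact0 k : k`!%:R != 0 :> K by rewrite pnatr_eq0 -lt0n fact_gt0.
  have linL c v : iter a (ser_lie H) (c *: v) = c *: iter a (ser_lie H) v.
    by elim: a => //= a ->; rewrite /ser_lie jacZl.
  rewrite /lie_dp linL -iterD !scalerA; congr (_ *: _).
  have := bin_fact (leq_addr b a); rewrite addKn => /(congr1 (fun k => k%:R : K)).
  rewrite !natrM => <-; field.
  by rewrite !fact0 pnatr_eq0 -lt0n bin_gt0 leq_addr.
have sH3 : ord 3 (s *: H) by exact: ordZ.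
have tH3 : ord 3 (t *: H) by exact: ordZ.
have stH3 : ord 3 ((s + t) *: H) by exact: ordZ.
have c := contlin_exp_lie sH3.
pose X := \sum_(b < M) lie_dp (t *: H) b g.
have -> : ser_exp_lie (s *: H) (ser_exp_lie (t *: H) g) -
    ser_exp_lie ((s + t) *: H) g =
  ser_exp_lie (s *: H) (ser_exp_lie (t *: H) g - X) -
  (ser_exp_lie ((s + t) *: H) g - \sum_(m < M) lie_dp ((s + t) *: H) m g) +
  \sum_(b < M) (ser_exp_lie (s *: H) (lie_dp (t *: H) b g) -
     \sum_(a < M - b) lie_dp (s *: H) a (lie_dp (t *: H) b g)).
  rewrite (contlinB _ _ c) /X (contlin_sum _ _ _ c) sumrB.
  rewrite -(sum_triangle (fun b a => lie_dp (s *: H) a (lie_dp (t *: H) b g))).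
  rewrite [X in _ = _ + (_ - X)](eq_bigr (fun m : 'I_M =>
    lie_dp ((s + t) *: H) m g)); first by ring.
  move=> m _; rewrite scale_iter exprDn scaler_suml; apply: eq_bigr => b _.
  have bm : (b <= m)%N by rewrite -ltnS.
  rewrite !scale_iter (contlinZ _ _ (contlin_lie_dp H _)) comp !scalerA subnK //.
  by rewrite bin_sub // mulr_natr.
apply: ordD; first apply: ordB.
- by apply: exp_lie_ord => //; exact: exp_lie_truncN.
- exact: exp_lie_truncN.
apply: ord_sum => b _.
have := @exp_lie_trunc (s *: H) sH3 (M - b) b (lie_dp (t *: H) b g).
rewrite subnK; last exact: ltnW.
apply; rewrite -[X in ord X _]addn0; exact: lie_dp_ord.
Qed.

Lemma exp_lie0 g : ser_exp_lie 0 g = g.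
Proof. by apply: exp_lie_fix => //; rewrite jac0r. Qed.

Lemma exp_lieNK H g : ord 3 H ->
  ser_exp_lie (- H) (ser_exp_lie H g) = g.
Proof.
move=> H3; have := exp_lie_add (-1) 1 g H3.
by rewrite addNr scale0r scaleN1r scale1r exp_lie0.
Qed.

Lemma exp_lieKN H g : ord 3 H ->
  ser_exp_lie H (ser_exp_lie (- H) g) = g.
Proof.
by move=> H3; rewrite -{1}[H]opprK exp_lieNK //; exact: ordN.
Qed.

Lemma exp_lie_iter H n g : ord 3 H ->
  iter n (ser_exp_lie H) g = ser_exp_lie (n%:R *: H) g.
Proof.
move=> H3; elim: n => [|n IH]; first by rewrite scale0r exp_lie0.
by rewrite iterS IH -{1}[H]scale1r exp_lie_add // -natr1 addrC.
Qed.

Lemma time_one_canonical H : ord 3 H -> formal_canonical (time_one_map H).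
Proof.
move=> H3; have N3 : ord 3 (- H) by exact: ordN.
have H0 := time_one_no_constant H3; have N0 := time_one_no_constant N3.
split=> //.
  exists (time_one_map (- H)); split=> //; apply/smapP; rewrite /smap_comp /=;
  by rewrite -!exp_lieE // ?exp_lieNK // ?exp_lieKN.
apply/serP; rewrite /= -exp_lie_jac // jacE ser_dx_x ser_dx_y ser_dy_x ser_dy_y.
by rewrite mulr1 mulr0 subr0 exp_lie1.
Qed.

(** A canonical S preserves the bracket, so substituting S carries L_H to L_(H o S) term by term. *)
Lemma exp_lie_subst S H g : formal_canonical S -> ord 3 H ->
  ser_exp_lie H g \o' S = ser_exp_lie (H \o' S) (g \o' S).
Proof.
move=> /formal_canonicalP[S0 jS _] H3.
have HS3 : ord 3 (H \o' S) by exact: ser_subst_ord.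
have cS := contlin_subst S0.
apply: ord_eq => M.
have -> : ser_exp_lie H g \o' S - ser_exp_lie (H \o' S) (g \o' S) =
  (ser_exp_lie H g - \sum_(m < M) lie_dp H m g) \o' S -
  (ser_exp_lie (H \o' S) (g \o' S) -
    \sum_(m < M) lie_dp (H \o' S) m (g \o' S)).
  rewrite (contlinB _ _ cS) (contlin_sum _ _ _ cS).
  rewrite [X in _ = _ - X - _](eq_bigr (fun m : 'I_M =>
    lie_dp (H \o' S) m (g \o' S))); first by ring.
  move=> m _; rewrite /lie_dp (contlinZ _ _ cS); congr (_ *: _).
  elim: (nat_of_ord m) => //= k <-.
  by rewrite /ser_lie jac_subst // jS mulr1.
by apply: ordB; [apply: ser_subst_ord => //|]; exact: exp_lie_truncN.
Qed.

End Exponential.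

(** * Filtrations and logarithms *)

Section Filtrations.
Variable K : numFieldType.
Implicit Types (f g h H : series K) (P Q F : smap K).
Local Notation ord := (@ser_order_ge K).
Local Notation jac := (@ser_jac K).
Local Notation E := (@ser_exp_lie K).

(* [s] is the weight lost in a bracket, and weight [c N] implies order [N]. *)
Record filtration (F : nat -> series K -> Prop) (s c : nat) : Prop := {
  fil0 : forall w, F w 0;
  filD : forall w f g, F w f -> F w g -> F w (f + g);
  filZ : forall w a f, F w f -> F w (a *: f);
  fil_le : forall w w' f, (w <= w')%N -> F w' f -> F w f;
  fil_jac : forall a b f g, F a f -> F (b + s)%N g -> F (a + b)%N (jac f g);
  fil_closed : forall w f, (forall N, exists g, F w g /\ ord N (f - g)) -> F w f;
  fil_sep : forall N f, F (c * N)%N f -> ord N f }.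

Lemma ord_filtration : filtration ord 2 1.
Proof.
split=> //.
- by move=> w f g; exact: ordD.
- by move=> w a f; exact: ordZ.
- by move=> w w' f; exact: ord_le.
- by move=> a b f g fa gb; have := ord_jac fa gb; rewrite addnA addnK.
- move=> w f fN; have [g [wg Ng]] := fN w.
  by rewrite -(subrK g f); exact: ordD.
- by move=> N f; rewrite mul1n.
Qed.

Section Theory.
Variables (F : nat -> series K -> Prop) (s c : nat).
Hypothesis filF : filtration F s c.

Lemma filN w f : F w f -> F w (- f).
Proof. by rewrite -scaleN1r; exact: (filZ filF). Qed.
Lemma filB w f g : F w f -> F w g -> F w (f - g).
Proof. by move=> wf /filN; exact: (filD filF). Qed.
Lemma fil_sum w I (r : seq I) (P : pred I) (G : I -> series K) :
  (forall k, P k -> F w (G k)) -> F w (\sum_(k <- r | P k) G k).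
Proof.
move=> wG; apply: (big_ind (F w)) => //; first exact: (fil0 filF).
by move=> f g; exact: (filD filF).
Qed.

Lemma fil_eq0 f : (forall w, F w f) -> f = 0.
Proof. by move=> wf; apply: ord_eq0 => d; exact: (fil_sep filF). Qed.

Lemma fil_lie_iter chi a g m : F (1 + s)%N chi -> F a g ->
  F (a + m)%N (iter m (ser_lie chi) g).
Proof.
move=> Fchi Fg; elim: m => [|m IH]; first by rewrite addn0.
by rewrite iterS addnS -addn1; exact: (fil_jac filF).
Qed.

(** Expanding the difference, every term contains a bracket with eta, which gains v, and m further
    brackets, each gaining at least 1. *)
Lemma fil_lie_iter_diff chi eta v a g m : (0 < v)%N ->
  F (1 + s)%N chi -> F (v + s)%N eta -> F a g ->
  F (a + v + m)%N
    (iter m.+1 (ser_lie (chi + eta)) g - iter m.+1 (ser_lie chi) g).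
Proof.
move=> v0 Fchi Feta Fg.
have Fce : F (1 + s)%N (chi + eta).
  by apply: (filD filF) => //; apply: (fil_le filF) Feta; rewrite leq_add2r.
elim: m => [|m IH].
  by rewrite /= /ser_lie jacDr addrAC subrr add0r addn0; exact: (fil_jac filF).
rewrite [iter m.+2 _ _]iterS [iter m.+2 (ser_lie chi) _]iterS.
set X := iter m.+1 _ g in IH *; set Y := iter m.+1 _ g in IH *.
have -> : ser_lie (chi + eta) X - ser_lie chi Y =
    jac (X - Y) (chi + eta) + jac Y eta.
  by rewrite /ser_lie jacBl !jacDr; ring.
apply: (filD filF).
  by rewrite addnS -addn1; exact: (fil_jac filF).
have -> : (a + v + m.+1 = a + m.+1 + v)%N by rewrite addnAC.
by apply: (fil_jac filF) => //; exact: fil_lie_iter.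
Qed.

(** The first-order term of the exponential contributes exactly {g, eta}; in later terms eta comes
    with at least one more bracket, which gains weight. Generators can therefore be corrected by
    addition. *)
Lemma exp_lie_perturb chi eta v a g : (0 < v)%N ->
  ord 3 chi -> ord 3 eta -> F (1 + s)%N chi -> F (v + s)%N eta -> F a g ->
  F (a + v + 1)%N (E (chi + eta) g - E chi g - jac g eta).
Proof.
move=> v0 c3 e3 Fchi Feta Fg.
have ce3 : ord 3 (chi + eta) by exact: ordD.
apply: (fil_closed filF) => N.
pose D m := lie_dp (chi + eta) m g - lie_dp chi m g.
exists (\sum_(m < N) D m.+2); split.
  apply: fil_sum => m _; rewrite /D /lie_dp -scalerBr; apply: (filZ filF).
  apply: (fil_le filF) (fil_lie_iter_diff m.+1 v0 Fchi Feta Fg).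
  by rewrite leq_add2l.
apply: (@ord_le _ _ N.+2); first by rewrite -addn2 leq_addr.
have -> : E (chi + eta) g - E chi g - jac g eta - \sum_(m < N) D m.+2 =
    (E (chi + eta) g - \sum_(m < N.+2) lie_dp (chi + eta) m g) -
    (E chi g - \sum_(m < N.+2) lie_dp chi m g).
  have : \sum_(m < N.+2) D m = jac g eta + \sum_(m < N) D m.+2.
    rewrite big_ord_recl big_ord_recl /= /bump /= /D !lie_dp0 subrr add0r.
    by congr (_ + _); rewrite !lie_dp1 jacDr addrAC subrr add0r.
  move/(congr1 (fun X => X - jac g eta)); rewrite addrAC subrr add0r => <-.
  rewrite sumrB; ring.
by apply: ordB; exact: exp_lie_truncN.
Qed.

Lemma exp_lie_first eta v a g : (0 < v)%N -> ord 3 eta -> F (v + s)%N eta ->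
  F a g -> F (a + v + 1)%N (E eta g - g - jac g eta).
Proof.
move=> v0 e3 Feta Fg.
have := exp_lie_perturb v0 (@ord_0 _ 3) e3 (fil0 filF _) Feta Fg.
by rewrite add0r exp_lie0.
Qed.

Lemma exp_lie_close eta v a g : (0 < v)%N -> ord 3 eta -> F (v + s)%N eta ->
  F a g -> F (a + v)%N (E eta g - g).
Proof.
move=> v0 e3 Feta Fg; rewrite -(subrK (jac g eta) (E eta g - g)).
apply: (filD filF); last exact: (fil_jac filF).
by apply: (fil_le filF) (exp_lie_first v0 e3 Feta Fg); rewrite leq_addr.
Qed.

Lemma exp_lie_fil eta a g : ord 3 eta -> F (1 + s)%N eta ->
  F a g -> F a (E eta g).
Proof.
move=> e3 Feta Fg; rewrite -(subrK g (E eta g)); apply: (filD filF) => //.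
by apply: (fil_le filF) (exp_lie_close _ e3 Feta Fg); rewrite ?leq_addr.
Qed.

Lemma fil_limit (u : nat -> series K) :
  (forall k, F k (u k.+1 - u k)) -> exists chi, forall k, F k (chi - u k).
Proof.
move=> Fu.
have Fle k m : (k <= m)%N -> F k (u m - u k).
  move/subnK <-; elim: (m - k)%N => [|d IH].
    by rewrite subrr; exact: (fil0 filF).
  rewrite addSn -(subrK (u (d + k)%N) (u _)) -addrA; apply: (filD filF) => //.
  by apply: (fil_le filF) (Fu _); rewrite leq_addl.
(* Weight c N implies order N, so the coefficient at (i, j) no longer changes from index c * (i +
   j).+1 on. *)
exists (fun i j => u (c * (i + j).+1)%N i j) => k.
apply: (fil_closed filF) => N.
pose M := maxn k (c * N); exists (u M - u k); split.
  by apply: Fle; exact: leq_maxl.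
move=> i j ij; rewrite !serB opprB addrA subrK.
have := Fle (c * (i + j).+1)%N M; rewrite leq_max leq_mul2l ij !orbT => /(_ isT).
move/(fil_sep filF) => /(_ i j (ltnSn _)) /eqP.
by rewrite serB -oppr_eq0 opprB => /eqP.
Qed.

(** Successive approximation with dependent choice. Nothing is claimed about Q at the limit: the
    limit is only close to approximants that satisfy Q, and each use passes to the limit itself. *)
Lemma fil_iterate (Q : nat -> series K -> Prop) chi0 : Q 0%N chi0 ->
  (forall k chi, Q k chi -> exists chi', Q k.+1 chi' /\ F k (chi' - chi)) ->
  exists chi, forall k, exists chik, Q k chik /\ F k (chi - chik).
Proof.
move=> Q0 QS.
have next k (x : {chi | Q k chi}) :
    {y : {chi | Q k.+1 chi} | F k (sval y - sval x)}.
  apply: cid; case: x => x Qx; have [y [Qy Fy]] := QS _ _ Qx.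
  by exists (exist _ y Qy).
pose u := nat_rect (fun k => {chi | Q k chi}) (exist _ chi0 Q0)
  (fun k x => sval (next k x)).
have [chi Fchi] := @fil_limit (fun k => sval (u k)) (fun k => svalP (next k (u k))).
by exists chi => k; exists (sval (u k)); split; [exact: svalP|exact: Fchi].
Qed.

End Theory.

(** Uniqueness of formal logarithms. By [exp_lie_perturb] the lowest part of A - B appears in the
    images of x and y as its two partial derivatives, so it vanishes, and the order of A - B rises
    by one. *)
Lemma exp_lie_inj A B : ord 3 A -> ord 3 B ->
  (forall g, E A g = E B g) -> A = B.
Proof.
move=> A3 B3 AB; apply: ord_eq => d; elim: d => // d IH.
case: (ltnP d 3) => d3; first by apply: ord_le (ordB A3 B3).
set eta := A - B in IH *.
have e3 : ord 3 eta by apply: ord_le IH.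
have Jeta g a : ord a g -> ord (a + d - 1)%N (jac g eta).
  move=> ag.
  have Fv : ord (d - 2 + 2)%N eta by rewrite subnK // ltnW.
  have v0 : (0 < d - 2)%N by rewrite subn_gt0.
  have := exp_lie_perturb ord_filtration v0 B3 e3 B3 Fv ag.
  rewrite [B + eta]addrC subrK AB subrr add0r => /ordN.
  by rewrite opprK; apply: ord_le; lia.
have dyeta : ord d (ser_dy eta).
  have := @Jeta (ser_x K) 1%N; rewrite jacE ser_dx_x ser_dy_x.
  by rewrite mul1r mul0r subr0 addnC addnK; apply => -[|i] [|j].
have dxeta : ord d (ser_dx eta).
  have := @Jeta (ser_y K) 1%N; rewrite jacE ser_dx_y ser_dy_y.
  rewrite mul1r mul0r sub0r addnC addnK => Jy.
  by rewrite -[ser_dx _]opprK; apply/ordN/Jy => -[|i] [|j].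
move=> [|i] [|j] ij; first by apply: e3.
- have /eqP := dyeta 0%N j ij; rewrite /ser_dy -mulr_natr mulf_eq0 pnatr_eq0.
  by rewrite orbF => /eqP.
- have /eqP := dxeta i 0%N ij; rewrite /ser_dx -mulr_natr mulf_eq0 pnatr_eq0.
  by rewrite orbF => /eqP.
- have ij' : (i + j.+1 < d)%N by [].
  have /eqP := dxeta i j.+1 ij'; rewrite /ser_dx -mulr_natr mulf_eq0 pnatr_eq0.
  by rewrite orbF => /eqP.
Qed.

(** Poincare lemma in the lowest degree: eta is homogeneous of degree k + 1, its coefficients with a
    positive power of y are integrated from e1, the pure power of x from e2, and the divergence
    condition makes the two choices agree. *)
Lemma divfree_hamiltonian k e1 e2 : ord k e1 -> ord k e2 ->
  ord k (ser_dx e1 + ser_dy e2) -> exists eta,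
  [/\ ord k.+1 eta, ord k.+1 (ser_dy eta - e1) & ord k.+1 (- ser_dx eta - e2)].
Proof.
move=> k1 k2 div.
pose eta : series K := fun i j => if (i + j == k.+1)%N then
  if j is j'.+1 then e1 i j' / j%:R else - (e2 i.-1 j / i%:R) else 0.
exists eta; split.
- by move=> i j ij; rewrite /eta; case: eqP => // ij'; move: ij; rewrite ij' ltnn.
- move=> i j; rewrite ltnS leq_eqVlt => /orP[/eqP ij|ij].
    rewrite serB /ser_dy /eta addnS ij eqxx -[X in X - _]mulr_natr divfK ?subrr //.
    by rewrite pnatr_eq0.
  rewrite serB k1 // subr0 /ser_dy /eta addnS eqSS.
  by case: eqP => [ij'|]; rewrite ?mul0rn //; move: ij; rewrite ij' ltnn.
- move=> i j; rewrite ltnS leq_eqVlt => /orP[/eqP ij|ij].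
    rewrite serB serN /ser_dx /eta addSn ij eqxx; case: j ij => [|j] ij /=.
      rewrite -[X in - X - _]mulr_natr mulNr divfK ?opprK ?subrr //.
      by rewrite pnatr_eq0.
    have ij' : (i + j < k)%N by rewrite -ij addnS.
    have := div i j ij'; rewrite serD /ser_dx /ser_dy => /eqP.
    rewrite addr_eq0 => /eqP H.
    rewrite -mulrnAl H mulNr opprK -[X in X / _]mulr_natr mulfK ?subrr //.
    by rewrite pnatr_eq0.
  rewrite serB k2 // subr0 serN /ser_dx /eta addSn eqSS.
  by case: eqP => [ij'|]; rewrite ?mul0rn ?oppr0 //; move: ij; rewrite ij' ltnn.
Qed.

(** Existence of formal logarithms. The error of the current approximation is divergence-free in
    lowest degree because both maps have Jacobian 1; it is thus a Hamiltonian field, whose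
    Hamiltonian is added to the generator. *)
Lemma exp_lie_log P : jac P.1 P.2 = 1 ->
  ord 2 (P.1 - ser_x K) -> ord 2 (P.2 - ser_y K) ->
  exists2 chi, ord 3 chi & P = time_one_map chi.
Proof.
move=> jP Px Py.
pose Q k chi := [/\ ord 3 chi, ord k.+2 (P.1 - E chi (ser_x K)) &
  ord k.+2 (P.2 - E chi (ser_y K))].
have x1 : ord 1 (ser_x K) by move=> [|i] [|j].
have y1 : ord 1 (ser_y K) by move=> -[|i] [|j].
have [||chi Qchi] := @fil_iterate _ _ _ ord_filtration Q 0.
- by split; rewrite ?exp_lie0.
- move=> k chi [c3 e1k e2k].
  set X := E chi (ser_x K) in e1k *; set Y := E chi (ser_y K) in e2k *.
  set e1 := P.1 - X in e1k *; set e2 := P.2 - Y in e2k *.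
  have c3' : ord (1 + 2) chi by [].
  have Xx : ord 2 (X - ser_x K).
    by have := exp_lie_close ord_filtration (ltnSn 0) c3 c3' x1.
  have Yy : ord 2 (Y - ser_y K).
    by have := exp_lie_close ord_filtration (ltnSn 0) c3 c3' y1.
  have XY : jac X Y = 1.
    rewrite -exp_lie_jac // jacE ser_dx_x ser_dy_x ser_dy_y mul0r subr0 mulr1.
    exact: exp_lie1.
  (* Comparing jac (X + e1) (Y + e2) = 1 with jac X Y = 1 leaves the divergence of the error plus
     products of higher order. *)
  have div : ord k.+2 (ser_dx e1 + ser_dy e2).
    have -> : ser_dx e1 + ser_dy e2 =
        - (jac (X - ser_x K) e2 + jac e1 (Y - ser_y K) + jac e1 e2).
      have H : jac X e2 + (jac e1 Y + jac e1 e2) = 0.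
        have : jac (X + e1) (Y + e2) = 1 by rewrite ![_ + (_ - _)]addrC !subrK.
        rewrite jacDl !jacDr XY -addrA => /(congr1 (fun u => - 1 + u)).
        by rewrite addKr addNr.
      rewrite jacBl jacBr.
      have -> : jac (ser_x K) e2 = ser_dy e2.
        by rewrite jacE ser_dx_x ser_dy_x mul1r mul0r subr0.
      have -> : jac e1 (ser_y K) = ser_dx e1.
        by rewrite jacE ser_dx_y ser_dy_y mulr1 mulr0 subr0.
      by apply/eqP; rewrite -subr_eq0 opprK -H; apply/eqP; ring.
    apply: ordN; apply: ordD; first apply: ordD.
    - by have := ord_jac Xx e2k; rewrite addnC addnK.
    - by have := ord_jac e1k Yy; rewrite addnK.
    - by apply: ord_le (ord_jac e1k e2k); lia.
  have [eta [ek eta1 eta2]] := divfree_hamiltonian e1k e2k div.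
  have e3 : ord 3 eta by apply: ord_le ek.
  have ek' : ord (k.+1 + 2)%N eta by rewrite addn2.
  have Px' := exp_lie_perturb ord_filtration (ltn0Sn k) c3 e3 c3 ek' x1.
  have Py' := exp_lie_perturb ord_filtration (ltn0Sn k) c3 e3 c3 ek' y1.
  exists (chi + eta); split; last first.
    by rewrite addrC addKr; apply: ord_le ek; lia.
  rewrite jacE ser_dx_x ser_dy_x mul1r mul0r subr0 in Px'.
  rewrite jacE ser_dx_y ser_dy_y mul0r mul1r sub0r in Py'.
  split; first exact: ordD.
    have -> : P.1 - E (chi + eta) (ser_x K) =
      - ((ser_dy eta - e1) + (E (chi + eta) (ser_x K) - X - ser_dy eta)).
      by rewrite /e1; ring.
    by apply/ordN/ordD => //; apply: ord_le Px'; lia.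
  have -> : P.2 - E (chi + eta) (ser_y K) =
    - ((- ser_dx eta - e2) + (E (chi + eta) (ser_y K) - Y - - ser_dx eta)).
    by rewrite /e2; ring.
  by apply/ordN/ordD => //; apply: ord_le Py'; lia.
have c3 : ord 3 chi.
  have [chi3 [[c3 _ _] cc]] := Qchi 3%N.
  by rewrite -(subrK chi3 chi); exact: ordD.
exists chi => //.
have H g (p : series K) :
    ord 1 g -> (forall k chik, Q k chik -> ord k.+2 (p - E chik g)) -> p = E chi g.
  move=> g1 Hk; apply: ord_eq => d.
  have [chid [Qd cd]] := Qchi d.+3.
  have [cd3 _ _] := Qd.
  set eta := chi - chid in cd.
  have e3 : ord 3 eta by apply: ord_le cd.
  have ed : ord (d.+1 + 2) eta by rewrite addn2.
  have := exp_lie_perturb ord_filtration (ltn0Sn d) cd3 e3 cd3 ed g1.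
  rewrite [chid + eta]addrC subrK => pert.
  have -> : p - E chi g = (p - E chid g) - (E chi g - E chid g - jac g eta)
     - jac g eta by ring.
  apply: ordB; first apply: ordB.
  - by apply: ord_le (Hk _ _ Qd); lia.
  - by apply: ord_le pert; lia.
  - by apply: ord_le (ord_jac g1 ed); lia.
rewrite /time_one_map -(H (ser_x K) P.1) // -?(H (ser_y K) P.2) //; first by case: (P).
- by move=> k chik [].
- by move=> k chik [].
Qed.

End Filtrations.

(** * Conjugacy of rotated flows *)

Section Conjugacy.
Variable K : numFieldType.
Implicit Types (f g h H : series K) (P Q F S : smap K).
Local Notation ord := (@ser_order_ge K).
Local Notation jac := (@ser_jac K).
Local Notation E := (@ser_exp_lie K).
Local Notation "f \o' P" := (ser_subst f P) (at level 40, left associativity).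

Lemma formal_canonical_surj S g : formal_canonical S -> exists f, f \o' S = g.
Proof.
move=> /formal_canonicalP[S0 _ [Q [Q0 _ QS _]]].
by exists (g \o' Q); rewrite ser_subst_comp // QS ser_subst_id.
Qed.

Variables (Rm : smap K) (n : nat).
Hypothesis Rm_can : formal_canonical Rm.
Hypothesis Rm_n : forall f, iter n (fun f => f \o' Rm) f = f.
Hypothesis n0 : (0 < n)%N.

Let Rm0 : no_constant Rm. Proof. by case: Rm_can. Qed.

Lemma subst_time_one_comp H f : ord 3 H ->
  f \o' smap_comp Rm (time_one_map H) = E H (f \o' Rm).
Proof.
by move=> H3; rewrite -ser_subst_comp ?exp_lieE //; exact: time_one_no_constant.
Qed.

(** An invariant H makes exp(L_H) commute with the rotation, so the rotations can be collected, and
    n of them cancel. *)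
Lemma iter_rotated_flow H f : ord 3 H -> H \o' Rm = H ->
  iter n (fun f => E H (f \o' Rm)) f = E (n%:R *: H) f.
Proof.
move=> H3 HR; rewrite -exp_lie_iter //.
have comm m g : iter m (E H) g \o' Rm = iter m (E H) (g \o' Rm).
  by elim: m => //= m <-; rewrite exp_lie_subst // HR.
rewrite -[in RHS](Rm_n f); elim: n => //= m ->.
by rewrite comm.
Qed.

(* The n-th iterate of R o Phi_H is Phi_(n H), whose logarithm is unique. *)
Lemma conjugate_hamiltonian H H' S : ord 3 H -> ord 3 H' ->
  H \o' Rm = H -> H' \o' Rm = H' -> formal_canonical S ->
  smap_comp (smap_comp Rm (time_one_map H)) S =
    smap_comp S (smap_comp Rm (time_one_map H')) ->
  H \o' S = H' /\ forall f, f \o' S \o' Rm = f \o' Rm \o' S.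
Proof.
move=> H3 H'3 HR H'R Scan conj.
have [S0 _ _] := formal_canonicalP Scan.
have H0 := time_one_no_constant H3; have H'0 := time_one_no_constant H'3.
have RH0 := no_constant_comp Rm0 H0; have RH'0 := no_constant_comp Rm0 H'0.
have conjf f : E H (f \o' Rm) \o' S = E H' (f \o' S \o' Rm).
  by rewrite -!subst_time_one_comp // !ser_subst_comp // conj.
have HS : H \o' S = H'.
  have HS3 : ord 3 (H \o' S) by exact: ser_subst_ord.
  have nK0 : n%:R != 0 :> K by rewrite pnatr_eq0 -lt0n.
  apply: (scalerI nK0); apply: exp_lie_inj; [exact: ordZ|exact: ordZ|move=> g].
  have [f <-] := formal_canonical_surj g Scan.
  rewrite -ser_substZ // -exp_lie_subst //; last exact: ordZ.
  rewrite -!iter_rotated_flow //.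
  by elim: n => //= m <-; rewrite conjf.
split=> // f; move: (conjf f); rewrite exp_lie_subst // HS.
move/(congr1 (E (- H'))); by rewrite !exp_lieNK.
Qed.

Lemma hamiltonian_conjugate H H' S : ord 3 H -> ord 3 H' ->
  formal_canonical S -> H \o' S = H' ->
  (forall f, f \o' S \o' Rm = f \o' Rm \o' S) ->
  smap_comp (smap_comp Rm (time_one_map H)) S =
    smap_comp S (smap_comp Rm (time_one_map H')).
Proof.
move=> H3 H'3 Scan HS SR; have [S0 _ _] := formal_canonicalP Scan.
have H0 := time_one_no_constant H3; have H'0 := time_one_no_constant H'3.
have RH0 := no_constant_comp Rm0 H0; have RH'0 := no_constant_comp Rm0 H'0.
apply: smap_ext; try exact: no_constant_comp.
move=> f; rewrite -!ser_subst_comp // -!exp_lieE //.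
by rewrite exp_lie_subst // HS SR.
Qed.

End Conjugacy.

(** Both G and G' are conjugate to F, so the inverse of the first change followed by the second
    conjugates them with each other. *)
Lemma formally_conjugate_transfer (K : numFieldType) (F G G' : smap K) P :
  no_constant G -> formal_canonical P ->
  smap_comp F P = smap_comp P G -> formally_conjugate F G' -> no_constant G' ->
  exists2 S, formal_canonical S & smap_comp G S = smap_comp S G'.
Proof.
move=> G0 Pcan FP [P' [P'can /smapP FP']] G'0.
have [P0 _ [Q [Q0 PQ QP Qcan]]] := formal_canonicalP Pcan.
have [P'0 _ _] := formal_canonicalP P'can.
have S0 : no_constant (smap_comp Q P') by exact: no_constant_comp.
exists (smap_comp Q P'); first exact: formal_canonical_comp.
have PGS : smap_comp P (smap_comp G (smap_comp Q P')) = smap_comp P' G'.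
  rewrite -smap_compA // -FP -(smap_compA (smap_comp F P)) //.
  by rewrite (smap_compA F) // PQ smap_comp1.
have GS0 := no_constant_comp G0 S0.
by rewrite (smap_compA Q) // -PGS -(smap_compA Q) // QP smap_comp1l.
Qed.

(** * Complex coordinates *)

Section MapSeries.
Variables (K L : fieldType) (phi : {rmorphism K -> L}).
Implicit Types f g : series K.

Definition ser_map f : series L := fun i j => phi (f i j).
Definition smap_map (P : smap K) : smap L := (ser_map P.1, ser_map P.2).

Lemma ser_mapD f g : ser_map (f + g) = ser_map f + ser_map g.
Proof. by apply/serP => i j; rewrite /ser_map !serD rmorphD. Qed.
Lemma ser_mapB f g : ser_map (f - g) = ser_map f - ser_map g.
Proof. by apply/serP => i j; rewrite /ser_map !serB rmorphB. Qed.
Lemma ser_mapZ c f : ser_map (c *: f) = phi c *: ser_map f.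
Proof. by apply/serP => i j; rewrite /ser_map !serZ rmorphM. Qed.
Lemma ser_mapM f g : ser_map (f * g) = ser_map f * ser_map g.
Proof.
apply/serP => i j; rewrite /ser_map !serM rmorph_sum; apply: eq_bigr => k _.
by rewrite rmorph_sum; apply: eq_bigr => l _; rewrite rmorphM.
Qed.
Lemma ser_map_mono a b : ser_map (ser_mono K a b) = ser_mono L a b.
Proof. by apply/serP => i j; rewrite /ser_map /ser_mono rmorph_nat. Qed.
Lemma ser_map1 : ser_map 1 = 1. Proof. exact: ser_map_mono. Qed.
Lemma ser_mapX f k : ser_map (f ^+ k) = ser_map f ^+ k.
Proof.
by elim: k => [|k IH]; rewrite ?expr0 ?ser_map1 // !exprS ser_mapM IH.
Qed.
Lemma ser_map_dx f : ser_map (ser_dx f) = ser_dx (ser_map f).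
Proof. by apply/serP => i j; rewrite /ser_map /ser_dx rmorphMn. Qed.
Lemma ser_map_dy f : ser_map (ser_dy f) = ser_dy (ser_map f).
Proof. by apply/serP => i j; rewrite /ser_map /ser_dy rmorphMn. Qed.
Lemma ser_map_jac f g : ser_map (ser_jac f g) = ser_jac (ser_map f) (ser_map g).
Proof. by rewrite !jacE ser_mapB !ser_mapM !ser_map_dx !ser_map_dy. Qed.
Lemma ser_map_subst f P :
  ser_map (ser_subst f P) = ser_subst (ser_map f) (smap_map P).
Proof.
apply/serP => i j; rewrite /ser_subst {1}/ser_map rmorph_sum.
apply: eq_bigr => k _; rewrite rmorph_sum; apply: eq_bigr => l _.
by rewrite rmorphM !ser_expE !ser_mulE /= -!ser_mapX -ser_mapM.
Qed.
Lemma ser_map_ord d f : ser_order_ge d (ser_map f) <-> ser_order_ge d f.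
Proof.
split=> df i j /df; rewrite /ser_map => H; last by rewrite H rmorph0.
by apply: (fmorph_inj phi); rewrite rmorph0.
Qed.
Lemma no_constant_map P : no_constant P -> no_constant (smap_map P).
Proof. by case=> P1 P2; split; rewrite /= /ser_map ?P1 ?P2 rmorph0. Qed.

End MapSeries.

Lemma ser_map_inj (K L : fieldType) (phi : {rmorphism K -> L}) (f g : series K) :
  ser_map phi f = ser_map phi g -> f = g.
Proof.
move/serP=> fg; apply/serP => i j; exact: (fmorph_inj phi (fg i j)).
Qed.

Section LinearSubst.
Variable K : fieldType.
Implicit Types (f g : series K).
Local Notation "f \o' P" := (ser_subst f P) (at level 40, left associativity).

Definition smap_swap : smap K := (ser_y K, ser_x K).

Lemma ser_swapE f : ser_swap f = f \o' smap_swap.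
Proof.
apply: ser_subst_hom => //.
- by split=> // d; exists d => g dg i j ij; apply: dg; rewrite addnC.
- by apply/serP => i j; rewrite /ser_swap !ser1 andbC.
- exact: ser_swapM.
- by apply/serP => i j; rewrite /ser_swap /= /ser_x /ser_y /ser_mono andbC.
- by apply/serP => i j; rewrite /ser_swap /= /ser_x /ser_y /ser_mono andbC.
Qed.

Definition smap_diag (a b : K) : smap K := (a *: ser_x K, b *: ser_y K).

Lemma no_constant_diag a b : no_constant (smap_diag a b).
Proof. by split; rewrite /= serZ mulr0. Qed.

Lemma ser_subst_diag a b f i j :
  (f \o' smap_diag a b) i j = a ^+ i * b ^+ j * f i j.
Proof.
pose A (g : series K) : series K := fun i j => a ^+ i * b ^+ j * g i j.
suff -> : f \o' smap_diag a b = A f by [].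
symmetry; move: f; apply: contlin_ext.
- split=> [c f g|d]; last by exists d => g dg i' j' ij; rewrite /A dg ?mulr0.
  by apply/serP => i' j'; rewrite /A !(serD, serZ); ring.
- exact: contlin_subst (no_constant_diag a b).
move=> k l; rewrite ser_subst_mono; last exact: no_constant_diag.
rewrite /= !exprZn -scalerAl -scalerAr scalerA -monoE.
apply/serP => i' j'; rewrite serZ /A /ser_mono.
by case: (_ =P k) => [->|]; case: (_ =P l) => [->|]; rewrite ?mulr0.
Qed.

End LinearSubst.

Section Hat.
Variable R : rcfType.
Local Notation C := R[i].
Implicit Types (f g : series R) (u v : series C).
Local Notation "f \o' P" := (ser_subst f P) (at level 40, left associativity).
Local Notation ord := (@ser_order_ge _).
Local Notation ci := (Complex 0 1 : C).

(* The coordinates (x, y) in terms of z = x + i y and w = x - i y. *)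
Definition zw_to_xy : smap C :=
  (2^-1 *: (ser_x C + ser_y C), (2 * ci)^-1 *: (ser_x C - ser_y C)).
Definition xy_to_zw : smap C :=
  (ser_x C + ci *: ser_y C, ser_x C - ci *: ser_y C).

Lemma ii : ci * ci = -1.
Proof. by apply/eqP; rewrite eq_complex /=; apply/andP; split; apply/eqP; ring. Qed.

Lemma i_neq0 : ci != 0.
Proof. by rewrite eq_complex /= oner_eq0 andbF. Qed.

Lemma invr2i : (2 * ci)^-1 = - ci / 2.
Proof.
have i20 : 2 * ci != 0 by rewrite mulf_neq0 ?i_neq0 ?pnatr_eq0.
apply: (mulfI i20); rewrite mulfV //; transitivity (- (ci * ci)).
  by rewrite ii opprK.
by field.
Qed.

Lemma conj_i : ci^* = - ci.
Proof. by apply/eqP; rewrite eq_complex /= oppr0 !eqxx. Qed.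

Lemma no_constant_zw_to_xy : no_constant zw_to_xy.
Proof.
by split; rewrite /= serZ ?serD ?serN /ser_x /ser_y /ser_mono /=; ring.
Qed.
Lemma no_constant_xy_to_zw : no_constant xy_to_zw.
Proof.
by split; rewrite /= serD ?serN serZ /ser_x /ser_y /ser_mono /=; ring.
Qed.
Local Hint Resolve no_constant_zw_to_xy no_constant_xy_to_zw : core.

Lemma xy_zwK : smap_comp xy_to_zw zw_to_xy = smap_id C.
Proof.
have z1 := ser_substx no_constant_zw_to_xy.
have z2 := ser_substy no_constant_zw_to_xy.
rewrite /smap_comp /= ser_substD // ser_substB // !ser_substZ // z1 z2 /=.
have i0 := i_neq0.
by congr (_, _); apply/serP => k l; rewrite !(serB, serD, serZ, serN); field;
  rewrite ?i0.
Qed.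

Lemma zw_xyK : smap_comp zw_to_xy xy_to_zw = smap_id C.
Proof.
have z1 := ser_substx no_constant_xy_to_zw.
have z2 := ser_substy no_constant_xy_to_zw.
rewrite /smap_comp /= !ser_substZ // ser_substD // ser_substB // z1 z2 /=.
have i0 := i_neq0.
by congr (_, _); apply/serP => k l; rewrite !(serB, serD, serZ, serN); field;
  rewrite ?i0.
Qed.

(** The real series f is rewritten in the complex coordinates z and w, where rotations are diagonal
    and the normal form consists of monomials. *)
Definition hat f : series C := ser_map (real_complex R) f \o' zw_to_xy.

(** Complex conjugation also exchanges z and w, hence the transposed indices. Its fixed points are
    exactly the series [hat f], by [ser_conj_hat] and [hat_surj]. *)
Definition ser_conj u : series C := fun i j => (u j i)^*.

Lemma hatD f g : hat (f + g) = hat f + hat g.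
Proof. by rewrite /hat ser_mapD ser_substD. Qed.
Lemma hatB f g : hat (f - g) = hat f - hat g.
Proof. by rewrite /hat ser_mapB ser_substB. Qed.
Lemma hatZ c f : hat (c *: f) = c%:C%C *: hat f.
Proof. by rewrite /hat ser_mapZ ser_substZ. Qed.
Lemma hatM f g : hat (f * g) = hat f * hat g.
Proof. by rewrite /hat ser_mapM ser_substM. Qed.
Lemma hat1 : hat 1 = 1.
Proof. by rewrite /hat ser_map1 ser_subst1E. Qed.
Lemma hat0 : hat 0 = 0.
Proof. by rewrite -(scale0r 0) hatZ scale0r. Qed.
Lemma hatX f k : hat (f ^+ k) = hat f ^+ k.
Proof. by elim: k => [|k IH]; rewrite ?expr0 ?hat1 // !exprS hatM IH. Qed.

Lemma hatK f : hat f \o' xy_to_zw = ser_map (real_complex R) f.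
Proof. by rewrite /hat ser_subst_comp // zw_xyK ser_subst_id. Qed.

Lemma hat_inj f g : hat f = hat g -> f = g.
Proof.
move=> /(congr1 (fun u => u \o' xy_to_zw)); rewrite !hatK.
exact: ser_map_inj.
Qed.

Lemma hat_ord d f : ord d (hat f) <-> ord d f.
Proof.
split=> [df|/(ser_map_ord (real_complex R)) df]; last exact: ser_subst_ord.
by apply/(ser_map_ord (real_complex R)); rewrite -hatK; exact: ser_subst_ord.
Qed.

(** The factor -2 i is the inverse of the Jacobian i / 2 of [zw_to_xy]. *)
Lemma hat_jac f g : hat (ser_jac f g) = (- 2 * ci) *: ser_jac (hat f) (hat g).
Proof.
rewrite /hat ser_map_jac jac_subst //.
have -> : ser_jac zw_to_xy.1 zw_to_xy.2 = (ci / 2) *: 1.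
  rewrite /= !(jacZl, jacZr) jacDl !jacBr !jacff !jacE.
  rewrite ser_dx_x ser_dx_y ser_dy_x ser_dy_y !(mul0r, mulr0, mul1r).
  apply/serP => k l.
  rewrite !(serZ, serD, serB, serN, ser0).
  have i0 := i_neq0; have i2 := ii.
  rewrite invr2i.
  by field.
rewrite -scalerAr mulr1 scalerA.
have -> : - 2 * ci * (ci / 2) = 1.
  have -> : - 2 * ci * (ci / 2) = - (ci * ci).
    by field.
  by rewrite ii opprK.
by rewrite scale1r.
Qed.

Lemma ser_conjE u : ser_conj u = ser_map (@Num.conj C) u \o' smap_swap C.
Proof. by rewrite -ser_swapE. Qed.

Lemma conj_zw_to_xy :
  smap_map (@Num.conj C) zw_to_xy = smap_comp zw_to_xy (smap_swap C).
Proof.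
have s0 : no_constant (smap_swap C) by [].
rewrite /smap_map /smap_comp /= !ser_mapZ ser_mapD ser_mapB !ser_map_mono.
rewrite !ser_substZ // ser_substD // ser_substB // ser_substx // ser_substy //=.
rewrite !fmorphV rmorphM /= conj_i conjC_nat; congr (_, _).
  by rewrite [ser_y C + _]addrC.
by rewrite mulrN invrN scaleNr -scalerN opprB.
Qed.

Lemma ser_conj_hat f : ser_conj (hat f) = hat f.
Proof.
have s0 : no_constant (smap_swap C) by [].
rewrite ser_conjE /hat ser_map_subst conj_zw_to_xy.
rewrite ser_subst_comp //; last exact: no_constant_comp.
rewrite smap_compA //.
have -> : smap_comp (smap_swap C) (smap_swap C) = smap_id C.
  by rewrite /smap_comp /= ser_substx // ser_substy.
rewrite smap_comp1; congr (_ \o' _); apply/serP => k l.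
by rewrite /ser_map /= /Num.conj /= oppr0.
Qed.

Lemma conj_xy_to_zw :
  smap_map (@Num.conj C) xy_to_zw = smap_comp (smap_swap C) xy_to_zw.
Proof.
rewrite /smap_map /smap_comp /= ser_substx // ser_substy //=.
rewrite ser_mapB ser_mapD !ser_mapZ !ser_map_mono /= conj_i.
by rewrite scaleNr opprK.
Qed.

Lemma hat_surj u : ser_conj u = u -> exists f, hat f = u.
Proof.
move=> uc; have s0 : no_constant (smap_swap C) by [].
pose v := u \o' xy_to_zw.
have vc : ser_map (@Num.conj C) v = v.
  rewrite /v ser_map_subst conj_xy_to_zw -ser_subst_comp //.
  by rewrite -ser_conjE uc.
exists (fun k l => complex.Re (v k l)); rewrite /hat.
have -> : ser_map (real_complex R) (fun k l => complex.Re (v k l)) = v.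
  apply/serP => k l; rewrite /ser_map /=.
  have /serP/(_ k l) := vc; rewrite /ser_map /Num.conj /=.
  case: (v k l) => a b /= [] /eqP; rewrite eq_sym -addr_eq0 -mulr2n.
  by rewrite mulrn_eq0 /= => /eqP ->.
by rewrite /v ser_subst_comp // xy_zwK ser_subst_id.
Qed.

Definition rot_mx (c s : R) : 'M[R]_2 := mx2 c (- s) s c.

Lemma smap_linear_no_constant (M : 'M[R]_2) : no_constant (smap_linear M).
Proof.
by split; rewrite /= ser_addE !ser_scaleE serD !serZ /ser_x /ser_y /ser_mono /=
  !mulr0 addr0.
Qed.

(** A rotation multiplies z by c + i s and w by the conjugate. Invariance thus becomes a congruence
    between exponents. *)
Lemma hat_rot c s f k l : hat (f \o' smap_linear (rot_mx c s)) k l =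
  Complex c s ^+ k * (Complex c s)^* ^+ l * hat f k l.
Proof.
have M0 := smap_linear_no_constant (rot_mx c s).
have D0 := no_constant_diag (Complex c s : C) (Complex c s)^*.
rewrite /hat ser_map_subst ser_subst_comp //; last exact: no_constant_map.
rewrite -ser_subst_diag ser_subst_comp //; congr (ser_subst _ _ k l).
rewrite /smap_comp /smap_map /= !ser_addE !ser_scaleE.
rewrite !ser_mapD !ser_mapZ !ser_map_mono.
rewrite !(ser_substB, ser_substD, ser_substZ) // !ser_substx // !ser_substy //=.
rewrite !mxE /=.
have cs : Complex c s = c%:C%C + ci * s%:C%C.
  by apply/eqP; rewrite eq_complex /=; apply/andP; split; apply/eqP; ring.
have csc : (Complex c s)^* = c%:C%C - ci * s%:C%C.
  by apply/eqP; rewrite eq_complex /=; apply/andP; split; apply/eqP; ring.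
have i0 := i_neq0; have i2 := ii.
rewrite invr2i csc cs rmorphN /=.
congr (_, _); apply/serP => a b; rewrite !(serD, serN, serB, serZ).
all: set X := ser_x _ a b; set Y := ser_y _ a b.
all: by field: i2.
Qed.

End Hat.

(** * Weights *)

Section SlotRecursion.
Variable L : fieldType.
Implicit Types (A B C U y : nat -> L) (T : pred nat).

(* Solved downwards: the equation of index [j] determines [U j.-1]. *)
Lemma descending_solution A B C y T J t : (forall j, T j -> B j != 0) ->
  exists U, [/\ U J = t, forall j, (J < j)%N -> U j = 0,
    forall j, (j < J)%N -> ~~ T j.+1 -> U j = 0 &
    forall j, (0 < j <= J)%N -> T j ->
      A j * U j - B j * U j.-1 + C j * U j.+1 = y j].
Proof.
move=> B0.
(* The pair at stage i holds the values of the solution at J - i and at J - i + 1. *)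
pose g := nat_rect (fun _ => (L * L)%type) (t, 0) (fun i x =>
  let j := (J - i)%N in
  (if T j then (A j * x.1 + C j * x.2 - y j) / B j else 0, x.1)).
pose U j := if (j <= J)%N then (g (J - j)%N).1 else 0.
have g2 j : (j <= J)%N -> (g (J - j)%N).2 = U j.+1.
  rewrite /U leq_eqVlt => /orP[/eqP ->|jJ]; first by rewrite subnn ltnn.
  by rewrite jJ -subnSK.
have US j : (j < J)%N -> U j =
    if T j.+1 then (A j.+1 * U j.+1 + C j.+1 * U j.+2 - y j.+1) / B j.+1 else 0.
  move=> jJ; rewrite {1}/U (ltnW jJ) -subnSK //= subKn // g2 //.
  by rewrite /U jJ.
exists U; split.
- by rewrite /U leqnn subnn.
- by move=> j jJ; rewrite /U leqNgt jJ.
- by move=> j jJ /negbTE Tj; rewrite US // Tj.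
- case=> // j /= jJ Tj; rewrite (US j) // Tj [B _ * _]mulrC divfK ?B0 //; ring.
Qed.

(** At the largest index where U does not vanish, the equation of the next index contains only its B
    term. *)
Lemma descending_zero A B C U T J j0 : (forall j, T j -> B j != 0) ->
  (forall j, (J <= j)%N -> U j = 0) ->
  (forall j, (j0 <= j < J)%N -> U j != 0 -> T j.+1) ->
  (forall j, (j0 < j <= J)%N -> T j ->
     A j * U j - B j * U j.-1 + C j * U j.+1 = 0) ->
  forall j, (j0 <= j)%N -> U j = 0.
Proof.
move=> B0 UJ UT eqU j.
have [d] := ubnP (J - j); elim: d j => // d IH j dj j0j.
case: (leqP J j) => [/UJ //|jJ]; apply/eqP; apply/negPn/negP => Uj.
have Tj : T j.+1 by apply: UT; rewrite ?j0j.
have := eqU j.+1; rewrite ltnS j0j jJ => /(_ isT Tj) /=.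
have U1 : U j.+1 = 0 by apply: IH; lia.
have U2 : U j.+2 = 0 by apply: IH; lia.
rewrite U1 U2 !mulr0 addr0 sub0r => /eqP; rewrite oppr_eq0 mulf_eq0.
by rewrite (negbTE Uj) (negbTE (B0 _ Tj)).
Qed.

End SlotRecursion.

Section Weights.
Variables (L : fieldType) (n p q : nat).
Implicit Types (f g u : series L).

Definition wok w k l : bool :=
  [&& k == l %[mod n], w <= p * k + q * l & w <= q * k + p * l]%N.

(* Resonant series of weight at least [w], where the weight of z^k w^l is the
   smaller of [p k + q l] and [q k + p l]. *)
Definition wfil w f : Prop := forall k l, ~~ wok w k l -> f k l = 0.

Lemma wfil0 w : wfil w 0. Proof. by []. Qed.
Lemma wfilD w f g : wfil w f -> wfil w g -> wfil w (f + g).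
Proof. by move=> wf wg k l kl; rewrite serD wf // wg // addr0. Qed.
Lemma wfilZ w a f : wfil w f -> wfil w (a *: f).
Proof. by move=> wf k l kl; rewrite serZ wf // mulr0. Qed.
Lemma wfilN w f : wfil w f -> wfil w (- f).
Proof. by move=> wf k l kl; rewrite serN wf // oppr0. Qed.
Lemma wfilB w f g : wfil w f -> wfil w g -> wfil w (f - g).
Proof. by move=> wf /wfilN; exact: wfilD. Qed.
Lemma wfil_le w w' f : (w <= w')%N -> wfil w' f -> wfil w f.
Proof.
move=> ww' wf k l kl; apply: wf; apply: contra kl => /and3P[km H1 H2].
by apply/and3P; split=> //; [exact: leq_trans H1|exact: leq_trans H2].
Qed.

(** Support condition for a derivative: the coefficient of z^k w^l in [ser_dx f] comes from z^(k+1)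
    w^l, so weight and resonance are measured after a shift by (c, d). *)
Definition shifted_wfil v (c d : nat) f :=
  forall k l, ~~ [&& (k + c == l + d %[mod n]), v <= p * (k + c) + q * (l + d)
    & v <= q * (k + c) + p * (l + d)]%N -> f k l = 0.

Lemma wfil_dx v f : wfil v f -> shifted_wfil v 1 0 (ser_dx f).
Proof.
move=> vf k l kl; rewrite /ser_dx vf ?mul0rn //.
by rewrite addn1 addn0 in kl.
Qed.
Lemma wfil_dy v f : wfil v f -> shifted_wfil v 0 1 (ser_dy f).
Proof.
move=> vf k l kl; rewrite /ser_dy vf ?mul0rn //.
by rewrite addn1 addn0 in kl.
Qed.

(** The shifts (c, d) and (d, c) add up to (e, e), which is invisible modulo n and costs (p + q) e
    of weight. Products use e = 0 and brackets e = 1. *)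
Lemma shifted_wfilM e v w c d f g : shifted_wfil v c d f ->
  shifted_wfil (w + (p + q) * e) d c g -> (c + d = e)%N -> wfil (v + w) (f * g).
Proof.
move=> vf wg cd k l kl; rewrite serM big1 // => -[k' /= k'k] _.
rewrite big1 // => -[l' /= l'l] _.
case: (boolP [&& (k' + c == l' + d %[mod n]), v <= p * (k' + c) + q * (l' + d)
    & v <= q * (k' + c) + p * (l' + d)]%N); last by move=> /vf ->; rewrite mul0r.
move=> /and3P[m1 a1 b1].
rewrite wg ?mulr0 //; apply: contra kl => /and3P[m2 a2 b2].
rewrite !ltnS in k'k l'l.
have ek : k = (k' + (k - k'))%N by rewrite subnKC.
have el : l = (l' + (l - l'))%N by rewrite subnKC.
move: ek el m2 a2 b2; set k2 := (k - k')%N; set l2 := (l - l')%N.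
have E x y : (x * (k' + c) + y * (l' + d) + (x * (k2 + d) + y * (l2 + c)) =
    x * (k' + k2) + y * (l' + l2) + (x + y) * e)%N by rewrite -cd; ring.
move=> -> -> m2 a2 b2; apply/and3P; split; last 2 first.
- by rewrite -(leq_add2r ((p + q) * e)) -E -addnA leq_add.
- by rewrite -(leq_add2r ((q + p) * e)) -E [(q + p)%N]addnC -addnA leq_add.
rewrite -(eqn_modDr e) -cd.
have -> : (k' + k2 + (c + d) = k' + c + (k2 + d))%N by ring.
have -> : (l' + l2 + (c + d) = l' + d + (l2 + c))%N by ring.
by rewrite -(eqP (_ : k' + c + (l2 + c) == l' + d + (l2 + c) %[mod n]))
  ?eqn_modDr // eqn_modDl.
Qed.

Lemma wfilM v w f g : wfil v f -> wfil w g -> wfil (v + w) (f * g).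
Proof.
have sh x u : wfil x u -> shifted_wfil x 0 0 u.
  by move=> xu k l; rewrite !addn0; exact: xu.
move=> vf wg; apply: (@shifted_wfilM 0 _ _ 0 0) => //; first exact: sh.
by rewrite muln0 addn0; exact: sh.
Qed.

Lemma wfilX v f k : wfil v f -> wfil (k * v) (f ^+ k).
Proof.
move=> vf; elim: k => [|k IH]; last by rewrite exprS mulSn; exact: wfilM.
rewrite expr0 mul0n => k l; rewrite ser1 /wok !leq0n !andbT.
by case: (k =P 0%N) => [->|//]; case: (l =P 0%N) => [->|//]; rewrite eqxx.
Qed.

Lemma wfil_jac v w f g : wfil v f -> wfil (w + (p + q)) g ->
  wfil (v + w) (ser_jac f g).
Proof.
move=> vf wg; rewrite jacE; apply: wfilB.
  by apply: (@shifted_wfilM 1 _ _ 1 0); rewrite ?muln1;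
    [exact: wfil_dx|exact: wfil_dy|].
by apply: (@shifted_wfilM 1 _ _ 0 1); rewrite ?muln1;
  [exact: wfil_dy|exact: wfil_dx|].
Qed.

Lemma wfil_mono w k l : wok w k l -> wfil w (ser_mono L k l).
Proof.
by move=> kl i j; rewrite /ser_mono; case: (i =P k) => [->|//];
  case: (j =P l) => [->|//]; rewrite kl.
Qed.

Lemma wfil_swap w f : wfil w f -> wfil w (ser_swap f).
Proof.
move=> wf k l kl; apply: wf; apply: contra kl => /and3P[m a b].
by apply/and3P; split=> //; rewrite 1?eq_sym // addnC.
Qed.

Lemma wokC w k l : wok w k l = wok w l k.
Proof.
by rewrite /wok eq_sym [(p * k + _)%N]addnC [(q * k + _)%N]addnC
  [X in _ && X]andbC.
Qed.

Lemma resonantP k l : (l <= k)%N -> k == l %[mod n] -> exists j, k = (l + n * j)%N.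
Proof.
move=> lk; rewrite eqn_mod_dvd // => /dvdnP[j E].
by exists j; rewrite mulnC -E subnKC.
Qed.

Hypothesis pq : (p <= q)%N.

(** Since p <= q, the form p k + q l is the smaller one on the side k >= l. A resonant point there
    is given by l and j, with k = l + n j. *)
Lemma weight_slot w j l :
  ((w <= p * (l + n * j) + q * l) && (w <= q * (l + n * j) + p * l))%N =
  (w <= (p + q) * l + p * n * j)%N.
Proof.
have -> : (p * (l + n * j) + q * l = (p + q) * l + p * n * j)%N by ring.
have -> : (q * (l + n * j) + p * l = (p + q) * l + q * n * j)%N by ring.
apply/andb_idr => wl; apply: leq_trans wl _.
by rewrite leq_add2l !leq_mul.
Qed.

Lemma wok_slot w j l : wok w (l + n * j) l = (w <= (p + q) * l + p * n * j)%N.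
Proof. by rewrite /wok weight_slot [(l + _)%N]addnC mulnC modnMDl eqxx. Qed.

Lemma wfil_slots w f : wfil 0 f ->
  (forall j l, ((p + q) * l + p * n * j < w)%N ->
    f (l + n * j)%N l = 0 /\ f l (l + n * j)%N = 0) -> wfil w f.
Proof.
move=> f0 Hf k l nok; have [m|m] := boolP (k == l %[mod n]); last first.
  by apply: f0; rewrite /wok !leq0n !andbT.
case: (leqP l k) => [lk|/ltnW lk].
  have [j E] := resonantP lk m; move: nok; rewrite E wok_slot -ltnNge.
  by move=> /Hf[].
rewrite eq_sym in m; have [j E] := resonantP lk m.
by move: nok; rewrite E wokC wok_slot -ltnNge => /Hf[].
Qed.

Lemma wfil_mono_n w : (w <= p * n)%N ->
  wfil w (ser_mono L n 0) /\ wfil w (ser_mono L 0 n).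
Proof.
move=> wn; have := wok_slot w 1 0; rewrite !muln1 muln0 !add0n wn => ok.
by split; apply: wfil_mono; rewrite // wokC.
Qed.

End Weights.

Lemma wfil_ord (L : fieldType) n p q N (f : series L) : (0 < p + q)%N ->
  wfil n p q ((p + q) * N) f -> ser_order_ge N f.
Proof.
move=> pq wf k l kl; apply: wf; apply/negP => /and3P[_ H1 H2].
have := leq_add H1 H2.
have -> : (p * k + q * l + (q * k + p * l) = (p + q) * (k + l))%N by ring.
by rewrite -mulnDr leq_pmul2l // leqNgt => /negP; apply; rewrite ltn_addr.
Qed.

(** * The homological equation *)

Section Homological.
Variables (L : numFieldType) (n p q : nat) (a b : L).
Hypotheses (p_gt0 : (0 < p)%N) (pq : (p <= q)%N) (n_gt1 : (1 < n)%N).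
Hypotheses (b0 : b != 0) (a0 : a = 0 \/ (p * n = 2 * (p + q))%N).
Implicit Types (f g u : series L) (U y : nat -> L).
Local Notation jac := (@ser_jac L).
Local Notation mono := (@ser_mono L).
Local Notation FF := (@wfil L n p q).
Local Notation s := (p + q)%N.
Local Notation h := (p * n)%N.

(** All its monomials have weight exactly h = p n: z^n and w^n because p <= q, and (z w)^2 when h =
    2 s; otherwise a is 0. *)
Definition ham0 : series L := a *: mono 2 2 + b *: (mono n 0 + mono 0 n).

Lemma dx_mono c d : ser_dx (mono c d) = c%:R *: mono c.-1 d.
Proof.
apply/serP => k l; rewrite /ser_dx serZ /ser_mono.
case: c => [|c] /=; first by rewrite mul0rn mul0r.
by rewrite eqSS; case: (k =P c) => [->|]; rewrite /= ?mul0rn ?mulr0 // mulrC mulr_natr.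
Qed.
Lemma dy_mono c d : ser_dy (mono c d) = d%:R *: mono c d.-1.
Proof.
apply/serP => k l; rewrite /ser_dy serZ /ser_mono.
case: d => [|d] /=; first by rewrite andbF mul0rn mul0r.
by rewrite eqSS; case: (l =P d) => [->|]; rewrite ?andbF /= ?mul0rn ?mulr0 // mulrC mulr_natr.
Qed.

Lemma jac_monoE u c d : jac u (mono c d) =
  d%:R *: (ser_dx u * mono c d.-1) - c%:R *: (ser_dy u * mono c.-1 d).
Proof. by rewrite jacE dx_mono dy_mono -!scalerAr. Qed.

Lemma jac_zw2S u k l :
  jac u (mono 2 2) k.+1 l.+1 = 2 * (k%:R - l%:R) * u k l.
Proof.
rewrite jac_monoE serB !serZ !mul_mono /=.
case: k l => [|k] [|l]; rewrite /= ?subSS ?subn0 /ser_dx /ser_dy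
  -1?[X in 2 * X - _]mulr_natr -1?[X in _ - 2 * X]mulr_natr; ring.
Qed.

Lemma jac_zw2_0 u k : jac u (mono 2 2) k 0 = 0.
Proof.
by rewrite jac_monoE serB !serZ !mul_mono /= ?andbF !mulr0 subr0.
Qed.

Lemma jac_zn u k l : jac u (mono n 0) k l =
  - (n%:R * if (n.-1 <= k)%N then l.+1%:R * u (k - n.-1)%N l.+1 else 0).
Proof.
rewrite jac_monoE scale0r sub0r serN serZ mul_mono andbT /ser_dy subn0.
by case: ifP => // _; rewrite -[X in - (_ * X) = _]mulr_natl.
Qed.

Lemma jac_wn u k l : jac u (mono 0 n) k l =
  n%:R * if (n.-1 <= l)%N then k.+1%:R * u k.+1 (l - n.-1)%N else 0.
Proof.
rewrite jac_monoE scale0r subr0 serZ mul_mono /= /ser_dx subn0.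
by case: ifP => // _; rewrite -[X in _ * X = _]mulr_natl.
Qed.

Lemma jac_ham0 u : jac u ham0 =
  a *: jac u (mono 2 2) + b *: (jac u (mono n 0) + jac u (mono 0 n)).
Proof. by rewrite /ham0 jacDr !jacZr jacDr. Qed.

Lemma ser_swap_mono c d : ser_swap (mono c d) = mono d c.
Proof. by apply/serP => k l; rewrite /ser_swap /ser_mono andbC. Qed.

Lemma ser_swap_ham0 : ser_swap ham0 = ham0.
Proof.
have E c f g : ser_swap (c *: f + g) = c *: ser_swap f + ser_swap g by [].
rewrite /ham0 E ser_swap_mono; congr (_ + _).
rewrite -[X in ser_swap X]addr0 E -[X in ser_swap X]scale1r.
apply/serP => k l; rewrite !(serD, serZ) /ser_swap !(serD, serZ) /ser_mono ser0.
by rewrite [(l == n) && _]andbC [(l == 0%N) && _]andbC; ring.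
Qed.

Lemma ser_swap_jac f g : ser_swap (jac f g) = - jac (ser_swap f) (ser_swap g).
Proof.
have E u v : ser_swap (u - v) = ser_swap u - ser_swap v by [].
by rewrite !jacE E !ser_swapM !ser_dy_swap; set A := ser_swap _ * _;
  rewrite opprB; congr (_ - _).
Qed.

Lemma ham0_fil : FF h ham0.
Proof.
have [z w] := wfil_mono_n L pq (leqnn h).
apply: wfilD; last by apply: wfilZ; exact: wfilD.
case: a0 => [->|hs]; first by rewrite scale0r.
apply/wfilZ/wfil_mono.
by rewrite /wok eqxx -!mulnDl [(q + p)%N]addnC hs mulnC leqnn.
Qed.

(** A pure power of z arises only by choosing b z^n in every factor. Since b is nonzero, this
    coefficient detects multiples of [ham0 ^+ P]. *)
Lemma ham0_pow_corner P k : (ham0 ^+ P) k 0%N = b ^+ P * (k == n * P)%N%:R.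
Proof.
have n0 : (0 == n) = false by case: (n) n_gt1.
elim: P k => [|P IH] k; first by rewrite !expr0 muln0 mul1r ser1 andbT.
have corner j : ham0 j 0%N = b * (j == n)%:R.
  by rewrite /ham0 serD !serZ serD /ser_mono !andbT n0 !andbF mulr0 add0r addr0.
rewrite exprS serM; under eq_bigr do rewrite big_ord1 subnn corner IH.
rewrite mulnS; case: (leqP n k) => nk.
  have nk' : (n < k.+1)%N by [].
  rewrite (bigD1 (Ordinal nk')) //= eqxx big1 ?addr0.
    by rewrite exprS -mulrA mulr1 -{2}(subnKC nk) eqn_add2l mulrA.
  move=> j /eqP jn; case: (_ =P n) => [E|_]; last by rewrite mulr0 mul0r.
  by case: jn; apply/val_inj.
rewrite big1.
  by rewrite (_ : (k == _) = false) ?mulr0 //; apply/eqP; lia.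
move=> [j /= jk] _; rewrite (_ : (j == n) = false) ?mulr0 ?mul0r //.
by apply/eqP; lia.
Qed.

(** Bracketing with z w multiplies z^k w^l by k - l up to sign, so only diagonal terms can remain in
    the lowest weight; the bracket with z^n then detects each of them. *)
Lemma wfil_nondegenerate v u : (0 < v)%N ->
  FF (v + s)%N u -> FF (v + s).+1 (jac (mono 1 1) u) ->
  FF (v + h).+1 (jac (mono n 0 + mono 0 n) u) -> FF (v + s).+1 u.
Proof.
clear a0 b0.
move=> v0 Wu H1 H2.
have off k l : k != l -> ~~ wok n p q (v + s).+1 k l -> u k l = 0.
  move=> kl nok; have := H1 _ _ nok; rewrite jacC serN jac_monoE serB !serZ.
  rewrite !mul_mono /= /ser_dx /ser_dy !subn0 !mul1r leq0n andbT => /eqP.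
  rewrite oppr_eq0.
  have -> : (if (0 < k)%N then u (k - 1).+1 l *+ (k - 1).+1 else 0) = k%:R * u k l.
    case: (k) => [|k']; first by rewrite mul0r.
    by rewrite subn1 -[LHS]mulr_natl.
  have -> : (if (0 < l)%N then u k (l - 1).+1 *+ (l - 1).+1 else 0) = l%:R * u k l.
    case: (l) => [|l']; first by rewrite mul0r.
    by rewrite subn1 -[LHS]mulr_natl.
  rewrite -mulrBl mulf_eq0 subr_eq0 eqr_nat (negbTE kl) /=.
  by move/eqP.
move=> k l nok; have [E|] := eqVneq k l; last by move/off; apply.
rewrite -E in nok *; clear l E.
have s_gt0 : (0 < s)%N by rewrite addn_gt0 p_gt0.
have [/and3P[_ H3 _]|/Wu //] := boolP (wok n p q (v + s) k k).
have {H3 nok} Ek : (s * k = v + s)%N.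
  move: nok; rewrite /wok eqxx /= -!mulnDl [(q + p)%N]addnC andbb -leqNgt.
  by move: H3; rewrite -mulnDl => H3 H4; apply/eqP; rewrite eqn_leq H4.
have k_gt1 : (1 < k)%N.
  rewrite ltnNge; apply/negP => k1; have := leq_mul (leqnn s) k1; rewrite Ek; lia.
(* The bracket of (z w)^k with z^n sits at z^(n+k-1) w^(k-1), whose weight is exactly v + h. *)
have nok : ~~ wok n p q (v + h).+1 (n + k.-1) k.-1.
  apply/negP => /and3P[_ + _].
  have -> : (p * (n + k.-1) + q * k.-1 = s * k.-1 + h)%N by ring.
  have : (s * k.-1 + s = s * k)%N by rewrite addnC -mulnS prednK // ltnW.
  by rewrite Ek; lia.
have := H2 _ _ nok; rewrite jacC serN jacDr serD jac_zn jac_wn.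
have -> : (n.-1 <= n + k.-1)%N by lia.
have -> : (n + k.-1 - n.-1 = k)%N by have := n_gt1; lia.
have -> : (if (n.-1 <= k.-1)%N then
    (n + k.-1).+1%:R * u (n + k.-1).+1 (k.-1 - n.-1)%N else 0) = 0.
  case: ifP => // nk; rewrite off ?mulr0 //; first by apply/eqP; lia.
  apply/negP => /and3P[_ + _].
  have -> : (n + k.-1).+1 = (n + k)%N by lia.
  have -> : (k.-1 - n.-1 = k - n)%N by have := n_gt1; lia.
  have nk' : (n <= k)%N by have := n_gt1; lia.
  have E1 : (q * (k - n) + q * n = q * k)%N by rewrite -mulnDr subnK.
  have E2 : (p * n <= q * n)%N by rewrite leq_mul2r pq orbT.
  by move: Ek; rewrite mulnDl mulnDr; lia.
rewrite mulr0 addr0 opprK prednK ?(ltnW k_gt1) // => /eqP.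
by rewrite !mulf_eq0 !pnatr_eq0; case: (k) k_gt1 => // k' _; case: (n) n_gt1 => //= n' _ /eqP.
Qed.

Section Level.
Variable v : nat.
Local Notation W := (v + s)%N.
Local Notation W' := (v + h)%N.

(* The coefficient of [u] at the point (l + n j, l) of weight W, and 0 if there
   is no such point. *)
Definition slot u j : L :=
  if (h * j <= W)%N && (s %| W - h * j)%N then
    u ((W - h * j) %/ s + n * j)%N ((W - h * j) %/ s)%N else 0.

Let s_gt0 : (0 < s)%N. Proof. by rewrite addn_gt0 p_gt0. Qed.
Let h_gt0 : (0 < h)%N. Proof. by rewrite muln_gt0 p_gt0 ltnW. Qed.

Lemma slotE u j l : (s * l + h * j = W)%N -> slot u j = u (l + n * j)%N l.
Proof.
move=> E; rewrite /slot -E leq_addl addnK dvdn_mulr //= mulKn //.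
Qed.

Lemma slot_neq0 u j : slot u j != 0 -> exists l, (s * l + h * j = W)%N.
Proof.
rewrite /slot; case: ifP => [/andP[hj sd] _|]; last by rewrite eqxx.
by exists ((W - h * j) %/ s)%N; rewrite mulnC divnK // subnK.
Qed.


(** Points where {u, ham0} has its lowest part for u of weight W: the bracket adds the weight h of
    [ham0] and loses s, and W + h - s = v + h. *)
Definition target j l : bool := (s * l + h * j == W')%N.

Definition coefA j : L := a * 2 * (n * j)%:R.
Definition tgl j := ((W' - h * j) %/ s)%N.
Definition coefB j : L := n%:R * b * (tgl j).+1%:R.
(** The w^n term enters the lowest weight only for p = q: on the side k >= l the monomial w^n has
    weight q n, which exceeds h when p < q. *)
Definition coefC j : L := if p == q then n%:R * b * (tgl j + n * j).+1%:R else 0.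
Definition has_target : pred nat :=
  fun j => (h * j <= W')%N && (s %| W' - h * j)%N.

Lemma targetP j l : target j l -> has_target j /\ tgl j = l.
Proof.
move=> /eqP E; rewrite /has_target /tgl -E leq_addl addnK dvdn_mulr // mulKn //.
Qed.

Lemma has_targetP j : has_target j -> target j (tgl j).
Proof.
by move=> /andP[hj sd]; rewrite /target /tgl mulnC divnK // subnK.
Qed.

Lemma coefB_neq0 j : coefB j != 0.
Proof.
by rewrite /coefB !mulf_neq0 ?pnatr_eq0 //; case: (n) n_gt1.
Qed.

(** Bracketing with (z w)^2 keeps the index j, with z^n raises it by one, with w^n lowers it by one,
    so target j sees the slots j, j - 1 and j + 1. For j = 0 the z^n source would lie on the other
    side of the diagonal. *)
Lemma target_eq u j l : FF W u -> (0 < j)%N -> target j l ->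
  jac u ham0 (l + n * j)%N l =
  coefA j * slot u j - coefB j * slot u j.-1 + coefC j * slot u j.+1.
Proof.
move=> Wu j0 jl; have [_ El] := targetP jl; move/eqP: jl => E.
rewrite jac_ham0 serD !serZ (serD (jac u (mono n 0))) jac_zn jac_wn.
rewrite (mulrDr b) addrA.
congr (_ + _ + _).
- rewrite /coefA -!mulrA; case: a0 => [->|hs]; first by rewrite !mul0r.
  congr (_ * _); case: l E {El} => [|l] E.
    rewrite jac_zw2_0; apply/esym/eqP; rewrite !mulf_eq0 -/(slot u j).
    rewrite [slot u j]/slot (_ : (h * j <= W)%N = false) ?eqxx ?orbT //.
    by move: E; rewrite muln0 add0n; lia.
  rewrite addSn jac_zw2S (@slotE u j l); last by lia.
  by rewrite natrD addrAC subrr add0r mulrA.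
- rewrite /coefB El.
  have -> : (n.-1 <= l + n * j)%N by case: (j) j0 => // j' _; rewrite mulnS; lia.
  rewrite (@slotE u j.-1 l.+1).
    have -> : (l + n * j - n.-1 = l.+1 + n * j.-1)%N.
      by case: (j) j0 => // j' _; rewrite mulnS; have := n_gt1; lia.
    ring.
  case: (j) j0 E => // j' _ /=; rewrite !mulnS; lia.
- rewrite /coefC El.
  case: ifP => [nl|nl].
    case: (p =P q) => [Epq|npq].
      rewrite (@slotE u j.+1 (l - n.-1)%N).
        have -> : (l - n.-1 + n * j.+1 = (l + n * j).+1)%N.
          by rewrite mulnS; have := n_gt1; lia.
        ring.
      move: E; rewrite -Epq addnn -mul2n !mulnS => E.
      have : (2 * p * (l - n.-1) + 2 * p * n.-1 = 2 * p * l)%N.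
        by rewrite -mulnDr subnK.
      have : (2 * p * n.-1 + 2 * p = 2 * p * n)%N.
        by rewrite addnC -mulnS prednK // ltnW.
      by lia.
    (* For p < q the source of the w^n term has weight W - (q - p) n, below W, so u vanishes
       there. *)
    rewrite mul0r Wu ?mulr0 //; apply/negP => /and3P[_ + _].
    have ltpq : (p < q)%N by rewrite ltn_neqAle pq andbT; apply/eqP.
    have E1 : (q * (l - n.-1) + q * n.-1 = q * l)%N by rewrite -mulnDr subnK.
    have E2 : (q * n.-1 + q = q * n)%N by rewrite addnC -mulnS prednK // ltnW.
    have E3 : (p * n < q * n)%N by rewrite ltn_mul2r ltpq andbT ltnW.
    have -> : (p * (l + n * j).+1 = p * l + p * n * j + p)%N by ring.
    by move: E; rewrite mulnDl; lia.
  rewrite !mulr0; case: (p =P q) => [Epq|npq]; last by rewrite mul0r.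
  apply/esym/eqP; rewrite mulf_eq0; apply/orP; right; apply/negPn/negP => /slot_neq0[l2].
  move: E; rewrite -Epq addnn -mul2n !mulnS => E.
  have E1 : (l < n.-1)%N by rewrite ltnNge nl.
  have E2 : (2 * p * l.+1 <= 2 * p * n.-1)%N by rewrite leq_mul2l E1 orbT.
  have : (2 * p * n.-1 + 2 * p = 2 * p * n)%N.
    by rewrite addnC -mulnS prednK // ltnW.
  move: E2; rewrite mulnS.
  by have := p_gt0; lia.
Qed.

Lemma slots_zero u (eps : L) : FF W u -> ser_swap u = eps *: u ->
  (forall j, slot u j = 0) -> FF W.+1 u.
Proof.
move=> Wu us uj; apply: wfil_slots => // [|j l]; first exact: wfil_le Wu.
rewrite ltnS leq_eqVlt => jl; have u0 : u (l + n * j)%N l = 0.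
  case/orP: jl => [/eqP jl|jl]; first by rewrite -(slotE u jl).
  by apply: Wu; rewrite wok_slot // -ltnNge.
by split=> //; have /serP/(_ (l + n * j)%N l) := us; rewrite /ser_swap serZ u0 mulr0.
Qed.

Definition slot_base U k l : L :=
  if (n %| k - l)%N && (s * l + p * (k - l) == W)%N then U ((k - l) %/ n)%N else 0.
Definition slot_series (eps : L) U : series L :=
  fun k l => if (l <= k)%N then slot_base U k l else eps * slot_base U l k.

Lemma slot_series_fil eps U : FF W (slot_series eps U).
Proof.
have main k l : (l <= k)%N -> ~~ wok n p q W k l -> slot_base U k l = 0.
  move=> lk; rewrite /slot_base; case: ifP => // /andP[nkl /eqP E] /negP[].
  have m : k == l %[mod n] by rewrite eqn_mod_dvd.
  have [j kE] := resonantP lk m.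
  by rewrite kE wok_slot // -E kE addKn mulnA.
move=> k l nok; rewrite /slot_series; case: (leqP l k) => [lk|kl]; first exact: main.
by rewrite main ?mulr0 // 1?ltnW // wokC.
Qed.

(** The diagonal is its own mirror image, so a sign other than 1 requires the slot of index 0 to be
    0. *)
Lemma slot_series_swap eps U : eps * eps = 1 ->
  (eps = 1 \/ U 0%N = 0) ->
  ser_swap (slot_series eps U) = eps *: slot_series eps U.
Proof.
move=> ee eU; apply/serP => k l; rewrite serZ /ser_swap /slot_series.
case: (ltngtP k l) => [kl|lk|->]; rewrite ?mulrA ?ee ?mul1r //.
case: eU => [->|U0]; first by rewrite mul1r.
by rewrite /slot_base subnn div0n U0; case: ifP; rewrite mulr0.
Qed.


Lemma slot_slot_series eps U j :
  (forall j, (forall l, (s * l + h * j)%N <> W) -> U j = 0) ->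
  slot (slot_series eps U) j = U j.
Proof.
move=> UW; rewrite /slot; case: ifP => [/andP[hj sd]|H].
  have E : (s * ((W - h * j) %/ s) + h * j = W)%N.
    by rewrite mulnC divnK // subnK.
  rewrite /slot_series leq_addr /slot_base addKn dvdn_mulr //= mulnA E eqxx.
  by rewrite mulKn // ltnW.
rewrite UW // => l E; move: H.
by rewrite -E leq_addl addnK dvdn_mulr.
Qed.

Lemma target_source j l : target j.+1 l = ((s * l.+1 + h * j)%N == W).
Proof. by rewrite /target !mulnS; apply/eqP/eqP; lia. Qed.

Lemma target_le j l : target j l -> (j <= W')%N.
Proof.
move=> /eqP <-; apply: leq_trans (leq_addl _ _).
exact: leq_pmull.
Qed.

Lemma no_source_no_target j :
  (forall l, (s * l + h * j)%N <> W) -> ~~ has_target j.+1.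
Proof.
by move=> H; apply/negP => /has_targetP; rewrite target_source => /eqP /H.
Qed.

(** A slot of index j with l > 0 is the z^n source of a target of index j + 1, so descent reaches
    it. Only the corner l = 0 has no such target, hence the separate hypothesis on it. *)
Lemma descending_slots u j0 : FF W u ->
  (forall j l, (j0 < j)%N -> target j l -> jac u ham0 (l + n * j)%N l = 0) ->
  (forall j, (h * j)%N = W -> slot u j = 0) ->
  forall j, (j0 <= j)%N -> slot u j = 0.
Proof.
move=> Wu Hu top; apply: (@descending_zero _ coefA coefB coefC (slot u)
  has_target W'.+1.+1 j0) => [j _|j j0j|j /andP[j0j _] uj|j /andP[j0j _] Tj].
- exact: coefB_neq0.
- apply/eqP/negPn/negP => uj; have [[|l] /eqP E] := slot_neq0 uj.
    by case/eqP: uj; apply: top; move: E; rewrite muln0 => /eqP.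
  rewrite -target_source in E; have jW := ltnW (target_le E).
  by have := leq_trans j0j jW; rewrite ltnNge leqnSn.
- have [[|l] /eqP E] := slot_neq0 uj.
    by case/eqP: uj; apply: top; move: E; rewrite muln0 => /eqP.
  by rewrite -target_source in E; case: (targetP E).
- have jl := has_targetP Tj.
  by rewrite -(target_eq Wu _ jl) ?Hu //; exact: leq_ltn_trans j0j.
Qed.

(** The equation of index j determines slot j - 1. An antisymmetric series has slot 0 equal to 0, so
    for eps = -1 the equation of index 1 is given up. The free corner value is set to 0. *)
Lemma solve_slots (eps : L) y j0 : eps * eps = 1 -> (eps = 1 \/ (0 < j0)%N) ->
  exists u, [/\ FF W u, ser_swap u = eps *: u & forall j l, (j0 < j)%N ->
    target j l -> jac u ham0 (l + n * j)%N l = y j].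
Proof.
move=> ee ej.
pose T j := has_target j && (j0 < j)%N.
have [U [UJ UJ' UT Ueq]] := @descending_solution _ coefA coefB coefC y T
  W'.+1 0 (fun j _ => coefB_neq0 j).
have UW j : (forall l, (s * l + h * j)%N <> W) -> U j = 0.
  move=> H; case: (ltngtP j W'.+1) => [jW|/UJ' //|->//].
  by apply: UT => //; rewrite /T (negbTE (no_source_no_target H)).
exists (slot_series eps U); split.
- exact: slot_series_fil.
- apply: slot_series_swap => //; case: ej => [|j00]; [by left|right].
  by apply: UT => //; rewrite /T ltnNge j00 andbF.
- move=> j l j0j jl; have j_gt0 : (0 < j)%N by exact: leq_ltn_trans j0j.
  rewrite (target_eq (slot_series_fil _ _) j_gt0 jl) !slot_slot_series //.
  have [Tj _] := targetP jl.
  by apply: Ueq; rewrite ?j_gt0 ?(leqW (target_le jl)) // /T Tj.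
Qed.

Lemma jac_pow P f : jac (f ^+ P) f = 0.
Proof.
elim: P => [|P IH].
  by rewrite expr0 jacE ser_dx_1 ser_dy_1 !mul0r subr0.
by rewrite exprS jacMl IH jacff mul0r mulr0 addr0.
Qed.

(** All slots follow from the corner z^(n P), which exists only when h divides W; subtracting the
    multiple of [ham0 ^+ P] with the same corner coefficient makes the rest vanish by descent. *)
Lemma kernel_sym u : FF W u -> ser_swap u = u ->
  (forall j l, (0 < j)%N -> target j l -> jac u ham0 (l + n * j)%N l = 0) ->
  exists c P, (c = 0 \/ W = (P * h)%N) /\ FF W.+1 (u - c *: ham0 ^+ P).
Proof.
move=> Wu us Hu; case: (boolP (h %| W)%N) => hW; last first.
  exists 0, 0%N; split; [by left|rewrite scale0r subr0].
  apply: (@slots_zero _ 1) => //; first by rewrite scale1r.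
  move=> j; apply: (@descending_slots u 0) => // i E.
  by rewrite -E dvdn_mulr in hW.
have /dvdnP[P WP] := hW.
pose c := slot u P / b ^+ P.
have WH : FF W (ham0 ^+ P) by rewrite WP; exact: wfilX ham0_fil.
have sH : ser_swap (ham0 ^+ P) = ham0 ^+ P.
  elim: P {WP c WH} => [|P IH].
    by rewrite !expr0; apply/serP => k l; rewrite /ser_swap !ser1 andbC.
  by rewrite !exprS ser_swapM IH ser_swap_ham0.
set u' := u - c *: ham0 ^+ P.
have Wu' : FF W u' by apply: wfilB => //; exact: wfilZ.
have topW : (s * 0 + h * P = W)%N by rewrite muln0 add0n WP mulnC.
exists c, P; split; first by right.
apply: (@slots_zero _ 1) => //.
  rewrite scale1r /u'; apply/serP => k l; rewrite /ser_swap !(serB, serZ).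
  move/serP: us => /(_ k l); rewrite /ser_swap => ->.
  by move/serP: sH => /(_ k l); rewrite /ser_swap => ->.
move=> j; apply: (@descending_slots u' 0) => //.
  move=> i l i0 il; rewrite /u' jacBl jacZl jac_pow scaler0 subr0; exact: Hu.
move=> i hi; have -> : i = P.
  by apply/eqP; rewrite -(eqn_pmul2l h_gt0) hi WP mulnC.
rewrite (slotE u' topW) /u' serB serZ add0n ham0_pow_corner eqxx mulr1.
by rewrite /c divfK ?expf_neq0 // -(slotE u topW) subrr.
Qed.

Lemma anti_slot0 u : ser_swap u = - u -> slot u 0 = 0.
Proof.
move/serP => us; rewrite /slot; case: ifP => // _.
set l := (_ %/ _)%N; rewrite muln0 addn0.
have /eqP := us l l; rewrite /ser_swap serN -addr_eq0 -mulr2n mulrn_eq0 /=.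
by move/eqP.
Qed.

(** Without a corner, descent kills all slots of positive index, and antisymmetry kills slot 0. *)
Lemma kernel_anti_generic u : ~~ (h %| W)%N -> FF W u -> ser_swap u = - u ->
  (forall j l, (1 < j)%N -> target j l -> jac u ham0 (l + n * j)%N l = 0) ->
  FF W.+1 u.
Proof.
move=> hW Wu us Hu; apply: (@slots_zero _ (-1)) => //; first by rewrite scaleN1r.
case=> [|j]; first exact: anti_slot0.
apply: (@descending_slots u 1) => // i E.
by rewrite -E dvdn_mulr in hW.
Qed.

(** * Antisymmetric generators at weights divisible by h, with a nonzero *)

Section QuadraticTwist.
Hypotheses (hs : (h = 2 * s)%N) (a_real : a \is Num.real) (a_neq0 : a != 0).
Hypothesis b_gt0 : 0 < b.
Variable P : nat.
Hypotheses (P_gt0 : (0 < P)%N) (WP : W = (h * P)%N).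

Let WP' : (W' = s * (2 * P).+1)%N.
Proof. by move: WP; rewrite hs mulnS => WP2; lia. Qed.

Let has_targetE j : (j <= P)%N -> has_target j.
Proof.
move=> jP; suff : target j (2 * P - 2 * j).+1 by move/targetP => [].
rewrite /target WP' hs; apply/eqP; rewrite [(2 * s)%N]mulnC -mulnA -mulnDr.
by congr (_ * _)%N; lia.
Qed.

Let target_leP j l : target j l -> (j <= P)%N.
Proof.
rewrite /target WP' hs => /eqP; rewrite [(2 * s)%N]mulnC -mulnA -mulnDr => /eqP.
by rewrite eqn_pmul2l // => /eqP; lia.
Qed.

Let T j := has_target j && (1 < j)%N.

Let coefC_ge0 j : 0 <= coefC j.
Proof.
by rewrite /coefC; case: ifP => // _; rewrite !mulr_ge0 ?ler0n // ltW.
Qed.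
Let coefB_gt0 j : 0 < coefB j.
Proof.
by rewrite /coefB !mulr_gt0 ?ltr0n // ltnW.
Qed.

(* The sign of [V j] is that of [a ^+ (P - j)], so the two terms of the
   remaining equation of index 1 cannot cancel. *)
Lemma twist_chain : exists V,
  [/\ V P = 1, forall j, (P < j)%N -> V j = 0, V 0%N = 0,
    forall j, (1 < j <= P)%N ->
      coefA j * V j - coefB j * V j.-1 + coefC j * V j.+1 = 0
  & coefA 1 * V 1%N + coefC 1 * V 2 != 0].
Proof.
have [V [VP VP' VT Veq]] := @descending_solution _ coefA coefB coefC
  (fun=> 0) T P 1 (fun j _ => coefB_neq0 j).
have {}Veq j : (1 < j <= P)%N ->
    coefA j * V j - coefB j * V j.-1 + coefC j * V j.+1 = 0.
  move=> /andP[j1 jP]; apply: Veq; first by rewrite jP ltnW.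
  by rewrite /T j1 has_targetE.
have a2 : 0 < a ^+ 2 by rewrite real_exprn_even_gt0.
have pos i j : 0 < a ^+ i * V j -> 0 <= a ^+ i.+1 * V j.+1 -> (0 < j)%N ->
    0 < a ^+ i.+1 * (coefA j * V j + coefC j * V j.+1).
  move=> Vj Vj1 j0.
  have -> : a ^+ i.+1 * (coefA j * V j + coefC j * V j.+1) =
      2 * (n * j)%:R * (a ^+ 2 * (a ^+ i * V j)) + coefC j * (a ^+ i.+1 * V j.+1).
    by rewrite /coefA exprS; ring.
  apply: ltr_pwDl; last by rewrite mulr_ge0.
  have nj : 0 < (n * j)%:R :> L by rewrite ltr0n muln_gt0 j0 andbT ltnW.
  by apply: mulr_gt0; apply: mulr_gt0.
have chain i : (i < P)%N ->
    0 < a ^+ i * V (P - i)%N /\ 0 <= a ^+ i.+1 * V (P - i).+1.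
  elim: i => [|i IH] iP.
    by rewrite subn0 VP VP' // mulr0 expr0 mulr1.
  have [IH1 IH2] := IH (ltnW iP).
  have E : (P - i = (P - i.+1).+1)%N by lia.
  have Pi : (0 < P - i)%N by lia.
  have Pi2 : (1 < P - i <= P)%N by rewrite leq_subr andbT; lia.
  have := pos i (P - i)%N IH1 IH2 Pi.
  have /eqP := Veq _ Pi2; rewrite addrAC subr_eq0 => /eqP ->.
  rewrite mulrCA pmulr_rgt0 // => H; split; first by move: H; rewrite E.
  rewrite -E !exprS !mulrA -expr2 -mulrA; apply: mulr_ge0; exact: ltW.
exists V; split=> //.
  by apply: VT => //; rewrite /T andbF.
have PP : (P.-1 < P)%N by rewrite prednK.
have [c1 c2] := chain _ PP.
have E : (P - P.-1 = 1)%N by lia.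
rewrite E in c1 c2.
have := pos _ _ c1 c2 (ltnSn 0); apply: contraTneq => ->.
by rewrite mulr0 ltxx.
Qed.

(** Descent solves the equations of index above 1 for any corner value. The one of index 1 is met by
    adding a multiple t of the homogeneous chain V, whose defect there is nonzero by
    [twist_chain]. *)
Lemma solve_anti_twist y : exists u, [/\ FF W u, ser_swap u = - u &
  forall j l, (0 < j)%N -> target j l -> jac u ham0 (l + n * j)%N l = y j].
Proof.
have [V [VP VP' V0 Veq sigma]] := twist_chain.
have [U [UP UP' UT Ueq]] := @descending_solution _ coefA coefB coefC
  y T P 0 (fun j _ => coefB_neq0 j).
pose t := (y 1%N - (coefA 1 * U 1%N + coefC 1 * U 2)) /
  (coefA 1 * V 1%N + coefC 1 * V 2).
pose X j := U j + t * V j.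
have U0 : U 0%N = 0 by apply: UT => //; rewrite /T andbF.
have X0 : X 0%N = 0 by rewrite /X U0 V0 mulr0 addr0.
have XW j : (forall l, (s * l + h * j)%N <> W) -> X j = 0.
  move=> H; case: (leqP j P) => jP; last first.
    by rewrite /X UP' // VP' // mulr0 addr0.
  exfalso; apply: (H (2 * (P - j))%N).
  by rewrite WP hs mulnCA mulnA -mulnDr subnK.
exists (slot_series (-1) X); split.
- exact: slot_series_fil.
- by rewrite slot_series_swap ?scaleN1r ?mulrNN ?mulr1 //; right.
- move=> j l j0 jl; rewrite (target_eq (slot_series_fil _ _) j0 jl).
  rewrite !slot_slot_series //; have jP := target_leP jl.
  case: j j0 jl jP => [//|[|j]] _ jl jP.
    rewrite X0 mulr0 subr0 /X.
    have -> : coefA 1 * (U 1%N + t * V 1%N) + coefC 1 * (U 2 + t * V 2) =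
      coefA 1 * U 1%N + coefC 1 * U 2 + t * (coefA 1 * V 1%N + coefC 1 * V 2).
      by ring.
    by rewrite /t divfK // addrC subrK.
  have := Ueq j.+2; rewrite jP /T has_targetE // => /(_ isT isT) <-.
  have := Veq j.+2; rewrite jP => /(_ isT) /=.
  move/(congr1 (fun x => t * x)); rewrite mulr0 /X => V_eq.
  by rewrite -[RHS]addr0 -V_eq /=; ring.
Qed.

(** By descent the slots of positive index are a multiple of the chain V; the equation of index 1,
    from which slot 0 is absent, forces that multiple to be 0. *)
Lemma kernel_anti_twist u : FF W u -> ser_swap u = - u ->
  (forall j l, (0 < j)%N -> target j l -> jac u ham0 (l + n * j)%N l = 0) ->
  FF W.+1 u.
Proof.
move=> Wu us Hu; apply: (@slots_zero _ (-1)) => //; first by rewrite scaleN1r.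
have [V [VP VP' V0 Veq sigma]] := twist_chain.
have eq j : (0 < j <= P)%N ->
    coefA j * slot u j - coefB j * slot u j.-1 + coefC j * slot u j.+1 = 0.
  move=> /andP[j0 jP]; have jl := has_targetP (has_targetE jP).
  by rewrite -(target_eq Wu j0 jl) Hu.
have large j : (P < j)%N -> slot u j = 0.
  move=> Pj; rewrite /slot; case: ifP => // /andP[+ _].
  by rewrite WP leq_pmul2l // leqNgt Pj.
pose D j := slot u j - slot u P * V j.
have D0 : forall j, (1 <= j)%N -> D j = 0.
  apply: (@descending_zero _ coefA coefB coefC D T P 1) => [j _|j Pj|j|j].
  - exact: coefB_neq0.
  - rewrite /D; move: Pj; rewrite leq_eqVlt => /orP[/eqP <-|Pj].
      by rewrite VP mulr1 subrr.
    by rewrite large // VP' // mulr0 subrr.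
  - by move=> /andP[j1 jP] _; rewrite /T has_targetE.
  - move=> /andP[j1 jP] _; rewrite /D.
    have := eq j; rewrite jP ltnW // => /(_ isT) e1.
    have := Veq j; rewrite jP j1 => /(_ isT) e2.
    have -> : coefA j * (slot u j - slot u P * V j) -
      coefB j * (slot u j.-1 - slot u P * V j.-1) +
      coefC j * (slot u j.+1 - slot u P * V j.+1) =
      (coefA j * slot u j - coefB j * slot u j.-1 + coefC j * slot u j.+1) -
      slot u P * (coefA j * V j - coefB j * V j.-1 + coefC j * V j.+1) by ring.
    by rewrite e1 e2 mulr0 subr0.
have uV j : (0 < j)%N -> slot u j = slot u P * V j.
  by move=> j0; apply/eqP; rewrite -subr_eq0; apply/eqP; exact: D0.
have uP : slot u P = 0.
  have := eq 1%N; rewrite P_gt0 => /(_ isT) /=.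
  rewrite anti_slot0 // mulr0 subr0 (uV 1%N) // (uV 2) //.
  rewrite mulrCA [X in _ + X]mulrCA -mulrDr => /eqP.
  by rewrite mulf_eq0 (negbTE sigma) orbF => /eqP.
case=> [|j]; first exact: anti_slot0.
by rewrite (uV j.+1) // uP mul0r.
Qed.

End QuadraticTwist.

(** * Antisymmetric generators at weights divisible by 3, for n = 3 *)

Section Cubic.
Hypotheses (p1 : p = 1%N) (q1 : q = 1%N) (n3 : n = 3%N) (hW : (3 %| W)%N).

(** Since 3 divides W, every target has l congruent to 2 modulo 3. In particular l >= 2, so its w^3
    source exists. *)
Let source_of_target j l : target j l -> (2 <= l)%N /\
  (s * (l - 2) + h * j.+1 = W)%N.
Proof.
move: hW => /dvdnP[P WP]; rewrite /target => /eqP.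
by move: WP; rewrite p1 q1 n3; lia.
Qed.

Let target_of_source j l : (s * l + h * j.+1 = W)%N -> target j l.+2.
Proof. by rewrite /target p1 q1 n3 => E; apply/eqP; lia. Qed.

Let coefC_neq0 j : coefC j != 0.
Proof.
rewrite /coefC p1 q1 eqxx !mulf_neq0 ?pnatr_eq0 //; by case: (n) n_gt1.
Qed.

(** At a diagonal target the brackets with z^3 and w^3 read u at two mirror points; antisymmetry
    makes the contributions equal, hence the factor 2. *)
Let target_eq0 u l : FF W u -> ser_swap u = - u -> target 0 l ->
  jac u ham0 l l = 2 * (n%:R * b * l.+1%:R) * slot u 1.
Proof.
move=> Wu us jl; have [l2 E] := source_of_target jl.
rewrite jac_ham0 serD !serZ (serD (jac u (mono n 0))) jac_zn jac_wn.
have -> : jac u (mono 2 2) l l = 0.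
  by case: (l) => [|l']; rewrite ?jac_zw2_0 // jac_zw2S subrr mulr0 mul0r.
rewrite (slotE u E) n3 /= l2 mulr0 add0r.
have -> : (l - 2 + 3 * 1 = l.+1)%N by lia.
have := us; move/serP => /(_ l.+1 (l - 2)%N); rewrite /ser_swap serN => ->; ring.
Qed.

(** With a = 0 and [coefC] nonzero the recursion runs upwards: the diagonal equation gives slot 1,
    and the equation of index j gives slot j + 1 from slot j - 1. All targets are met, the diagonal
    one included. *)
Lemma solve_anti_cubic y : exists u, [/\ FF W u, ser_swap u = - u &
  forall j l, target j l -> jac u ham0 (l + n * j)%N l = y j].
Proof.
have a00 : a = 0 by case: a0 => //; rewrite p1 q1 n3.
(* The pair at stage j holds slots j and j + 1; slot 0 is 0 by antisymmetry. *)
pose g := nat_rect (fun _ => (L * L)%type)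
  (0, if has_target 0 then y 0%N / (2 * (n%:R * b * (tgl 0).+1%:R)) else 0)
  (fun i x => (x.2, if has_target i.+1 then (y i.+1 + coefB i.+1 * x.1) / coefC i.+1
                    else 0)).
pose U j := (g j).1.
have U1 : U 1%N = if has_target 0 then y 0%N / (2 * (n%:R * b * (tgl 0).+1%:R)) else 0.
  by [].
have US j : U j.+2 = if has_target j.+1 then
    (y j.+1 + coefB j.+1 * U j) / coefC j.+1 else 0 by [].
have UW j : (forall l, (s * l + h * j)%N <> W) -> U j = 0.
  case: j => [//|j] H.
  have nT : has_target j = false.
    apply/negP => /has_targetP /source_of_target[_]; exact: H.
  by case: j nT {H} => [|j] nT; rewrite ?U1 ?US nT.
have us : ser_swap (slot_series (-1) U) = - slot_series (-1) U.
  by rewrite slot_series_swap ?scaleN1r ?mulrNN ?mulr1 //; right.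
exists (slot_series (-1) U); split=> //; first exact: slot_series_fil.
move=> [|j] l jl; have [Tj El] := targetP jl.
  rewrite muln0 addn0 target_eq0 //; last exact: slot_series_fil.
  rewrite slot_slot_series // U1 Tj El mulrC divfK //.
  by rewrite !mulf_neq0 ?pnatr_eq0 //; case: (n) n_gt1.
rewrite (target_eq (slot_series_fil _ _) (ltn0Sn j) jl) !slot_slot_series //.
rewrite US Tj /= /coefA a00 !mul0r add0r [coefC _ * _]mulrC divfK //.
by rewrite addrC addrK.
Qed.

(** Upward induction in steps of two: antisymmetry starts the even slots and the diagonal equation
    the odd ones. *)
Lemma kernel_anti_cubic u : FF W u -> ser_swap u = - u ->
  (forall j l, target j l -> jac u ham0 (l + n * j)%N l = 0) -> FF W.+1 u.
Proof.
move=> Wu us Hu; apply: (@slots_zero _ (-1)) => //; first by rewrite scaleN1r.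
have a00 : a = 0 by case: a0 => //; rewrite p1 q1 n3.
move=> j; have [d] := ubnP j; elim: d j => // d IH [_|j jd].
  exact: anti_slot0.
apply/eqP/negPn/negP => uj; have [l E] := slot_neq0 uj.
have jl := target_of_source E; have := Hu _ _ jl.
case: j jd uj E jl => [|j] jd uj E jl.
  rewrite muln0 addn0 target_eq0 // => /eqP; rewrite mulf_eq0 (negbTE uj) orbF.
  by rewrite !mulf_eq0 !pnatr_eq0 (negbTE b0) /=; case: (n) n_gt1.
rewrite (target_eq Wu (ltn0Sn j) jl) /= /coefA a00 !mul0r.
rewrite [slot u j]IH; last by lia.
rewrite mulr0 subr0 add0r => /eqP; rewrite mulf_eq0 (negbTE uj) orbF.
exact/negP/coefC_neq0.
Qed.

End Cubic.

(** For [hat f] with f real, the first clause makes the coefficient real and so excludes sine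
    terms. *)
Definition nf_at (allowed : nat -> nat -> bool) f k l : Prop :=
  f k l = f l k /\ ((l <= k)%N -> ~~ allowed k l -> f k l = 0).

Definition nf_below (allowed : nat -> nat -> bool) w f : Prop :=
  forall k l, ~~ ((w <= p * k + q * l) && (w <= q * k + p * l))%N ->
  nf_at allowed f k l.

Lemma jac_ham0_fil u : FF W u -> FF W' (jac u ham0).
Proof.
move=> Wu; rewrite jacC addnC; apply: wfilN; apply: wfil_jac => //.
exact: ham0_fil.
Qed.

Lemma below_target k l : (l <= k)%N -> k == l %[mod n] ->
  ~~ ((W' < p * k + q * l) && (W' < q * k + p * l))%N ->
  ~~ wok n p q W' k l \/ exists2 j, k = (l + n * j)%N & target j l.
Proof.
move=> lk m; have [j ->] := resonantP lk m.
rewrite weight_slot // -leqNgt leq_eqVlt wok_slot // -ltnNge => /orP[jl|jl].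
  by right; exists j.
by left.
Qed.


Lemma sym_anti_split w f : FF w f -> exists fs fa,
  [/\ f = fs + fa, ser_swap fs = fs, ser_swap fa = - fa & FF w fs /\ FF w fa].
Proof.
move=> wf; have wf' := wfil_swap wf.
exists (2^-1 *: (f + ser_swap f)), (2^-1 *: (f - ser_swap f)); split.
- by apply/serP => k l; rewrite !(serB, serD, serZ, serN); field.
- by apply/serP => k l; rewrite /ser_swap !(serD, serZ) /ser_swap; ring.
- by apply/serP => k l; rewrite /ser_swap !(serN, serZ, serB) /ser_swap; ring.
- by split; apply: wfilZ; [exact: wfilD|exact: wfilB].
Qed.

Variable allowed : nat -> nat -> bool.
Hypothesis solve_anti : forall y, exists u, [/\ FF W u, ser_swap u = - u &
  forall j l, target j l -> ~~ allowed (l + n * j)%N l ->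
    jac u ham0 (l + n * j)%N l = y j].
Hypothesis kernel_anti : forall u, FF W u -> ser_swap u = - u ->
  (forall j l, target j l -> ~~ allowed (l + n * j)%N l ->
    jac u ham0 (l + n * j)%N l = 0) -> FF W.+1 u.

(** Bracketing with the symmetric [ham0] reverses parity, so two independent problems arise: us
    removes the antisymmetric part of f completely, and ua removes the symmetric part where nothing
    is allowed. *)
Lemma solve_nf (kappa : L) f : kappa != 0 -> FF 0 f -> nf_below allowed W' f ->
  exists2 u, FF W u & nf_below allowed W'.+1 (f + kappa *: jac u ham0).
Proof.
move=> k0 f0 nff.
have [fs [fa [fE fss fas [fs0 fa0]]]] := sym_anti_split f0.
have [|us [Wus uss Hus]] := @solve_slots 1 (fun j => - (kappa^-1 *
   fa (tgl j + n * j)%N (tgl j))) 0 (mulr1 1); first by left.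
have [ua [Wua uaa Hua]] := solve_anti (fun j => - (kappa^-1 *
   fs (tgl j + n * j)%N (tgl j))).
pose Ga := fa + kappa *: jac us ham0; pose Gs := fs + kappa *: jac ua ham0.
have Gaa : ser_swap Ga = - Ga.
  have -> : ser_swap Ga = ser_swap fa + kappa *: ser_swap (jac us ham0) by [].
  by rewrite ser_swap_jac ser_swap_ham0 uss scale1r fas scalerN /Ga (opprD fa).
have Gss : ser_swap Gs = Gs.
  have -> : ser_swap Gs = ser_swap fs + kappa *: ser_swap (jac ua ham0) by [].
  by rewrite ser_swap_jac ser_swap_ham0 uaa fss jacNl opprK.
exists (us + ua); first exact: wfilD.
have -> : f + kappa *: jac (us + ua) ham0 = Gs + Ga.
  by rewrite jacDl scalerDr {1}fE /Gs /Ga; ring.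
have jW u : FF W u -> FF 0 (jac u ham0).
  by move=> /jac_ham0_fil; apply: wfil_le.
have Ga0 : FF 0 Ga by apply: wfilD => //; apply/wfilZ/jW.
have Gs0 : FF 0 Gs by apply: wfilD => //; apply/wfilZ/jW.
have nres u k l : FF 0 u -> ~~ (k == l %[mod n]) -> u k l = 0.
  by move=> u0 kl; apply: u0; rewrite /wok !leq0n !andbT.
(* Below weight W' both corrections vanish and f is already normal; at weight W' the resonant points
   are the targets. *)
have key k l : (l <= k)%N ->
    ~~ ((W' < p * k + q * l) && (W' < q * k + p * l))%N ->
    Ga k l = 0 /\ (~~ allowed k l -> Gs k l = 0).
  move=> lk kl; have [m|m] := boolP (k == l %[mod n]); last by rewrite !nres.
  have [nok|[j kE jl]] := below_target lk m kl.
    have := nff k l; rewrite /wok m /= in nok => /(_ nok)[fkl fz].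
    have jz u : FF W u -> jac u ham0 k l = 0.
      by move=> /jac_ham0_fil; apply; rewrite /wok m.
    rewrite /Ga /Gs !serD !serZ !jz // !mulr0 !addr0.
    have sE : fs l k = fs k l by have /serP/(_ k l) := fss.
    have aE : fa l k = - fa k l by have /serP/(_ k l) := fas.
    have H : fa k l = 0.
      move: fkl; rewrite fE !serD sE aE => /addrI/eqP.
      by rewrite -addr_eq0 -mulr2n mulrn_eq0 /= => /eqP.
    by split=> // /(fz lk); rewrite fE serD H addr0.
  have [_ El] := targetP jl.
  split.
    case: j kE jl El => [|j] kE jl El.
      have /serP/(_ k l) := Gaa; rewrite /ser_swap serN kE muln0 addn0 => /eqP.
      by rewrite -addr_eq0 -mulr2n mulrn_eq0 /= => /eqP.
    by rewrite /Ga serD serZ kE Hus // El; field.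
  by rewrite kE => nall; rewrite /Gs serD serZ Hua // El; field.
move=> k l kl; have kl' : ~~ ((W' < p * l + q * k) && (W' < q * l + p * k))%N.
  by rewrite andbC [(q * l + _)%N]addnC [(p * l + _)%N]addnC.
have Ga_kl : Ga k l = 0 /\ Ga l k = 0.
  have sw k' l' : Ga k' l' = - Ga l' k'.
    by have /serP/(_ l' k') := Gaa; rewrite /ser_swap serN.
  case: (leqP l k) => [lk|/ltnW lk].
    by have [H _] := key k l lk kl; rewrite (sw l k) H oppr0.
  by have [H _] := key l k lk kl'; rewrite (sw k l) H oppr0.
split; rewrite !serD Ga_kl.1 ?Ga_kl.2 !addr0.
  by have /serP/(_ l k) := Gss.
by move=> lk; have [_] := key k l lk kl.
Qed.

(** A normal form is symmetric, so {us, ham0} vanishes at every target and us is a power of [ham0]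
    up to higher weight. The symmetric {ua, ham0} vanishes where nothing is allowed, so ua has
    higher weight. *)
Lemma kernel_nf u : FF W u -> nf_below allowed W'.+1 (jac u ham0) ->
  exists c P, (c = 0 \/ W = (P * h)%N) /\ FF W.+1 (u - c *: ham0 ^+ P).
Proof.
move=> Wu nfu.
have [us [ua [uE uss uas [usW uaW]]]] := sym_anti_split Wu.
have jE k l : jac u ham0 k l = jac us ham0 k l + jac ua ham0 k l.
  by rewrite {1}uE jacDl serD.
have js k l : jac us ham0 l k = - jac us ham0 k l.
  have := ser_swap_jac us ham0; rewrite uss ser_swap_ham0.
  by move/serP => /(_ k l); rewrite serN.
have ja k l : jac ua ham0 l k = jac ua ham0 k l.
  have := ser_swap_jac ua ham0.
  rewrite uas ser_swap_ham0 jacNl opprK.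
  by move/serP => /(_ k l).
have tgt j l : target j l -> nf_at allowed (jac u ham0) (l + n * j)%N l.
  move=> /eqP E; apply: nfu; rewrite negb_and -!leqNgt.
  by rewrite (_ : (p * (l + n * j) + q * l = W')%N) ?leqnn // -E; ring.
have uaW1 : FF W.+1 ua.
  apply: kernel_anti => // j l jl nall; have [H1 H2] := tgt j l jl.
  have := H2 (leq_addr _ _) nall; move: H1;
    rewrite !jE (js (l + n * j)%N l) (ja (l + n * j)%N l) => /addIr /eqP.
  rewrite -addr_eq0 -mulr2n mulrn_eq0 /= => /eqP ->.
  by rewrite add0r.
have [j l j0 jl|c [P [cP HP]]] := kernel_sym usW uss.
  have [H1 _] := tgt j l jl; move: H1;
    rewrite !jE (js (l + n * j)%N l) (ja (l + n * j)%N l) => /addIr /eqP.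
  by rewrite -addr_eq0 -mulr2n mulrn_eq0 /= => /eqP.
exists c, P; split=> //.
have -> : u - c *: ham0 ^+ P = (us - c *: ham0 ^+ P) + ua.
  by rewrite {1}uE; ring.
exact: wfilD.
Qed.

End Level.
End Homological.

(** * Matching the solvable targets with the monomials of the two normal forms *)

Section AntisymmetricCases.
Variables (L : numFieldType) (a b : L) (v : nat).
Implicit Types (u : series L) (y : nat -> L).
Hypotheses (b_gt0 : 0 < b) (v_gt0 : (0 < v)%N).

Let b0 : b != 0. Proof. by rewrite gt_eqF. Qed.

Definition solvable_anti n p q (allowed : nat -> nat -> bool) : Prop :=
  forall y, exists u,
    [/\ wfil n p q (v + (p + q)) u, ser_swap u = - u & forall j l,
      target n p q v j l -> ~~ allowed (l + n * j)%N l ->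
      ser_jac u (ham0 n a b) (l + n * j)%N l = y j].

Definition injective_anti n p q (allowed : nat -> nat -> bool) : Prop :=
  forall u, wfil n p q (v + (p + q)) u -> ser_swap u = - u ->
  (forall j l, target n p q v j l -> ~~ allowed (l + n * j)%N l ->
    ser_jac u (ham0 n a b) (l + n * j)%N l = 0) ->
  wfil n p q (v + (p + q)).+1 u.

(* The monomials z^k w^l, with k >= l, of the unique normal forms. *)
Definition allowed_ge4 n k l : bool :=
  ((k == l) && (2 <= k)%N) || ((k == l + n)%N && ~~ odd l).

Definition allowed_3 k l : bool :=
  [&& k == l, 3 <= k & k %% 3 != 2]%N || ((k == l + 3)%N && (l %% 3 != 2)%N).

Section AtLeastFour.
Variable n : nat.
Hypotheses (n4 : (4 <= n)%N) (a_real : a \is Num.real) (a_neq0 : a != 0).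

Let hs : (2 * n = 2 * (2 + (n - 2)))%N. Proof. by lia. Qed.
Let ah : a = 0 \/ (2 * n = 2 * (2 + (n - 2)))%N. Proof. by right. Qed.
Let pq : (2 <= n - 2)%N. Proof. by lia. Qed.
Let n_gt1 : (1 < n)%N. Proof. by lia. Qed.
Let tgtE j l : target n 2 (n - 2) v j l -> (n * l + 2 * n * j = v + 2 * n)%N.
Proof. by rewrite /target subnKC; [move/eqP|lia]. Qed.

Let not_allowed_ge2 j l : (1 < j)%N -> ~~ allowed_ge4 n (l + n * j)%N l.
Proof.
move=> j1; have := leq_mul (leqnn n) j1; rewrite muln2 -addnn => nj.
by rewrite /allowed_ge4 !gtn_eqF //; lia.
Qed.

(** The targets given up, of index 0 and 1, are allowed: the former is diagonal with exponent at
    least 3; the latter has W = n (l + 1), so an odd l would make 2 n divide W. *)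
Let generic_allowed j l : ~~ (2 * n %| v + (2 + (n - 2)))%N ->
  target n 2 (n - 2) v j l -> ~~ allowed_ge4 n (l + n * j)%N l -> (1 < j)%N.
Proof.
move=> hW jl; case: j jl => [|[|j]] // jl; have E := tgtE jl.
  have l2 : (2 < l)%N.
    rewrite ltnNge; apply/negP => l2.
    have := leq_mul (leqnn n) l2; lia.
  by rewrite /allowed_ge4 muln0 addn0 eqxx (ltnW l2).
rewrite /allowed_ge4 muln1 eqxx /= negb_or => /andP[_]; rewrite negbK => ol.
case/negP: hW; apply/dvdnP; exists (uphalf l).
have -> : (v + (2 + (n - 2)) = n * l.+1)%N by rewrite mulnS; lia.
rewrite mulnA [(uphalf l * 2)%N]muln2 uphalf_half ol doubleD -[(_ + _)%N]/((true + (l./2).*2).+1).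
have := odd_double_half l; rewrite ol => ->.
exact: mulnC.
Qed.

(** At weight W = 2 n P the target of index 1 has l + 1 = 2 P. This odd l is why only even powers of
    I survive in B. *)
Let twist_allowed j l P : (v + (2 + (n - 2)) = 2 * n * P)%N -> (0 < j)%N ->
  target n 2 (n - 2) v j l -> ~~ allowed_ge4 n (l + n * j)%N l.
Proof.
move=> WP; case: j => [|[|j]] // _ jl; last exact: not_allowed_ge2.
have E := tgtE jl.
have El : (l.+1 = P * 2)%N.
  apply/eqP; rewrite -(eqn_pmul2l (_ : 0 < n)%N); last by lia.
  have -> : (n * (P * 2) = 2 * n * P)%N by ring.
  by rewrite mulnS; apply/eqP; lia.
have ol : odd l by have := congr1 odd El; rewrite /= muln2 odd_double => /negbFE.
by rewrite /allowed_ge4 muln1 ol andbF orbF gtn_eqF //; lia.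
Qed.

Let twist_P P : (v + (2 + (n - 2)) = 2 * n * P)%N -> (0 < P)%N.
Proof. by case: P => //; lia. Qed.

Lemma solvable_anti_ge4 : solvable_anti n 2 (n - 2) (allowed_ge4 n).
Proof.
move=> y; case: (boolP (2 * n %| v + (2 + (n - 2)))%N) => hW; last first.
  have [||u [Wu us Hu]] := @solve_slots L n 2 (n - 2) a b isT pq n_gt1 b0 ah v
     (-1) y 1%N; first by rewrite mulrNN mulr1.
    by right.
  exists u; rewrite -scaleN1r; split=> // j l jl nall; apply: Hu => //.
  exact: generic_allowed jl nall.
have /dvdnP[P] := hW; rewrite mulnC => WP.
have [u [Wu us Hu]] := @solve_anti_twist L n 2 (n - 2) a b isT pq n_gt1 b0 ah v
  hs a_real a_neq0 b_gt0 P (twist_P WP) WP y.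
exists u; split=> // -[|j] l jl nall; last exact: Hu.
case/negP: nall; rewrite /allowed_ge4 muln0 addn0 eqxx /=.
have E := tgtE jl; suff -> : (1 < l)%N by [].
rewrite ltnNge; apply/negP => l2; have := leq_mul (leqnn n) l2; lia.
Qed.

Lemma injective_anti_ge4 : injective_anti n 2 (n - 2) (allowed_ge4 n).
Proof.
move=> u Wu us Hu; case: (boolP (2 * n %| v + (2 + (n - 2)))%N) => hW; last first.
  apply: (@kernel_anti_generic L n 2 (n - 2) a b) => // j l j1 jl.
  by apply: Hu => //; exact: not_allowed_ge2.
have /dvdnP[P] := hW; rewrite mulnC => WP.
apply: (@kernel_anti_twist L n 2 (n - 2) a b _ _ _ _ _ _ _ _ _ _ P) => //.
  exact: twist_P WP.
by move=> j l j0 jl; apply: Hu => //; exact: twist_allowed WP _ jl.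
Qed.

End AtLeastFour.

Section Three.
Hypothesis a00 : a = 0.
Let ah : a = 0 \/ (1 * 3 = 2 * (1 + 1))%N. Proof. by left. Qed.

Let not_allowed_ge2 j l : (1 < j)%N -> ~~ allowed_3 (l + 3 * j)%N l.
Proof. by move=> j1; rewrite /allowed_3; lia. Qed.

Let generic_allowed j l : ~~ (3 %| v + (1 + 1))%N ->
  target 3 1 1 v j l -> ~~ allowed_3 (l + 3 * j)%N l -> (1 < j)%N.
Proof.
rewrite /target /allowed_3 => hW /eqP E; case: j E => [|[|j]] // E.
  by rewrite muln0 addn0 eqxx /=; lia.
by rewrite muln1 eqxx /=; lia.
Qed.

(** Divisibility of W by 3 makes l congruent to 2 modulo 3 at every target. These are exactly the
    residues missing from A and B. *)
Let cubic_allowed j l : (3 %| v + (1 + 1))%N ->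
  target 3 1 1 v j l -> ~~ allowed_3 (l + 3 * j)%N l.
Proof.
rewrite /target => hW /eqP E; case: j E => [|[|j]] // E; last exact: not_allowed_ge2.
  by rewrite /allowed_3; lia.
by rewrite /allowed_3; lia.
Qed.

Lemma solvable_anti_3 : solvable_anti 3 1 1 allowed_3.
Proof.
move=> y; case: (boolP (3 %| v + (1 + 1))%N) => hW; last first.
  have [||u [Wu us Hu]] := @solve_slots L 3 1 1 a b isT isT isT b0 ah v
     (-1) y 1%N; first by rewrite mulrNN mulr1.
    by right.
  exists u; rewrite -scaleN1r; split=> // j l jl nall; apply: Hu => //.
  exact: generic_allowed jl nall.
have [u [Wu us Hu]] := @solve_anti_cubic L 3 1 1 a b isT isT isT b0 ah v
  erefl erefl erefl hW y.
by exists u; split=> // j l jl nall; exact: Hu.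
Qed.

Lemma injective_anti_3 : injective_anti 3 1 1 allowed_3.
Proof.
move=> u Wu us Hu; case: (boolP (3 %| v + (1 + 1))%N) => hW; last first.
  apply: (@kernel_anti_generic L 3 1 1 a b) => // j l j1 jl.
  by apply: Hu => //; exact: not_allowed_ge2.
apply: (@kernel_anti_cubic L 3 1 1 a b) => //.
by move=> j l jl; apply: Hu => //; exact: cubic_allowed.
Qed.

End Three.

End AntisymmetricCases.

(** * Existence and uniqueness up to a near-identity change *)

Section ConjugationStability.
Variables (R : rcfType) (n p q : nat).
Local Notation C := R[i].
Implicit Types u : series C.
Local Notation FF := (@wfil C n p q).

Lemma ser_conjK u : ser_conj (ser_conj u) = u.
Proof. by apply/serP => k l; rewrite /ser_conj conjCK. Qed.
Lemma ser_conjD u w : ser_conj (u + w) = ser_conj u + ser_conj w.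
Proof. by apply/serP => k l; rewrite /ser_conj serD rmorphD. Qed.
Lemma ser_conjB u w : ser_conj (u - w) = ser_conj u - ser_conj w.
Proof. by apply/serP => k l; rewrite /ser_conj serB rmorphB. Qed.
Lemma ser_conjZ c u : ser_conj (c *: u) = c^* *: ser_conj u.
Proof. by apply/serP => k l; rewrite /ser_conj serZ rmorphM. Qed.
Lemma ser_conj_swap u : ser_conj u = ser_swap (ser_map (@Num.conj C) u).
Proof. by []. Qed.
Lemma ser_conj_jac u w : ser_conj (ser_jac u w) = - ser_jac (ser_conj u) (ser_conj w).
Proof. by rewrite !ser_conj_swap ser_map_jac ser_swap_jac. Qed.
Lemma ser_conj_mono k l : ser_conj (ser_mono C k l) = ser_mono C l k.
Proof. by rewrite ser_conj_swap ser_map_mono ser_swap_mono. Qed.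
Lemma wfil_conj w u : FF w u -> FF w (ser_conj u).
Proof.
by move=> /wfil_swap wu k l kl; rewrite /ser_conj; have := wu k l kl;
  rewrite /ser_swap => ->; rewrite rmorph0.
Qed.

Lemma nf_belowD allowed w u u' : nf_below p q allowed w u ->
  nf_below p q allowed w u' -> nf_below p q allowed w (u + u').
Proof.
move=> nu nu' k l kl; have [u1 u2] := nu k l kl; have [u'1 u'2] := nu' k l kl.
split; rewrite !serD; first by rewrite u1 u'1.
by move=> lk nall; rewrite u2 // u'2 // addr0.
Qed.
Lemma nf_belowZ allowed w c u : nf_below p q allowed w u ->
  nf_below p q allowed w (c *: u).
Proof.
move=> nu k l kl; have [u1 u2] := nu k l kl.
split; rewrite !serZ; first by rewrite u1.
by move=> lk nall; rewrite u2 // mulr0.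
Qed.
Lemma nf_belowB allowed w u u' : nf_below p q allowed w u ->
  nf_below p q allowed w u' -> nf_below p q allowed w (u - u').
Proof.
by move=> nu nu'; rewrite -scaleN1r; apply: nf_belowD => //; exact: nf_belowZ.
Qed.
Lemma nf_below_conj allowed w u : nf_below p q allowed w u ->
  nf_below p q allowed w (ser_conj u).
Proof.
move=> nu k l kl; have [u1 u2] := nu k l kl.
split; rewrite /ser_conj; first by rewrite u1.
by move=> lk nall; rewrite -u1 u2 // rmorph0.
Qed.
Lemma wfil_nf_below allowed w u : FF w u -> nf_below p q allowed w u.
Proof.
move=> wu k l kl.
have z k' l' : ~~ ((w <= p * k' + q * l') && (w <= q * k' + p * l'))%N -> u k' l' = 0.
  by move=> kl'; apply: wu; apply: contra kl' => /and3P[_ -> ->].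
have kl2 : ~~ ((w <= p * l + q * k) && (w <= q * l + p * k))%N.
  by rewrite andbC [(q * l + _)%N]addnC [(p * l + _)%N]addnC.
by split; rewrite !z.
Qed.
Lemma nf_below_le allowed w w' u : (w <= w')%N -> nf_below p q allowed w' u ->
  nf_below p q allowed w u.
Proof.
move=> ww' nu k l kl; apply: nu; apply: contra kl => /andP[H1 H2].
by rewrite (leq_trans ww' H1) (leq_trans ww' H2).
Qed.

End ConjugationStability.

Section RealSide.
Variables (R : rcfType) (n p q : nat) (a b : R) (allowed : nat -> nat -> bool).
Local Notation C := R[i].
Implicit Types f g H chi : series R.
Local Notation ord := (@ser_order_ge _).
Local Notation jac := (@ser_jac _).
Local Notation E := (@ser_exp_lie R).
Local Notation "f \o' P" := (ser_subst f P) (at level 40, left associativity).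
Local Notation FF := (@wfil C n p q).
Local Notation s := (p + q)%N.
Local Notation h := (p * n)%N.
Local Notation ham := (ham0 n (a%:C)%C (b%:C)%C).

Hypotheses (p_gt0 : (0 < p)%N) (pq : (p <= q)%N) (n_gt1 : (1 < n)%N).
Hypotheses (b_gt0 : 0 < b) (ah : a = 0 \/ h = (2 * s)%N).
Hypothesis solv : forall v, (0 < v)%N ->
  solvable_anti (a%:C)%C (b%:C)%C v n p q allowed.
Hypothesis inj : forall v, (0 < v)%N ->
  injective_anti (a%:C)%C (b%:C)%C v n p q allowed.
Hypothesis nf_ham0 : forall w, nf_below p q allowed w ham.

Definition rfil w f : Prop := FF w (hat f).
Local Notation F := rfil.
Definition rnf w f : Prop := nf_below p q allowed w (hat f).

Let b0C : (b%:C)%C != 0 :> C.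
Proof. by rewrite (fmorph_eq0 (real_complex R)) gt_eqF. Qed.
Let ahC : (a%:C)%C = 0 :> C \/ h = (2 * s)%N.
Proof. by case: ah => [->|]; [left|right]. Qed.
Let s_gt0 : (0 < s)%N. Proof. by rewrite addn_gt0 p_gt0. Qed.

(** The two linear forms add up to s (k + l). Weight 1 + s thus gives order 3, which [exp_lie]
    statements require of a generator. *)
Lemma rfil_ord N w f : (s * N < 2 * w)%N -> F w f -> ord N.+1 f.
Proof.
move=> Nw wf; apply/hat_ord => k l kl; apply: wf; apply/negP => /and3P[_ H1 H2].
have := leq_add H1 H2.
have -> : (p * k + q * l + (q * k + p * l) = s * (k + l))%N by ring.
rewrite addnn -mul2n leqNgt => /negP; apply.
by apply: leq_ltn_trans Nw; rewrite leq_pmul2l.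
Qed.

Lemma rfil_filtration : filtration F s s.
Proof.
split.
- by move=> w; rewrite /F hat0; exact: wfil0.
- by move=> w f g; rewrite /F hatD; exact: wfilD.
- by move=> w c f; rewrite /F hatZ; exact: wfilZ.
- by move=> w w' f; exact: wfil_le.
- by move=> v w f g; rewrite /F hat_jac => Ff Fg; apply/wfilZ/wfil_jac.
- move=> w f fN k l kl; have [g [Fg]] := fN (k + l).+1.
  move=> /hat_ord; rewrite hatB => /(_ k l (ltnSn _)) /eqP.
  by rewrite serB subr_eq0 => /eqP ->; exact: Fg.
- by move=> N f Ff; apply/hat_ord; exact: wfil_ord Ff.
Qed.
Local Notation filF := rfil_filtration.

Lemma rfilM v w f g : F v f -> F w g -> F (v + w) (f * g).
Proof. by rewrite /F hatM; exact: wfilM. Qed.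
Lemma rfilX v f k : F v f -> F (k * v) (f ^+ k).
Proof. by rewrite /F hatX; exact: wfilX. Qed.

Lemma rfil_pow_diff f g P : F h f -> F h g -> F (h + 1) (f - g) ->
  F (P * h + 1) (f ^+ P - g ^+ P).
Proof.
move=> Ff Fg fg; elim: P => [|P IH].
  by rewrite !expr0 subrr; exact: (fil0 filF).
have -> : f ^+ P.+1 - g ^+ P.+1 = f * (f ^+ P - g ^+ P) + (f - g) * g ^+ P.
  by rewrite !exprS; ring.
rewrite mulSn; apply: (filD filF).
  by rewrite -addnA; exact: rfilM.
by rewrite addnAC; apply: rfilM => //; exact: rfilX.
Qed.

Lemma rnf_fil w f g : rnf w f -> F w (g - f) -> rnf w g.
Proof.
move=> nf; rewrite /F hatB => Fgf; rewrite /rnf -(subrK (hat f) (hat g)).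
by apply: nf_belowD => //; exact: wfil_nf_below Fgf.
Qed.

Lemma real_ham0 : exists H0 : series R, hat H0 = ham.
Proof.
apply: hat_surj; rewrite /ham0 ser_conjD !ser_conjZ ser_conjD !ser_conj_mono.
congr (_ *: _ + _ *: _); last exact: addrC.
- by apply/eqP; rewrite eq_complex /= oppr0 !eqxx.
- by apply/eqP; rewrite eq_complex /= oppr0 !eqxx.
Qed.

Section WithHam.
Variables (H0 I Zn : series R).
Hypotheses (hatH0 : hat H0 = ham) (hatI : hat I = ser_mono C 1 1).
Hypothesis hatZn : hat Zn = ser_mono C n 0 + ser_mono C 0 n.

Lemma real_solve v f : (0 < v)%N -> F 0 f -> rnf (v + h) f ->
  exists2 eta, F (v + s) eta & rnf (v + h).+1 (f + jac H0 eta).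
Proof.
move=> v0 F0f nf.
(* [hat_jac] contributes -2 i, and exchanging the arguments of the bracket changes the sign. *)
pose kap : C := 2 * Complex 0 1.
have kap0 : kap != 0 by rewrite mulf_neq0 ?i_neq0 ?pnatr_eq0.
have kapc : kap^* = - kap by rewrite rmorphM /= conjC_nat conj_i mulrN.
have [u Wu nfu] := solve_nf p_gt0 pq n_gt1 b0C ahC (solv v0) kap0 F0f nf.
have Ham_c : ser_conj ham = ham by rewrite -hatH0 ser_conj_hat.
(* Conjugation changes the sign of the bracket and of the imaginary [kap], so the conjugate of u is
   a solution too; the mean of both comes from a real series. *)
pose u' := 2^-1 *: (u + ser_conj u).
have [eta He] : exists eta, hat eta = u'.
  apply: hat_surj; rewrite /u' ser_conjZ ser_conjD ser_conjK fmorphV /= conjC_nat.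
  by rewrite [ser_conj u + u]addrC.
exists eta.
  by rewrite /F He; apply: wfilZ; apply: wfilD => //; exact: wfil_conj.
rewrite /rnf hatD hat_jac hatH0 He jacC scalerN -scaleNr mulNr opprK -/kap.
have -> : hat f + kap *: jac u' ham = 2^-1 *: ((hat f + kap *: jac u ham) +
    ser_conj (hat f + kap *: jac u ham)).
  rewrite ser_conjD ser_conj_hat ser_conjZ ser_conj_jac kapc Ham_c.
  rewrite scalerN scaleNr opprK /u' jacZl jacDl.
  by apply/serP => k l; rewrite !(serD, serZ); field.
apply: nf_belowZ; apply: nf_belowD => //; exact: nf_below_conj.
Qed.

Lemma real_kernel v eta : (0 < v)%N -> F (v + s) eta ->
  rnf (v + h).+1 (jac H0 eta) -> exists (c : R) P,
  (c = 0 \/ (v + s = P * h)%N) /\ F (v + s).+1 (eta - c *: H0 ^+ P).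
Proof.
move=> v0 Feta nf.
pose kap : C := 2 * Complex 0 1.
have kap0 : kap != 0 by rewrite mulf_neq0 ?i_neq0 ?pnatr_eq0.
have nf' : nf_below p q allowed (v + h).+1 (jac (hat eta) ham).
  rewrite -[jac _ _](scalerK kap0); apply: nf_belowZ.
  by move: nf; rewrite /rnf hat_jac hatH0 jacC scalerN -scaleNr mulNr opprK.
have [c [P [cP FcP]]] := kernel_nf p_gt0 pq n_gt1 b0C ahC (inj v0) Feta nf'.
have Ham_c : ser_conj (ham ^+ P) = ham ^+ P by rewrite -hatH0 -hatX ser_conj_hat.
exists (complex.Re c), P; split.
  by case: cP => [->|]; [left|right].
rewrite /F hatB hatZ hatX hatH0.
(* Averaging with the conjugate replaces c by its real part, since [hat eta] and the power of [ham]
   are self-conjugate. *)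
have -> : hat eta - (complex.Re c)%:C%C *: ham ^+ P =
    2^-1 *: ((hat eta - c *: ham ^+ P) + ser_conj (hat eta - c *: ham ^+ P)).
  rewrite ser_conjB ser_conj_hat ser_conjZ Ham_c.
  have -> : (complex.Re c)%:C%C = 2^-1 * (c + c^*).
    case: (c) => x y; apply/eqP; rewrite eq_complex /=.
    by apply/andP; split; apply/eqP; field.
  by apply/serP => k l; rewrite !(serB, serD, serZ, serN); field.
by apply: wfilZ; apply: wfilD => //; exact: wfil_conj.
Qed.

Lemma real_nondegenerate v zeta : (0 < v)%N -> F (v + s) zeta ->
  F (v + s).+1 (jac I zeta) -> F (v + h).+1 (jac Zn zeta) -> F (v + s).+1 zeta.
Proof.
move=> v0 Fz; rewrite /F !hat_jac hatI hatZn => F1 F2.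
have k0 : - 2 * Complex 0 1 != 0 :> C.
  by rewrite mulf_neq0 ?i_neq0 // oppr_eq0 pnatr_eq0.
apply: wfil_nondegenerate => //.
  by rewrite -[ser_jac _ _](scalerK k0); apply: wfilZ.
by rewrite -[ser_jac _ _](scalerK k0); apply: wfilZ.
Qed.

Let FH0 : F h H0. Proof. by rewrite /F hatH0; exact: ham0_fil. Qed.

Lemma rfil_lead H : F (h + 1) (H - H0) -> F h H.
Proof.
move=> FH; rewrite -(subrK H0 H); apply: (filD filF) => //.
by apply: (fil_le filF) FH; rewrite leq_addr.
Qed.

Let ord3 f : F (1 + s) f -> ord 3 f.
Proof. by apply: rfil_ord; clear -p_gt0; lia. Qed.

(** Adding eta to chi changes exp(L_chi) H by {H, eta} up to higher weight, and only the leading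
    part H0 enters this bracket at the weight being treated. Earlier weights are left untouched, so
    the sum of all corrections converges. *)
Lemma normal_form_exists H : F (h + 1) (H - H0) ->
  exists2 chi, F (1 + s) chi & forall w, rnf w (E chi H).
Proof.
move=> FHH0; have FH := rfil_lead FHH0.
pose Q k chi := F (1 + s) chi /\ rnf (k + 1 + h) (E chi H).
have [||chi Hchi] := @fil_iterate _ _ _ _ filF Q 0.
- split; first exact: (fil0 filF).
  rewrite exp_lie0; apply: rnf_fil (_ : rnf _ H0) _; first by rewrite /rnf hatH0.
  by rewrite add0n addnC.
- move=> k chi [Fchi nf].
  have FE : F 0 (E chi H).
    apply: (fil_le filF) (leq0n h) _.
    by apply: (exp_lie_fil filF) => //; exact: ord3.
  have nf' : rnf (k.+1 + h) (E chi H) by move: nf; rewrite addn1.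
  have [eta Feta nfeta] := real_solve (ltn0Sn k) FE nf'.
  exists (chi + eta); split; last first.
    rewrite addrC addKr; apply: (fil_le filF) Feta.
    by rewrite (leq_trans (leqnSn k)) ?leq_addr.
  have F1eta : F (1 + s) eta by apply: (fil_le filF) Feta; rewrite leq_add2r.
  split; first exact: (filD filF).
  have -> : (k.+1 + 1 + h = (k.+1 + h).+1)%N by lia.
  apply: rnf_fil nfeta _.
  have -> : E (chi + eta) H - (E chi H + jac H0 eta) =
      (E (chi + eta) H - E chi H - jac H eta) + jac (H - H0) eta.
    by rewrite jacBl; ring.
  apply: (filD filF).
    have := exp_lie_perturb filF (ltn0Sn k) (ord3 Fchi) (ord3 F1eta) Fchi Feta FH.
    by apply: (fil_le filF); lia.
  by apply: (fil_le filF) (fil_jac filF FHH0 Feta); lia.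
have Fchi : F (1 + s) chi.
  have [chik [[Fk _] dk]] := Hchi (1 + s)%N.
  by rewrite -(subrK chik chi); exact: (filD filF).
exists chi => // w.
have [chik [[Fk nfk] dk]] := Hchi (w.+1 + s)%N.
apply: rnf_fil (nf_below_le (_ : w <= _)%N nfk) _; first by lia.
set eta := chi - chik in dk.
have F1eta : F (1 + s) eta by apply: (fil_le filF) dk; rewrite leq_add2r.
have -> : chi = chik + eta by rewrite addrC subrK.
rewrite -(subrK (jac H eta) (E (chik + eta) H - E chik H)).
apply: (filD filF).
  have := exp_lie_perturb filF (ltn0Sn w) (ord3 Fk) (ord3 F1eta) Fk dk FH.
  by apply: (fil_le filF); lia.
by apply: (fil_le filF) (fil_jac filF FH dk); lia.
Qed.

Variable Rm : smap R.
Hypothesis Rm_can : formal_canonical Rm.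
Hypothesis Rm_inv : forall f, f \o' Rm = f <-> F 0 f.
Hypothesis inv_ord3 : forall f, F 0 f -> ord 3 f -> F (1 + s) f.

(** Conjugating exp(L_chi) with the rotation gives the generator chi o Rm; as P commutes with the
    rotation, uniqueness of logarithms makes chi invariant. *)
Lemma time_one_log_invariant P : formal_canonical P ->
  ord 2 (P.1 - ser_x R) -> ord 2 (P.2 - ser_y R) ->
  (forall f, f \o' P \o' Rm = f \o' Rm \o' P) ->
  exists2 chi, F (1 + s) chi & forall f, f \o' P = E chi f.
Proof.
move=> /formal_canonicalP[P0 jP _] P1 P2 PR.
have [chi c3 EP] := exp_lie_log jP P1 P2.
have Echi f : f \o' P = E chi f by rewrite EP exp_lieE.
exists chi => //; apply: inv_ord3 => //; apply/Rm_inv.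
have [Rm0 _ _] := formal_canonicalP Rm_can.
apply: exp_lie_inj => //; first exact: ser_subst_ord.
move=> g; have [f <-] := formal_canonical_surj g Rm_can.
by rewrite -exp_lie_subst // -!Echi PR.
Qed.

Lemma fil_invariant_exp chi f : F (1 + s) chi -> E chi f \o' Rm = E chi (f \o' Rm).
Proof.
move=> Fchi; rewrite exp_lie_subst //; last exact: ord3.
have -> // : chi \o' Rm = chi.
by apply/Rm_inv; apply: (fil_le filF) Fchi.
Qed.

(* Powers of H commute with H, so exp(L_chi) may be composed with exp(-L_G) for
   the multiple G of a power of H that cancels the leading part of chi. *)
Lemma normal_form_step H H' chi v : (0 < v)%N ->
  F (h + 1) (H - H0) -> (forall w, rnf w H) -> (forall w, rnf w H') ->
  F (v + s) chi -> E chi H = H' ->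
  exists2 chi', F (v.+1 + s) chi' & E chi' H = H'.
Proof.
move=> v0 FHH0 nH nH' Fchi EH; have FH := rfil_lead FHH0.
have F1s u f : (0 < u)%N -> F (u + s) f -> F (1 + s) f.
  by move=> u0; apply: (fil_le filF); rewrite leq_add2r.
have c3 : ord 3 chi by apply: ord3; exact: F1s Fchi.
have nfj : rnf (v + h).+1 (jac H0 chi).
  have nd : rnf (v + h).+1 (H' - H) by rewrite /rnf hatB; exact: nf_belowB (nH' _) (nH _).
  apply: rnf_fil nd _.
  have -> : jac H0 chi - (H' - H) =
     - (jac (H - H0) chi) - (E chi H - H - jac H chi).
    by rewrite jacBl EH; ring.
  apply: (filB filF).
    by apply: (filN filF); apply: (fil_le filF) (fil_jac filF FHH0 Fchi); lia.
  by apply: (fil_le filF) (exp_lie_first filF v0 c3 Fchi FH); lia.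
have [c [P [cP FcP]]] := real_kernel v0 Fchi nfj.
pose G := c *: H ^+ P.
have FG : F (v + s) G.
  rewrite /G; case: cP => [->|->]; first by rewrite scale0r; exact: (fil0 filF).
  by apply: (filZ filF); exact: rfilX.
have FcG : F (v.+1 + s) (chi - G).
  have -> : chi - G = (chi - c *: H0 ^+ P) - c *: (H ^+ P - H0 ^+ P).
    by rewrite /G scalerBr; ring.
  apply: (filB filF); first by rewrite addSn.
  rewrite /G; case: cP => [->|E1]; first by rewrite scale0r; exact: (fil0 filF).
  by apply: (filZ filF); rewrite addSn -addn1 E1; exact: rfil_pow_diff.
have GH : jac H G = 0 by rewrite /G jacZr jacC jac_pow oppr0 scaler0.
have G3 : ord 3 (- G) by apply/ordN/ord3; exact: F1s FG.
have FNG : F (v + s) (- G) by exact: (filN filF).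
pose S := smap_comp (time_one_map (- G)) (time_one_map chi).
have SE f : f \o' S = E chi (E (- G) f).
  rewrite -ser_subst_comp ?exp_lieE //; exact: time_one_no_constant.
have S0 : no_constant S by apply: no_constant_comp; exact: time_one_no_constant.
have Sid g : ord 1 g -> ord 2 (g \o' S - g).
  move=> g1; rewrite SE -(subrK (E (- G) g) (E chi _)) -addrA.
  apply: ordD.
    apply: (@exp_lie_close _ _ _ _ (@ord_filtration R) _ 1 1) => //.
    exact: exp_lie_ord.
  exact: (@exp_lie_close _ _ _ _ (@ord_filtration R) _ 1 1).
have [|||f|chi' F1' Echi'] := @time_one_log_invariant S.
- by apply: formal_canonical_comp; exact: time_one_canonical.
- by have := Sid (ser_x R); rewrite ser_substx //; apply => -[|i] [|j].
- by have := Sid (ser_y R); rewrite ser_substy //; apply => -[|i] [|j].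
- rewrite !SE !fil_invariant_exp //; [exact: F1s FNG|exact: F1s Fchi].
have E' f : E chi' f = E chi (E (- G) f) by rewrite -Echi' SE.
have EH' : E chi' H = H'.
  by rewrite E' (exp_lie_fix G3) // jacNr GH oppr0.
exists chi' => //.
(* To first order the composed map acts through chi - G, whose weight is one higher than that of
   chi. *)
have close t f : F t f -> F (t + v + 1) (E chi' f - f).
  move=> Ff; rewrite E'; set g := E (- G) f.
  have Fg : F t g by apply: (exp_lie_fil filF) => //; exact: F1s FNG.
  have -> : E chi g - f = (E chi g - g - jac g chi) +
      (g - f - jac f (- G)) + jac (g - f) chi + jac f (chi - G).
    by rewrite jacNr jacBl jacBr; ring.
  apply: (filD filF); last first.
    by apply: (fil_le filF) (fil_jac filF Ff FcG); lia.
  apply: (filD filF); last first.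
    have Fgf := exp_lie_close filF v0 G3 FNG Ff.
    by apply: (fil_le filF) (fil_jac filF Fgf Fchi); lia.
  by apply: (filD filF); apply: (exp_lie_first filF).
have c'3 := ord3 F1'.
(* Bootstrapping: {f, chi'} equals exp(L_chi') f - f up to a weight higher than the one known for
   chi', so by [close] its brackets with z w and z^n + w^n are small, and [real_nondegenerate]
   raises the weight of chi' by one, up to v + 1 + s. *)
suff main u : (u <= v)%N -> F (u.+1 + s) chi' by exact: main.
elim: u => [//|u IH] uv; have {IH}Fu := IH (ltnW uv).
have Fjac t f : F t f -> F (t + u.+2) (jac f chi').
  move=> Ff.
  have -> : jac f chi' = (E chi' f - f) - (E chi' f - f - jac f chi') by ring.
  apply: (filB filF).
    by apply: (fil_le filF) (close t f Ff); lia.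
  by apply: (fil_le filF) (exp_lie_first filF (ltn0Sn u) c'3 Fu Ff); lia.
rewrite addSn; apply: (@real_nondegenerate u.+1) => //.
  have FI : F s I.
    rewrite /F hatI; apply: wfil_mono.
    by rewrite /wok eqxx !muln1 leqnn addnC leqnn.
  by apply: (fil_le filF) (Fjac _ _ FI); lia.
have FZ : F h Zn.
  have [z w] := wfil_mono_n C pq (leqnn h).
  by rewrite /F hatZn; exact: wfilD.
by apply: (fil_le filF) (Fjac _ _ FZ); lia.
Qed.

Lemma normal_form_unique H H' chi :
  F (h + 1) (H - H0) -> (forall w, rnf w H) -> (forall w, rnf w H') ->
  F (1 + s) chi -> E chi H = H' -> H = H'.
Proof.
move=> FHH0 nH nH' Fchi EH; have FH := rfil_lead FHH0.
have all v : exists2 chi', F (v.+1 + s) chi' & E chi' H = H'.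
  elim: v => [|v [chi' F' E']]; first by exists chi.
  exact: normal_form_step (ltn0Sn v) FHH0 nH nH' F' E'.
apply/eqP; rewrite eq_sym -subr_eq0; apply/eqP.
apply: (fil_eq0 filF) => w; have [chi' F' <-] := all w.
have c3 : ord 3 chi' by apply: ord3; apply: (fil_le filF) F'; rewrite leq_add2r.
by apply: (fil_le filF) (exp_lie_close filF (ltn0Sn w) c3 F' FH); lia.
Qed.

End WithHam.
End RealSide.

(** * Resonant Hamiltonians in complex coordinates *)

Section ResonantHam.
Variable R : rcfType.
Local Notation C := R[i].
Local Notation ord := (@ser_order_ge _).
Implicit Types (A B : nat -> R) (f : series R).
Local Notation mono := (@ser_mono C).

Lemma hat_x : hat (ser_x R) = 2^-1 *: (ser_x C + ser_y C).
Proof.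
by rewrite /hat ser_map_mono ser_substx //; exact: no_constant_zw_to_xy.
Qed.
Lemma hat_y : hat (ser_y R) = (2 * Complex 0 1)^-1 *: (ser_x C - ser_y C).
Proof.
by rewrite /hat ser_map_mono ser_substy //; exact: no_constant_zw_to_xy.
Qed.

Lemma hat_xiy : hat (ser_x R) + Complex 0 1 *: hat (ser_y R) = ser_x C /\
  hat (ser_x R) - Complex 0 1 *: hat (ser_y R) = ser_y C.
Proof.
have i0 := i_neq0 R.
rewrite hat_x hat_y; split; apply/serP => k l;
  rewrite !(serB, serD, serZ, serN); field; by rewrite ?i0.
Qed.

Lemma real_half : (2^-1 : R)%:C%C = 2^-1 :> C.
Proof. by rewrite (fmorphV (real_complex R)) (rmorph_nat (real_complex R)). Qed.

Lemma hat_I : hat (ser_I R) = 2^-1 *: mono 1 1.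
Proof.
rewrite /ser_I ser_addE ser_scaleE hatZ hatD real_half !monoE !expr0 mulr1 mul1r.
rewrite !hatX !expr1; congr (_ *: _).
have [<- <-] := hat_xiy.
set x := hat _; set y := hat _.
have -> : (x + Complex 0 1 *: y) * (x - Complex 0 1 *: y) =
    x ^+ 2 - (Complex 0 1 *: y) ^+ 2 by ring.
by rewrite exprZn (expr2 (Complex 0 1 : C)) ii scaleN1r opprK.
Qed.

Lemma hat_zpow n : hat (ser_zpow R n).1 = 2^-1 *: (mono n 0 + mono 0 n).
Proof.
suff [H1 H2] : hat (ser_zpow R n).1 + Complex 0 1 *: hat (ser_zpow R n).2 = mono n 0
  /\ hat (ser_zpow R n).1 - Complex 0 1 *: hat (ser_zpow R n).2 = mono 0 n.
  by rewrite -H1 -H2; apply/serP => k l; rewrite !(serB, serD, serZ, serN); field.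
elim: n => [|n [IH1 IH2]].
  have -> : (ser_zpow R 0).2 = 0 by [].
  by rewrite hat0 scaler0 subr0 addr0 hat1.
have -> : (ser_zpow R n.+1).1 =
  ser_x R * (ser_zpow R n).1 - ser_y R * (ser_zpow R n).2 by [].
have -> : (ser_zpow R n.+1).2 =
  ser_x R * (ser_zpow R n).2 + ser_y R * (ser_zpow R n).1 by [].
rewrite hatB hatD !hatM.
rewrite (monoE C n.+1) (monoE C 0 n.+1) !exprS !expr0 !mulr1 !mul1r.
move: IH1 IH2; rewrite !monoE !expr0 mulr1 mul1r => <- <-.
have [<- <-] := hat_xiy.
move: (hat (ser_x R)) (hat (ser_y R)) (hat (ser_zpow R n).1) (hat (ser_zpow R n).2) => x y u w.
have := ii R; move: (Complex 0 1 : C) => c cc.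
have e1 : y * w = - ((c *: y) * (c *: w)).
  by rewrite -(scalerAr c (c *: y) w) -(scalerAl c y w) scalerA cc scaleN1r opprK.
have e2 : c *: (x * w + y * u) = x * (c *: w) + (c *: y) * u.
  by rewrite (scalerDr c) (scalerAr c x w) (scalerAl c y u).
by rewrite e1 e2; split; ring.
Qed.

(** Coefficient of z^n + w^n in I^(n/2) cos (n phi): the factor 2^(-n/2), times 1/2 from taking the
    real part. *)
Definition icos n : R := (Num.sqrt 2 ^+ n)^-1 / 2.

Lemma icos_gt0 n : 0 < icos n.
Proof. by rewrite /icos divr_gt0 ?ltr0n // invr_gt0 exprn_gt0 // sqrtr_gt0 ltr0n. Qed.

Lemma hat_Icos n : hat (ser_Icos R n) = (icos n)%:C%C *: (mono n 0 + mono 0 n).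
Proof.
rewrite /ser_Icos ser_scaleE hatZ hat_zpow scalerA; congr (_ *: _).
by rewrite -real_half -(rmorphM (real_complex R)).
Qed.

Lemma hat_subst1_I A k l :
  hat (ser_subst1 A (ser_I R)) k l = if k == l then (A k / 2 ^+ k)%:C%C else 0.
Proof.
pose N := (k + l).+1.
have I1 : ord 1 (ser_I R).
  by move=> -[|i] [|j] // _; rewrite /ser_I ser_scaleE serZ ser_addE serD
    /ser_mono /= addr0 mulr0.
have trunc : ord N (ser_subst1 A (ser_I R) - \sum_(m < N) A m *: ser_I R ^+ m).
  move=> i j ij; rewrite serB ser_sum; apply/eqP; rewrite subr_eq0; apply/eqP.
  rewrite /ser_subst1.
  have -> : \sum_(m < (i + j).+1) A m * ser_exp (ser_I R) m i j =
      \sum_(m < (i + j).+1) (A m *: ser_I R ^+ m) i j.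
    by apply: eq_bigr => m _; rewrite ser_expE.
  rewrite (big_ord_widen _ (fun m => (A m *: ser_I R ^+ m) i j) ij) big_mkcond.
  apply: eq_bigr => m _; case: ifP => // /negbT; rewrite -leqNgt => jm.
  by have := @ordX _ _ _ m I1; rewrite serZ muln1 => ->; rewrite ?mulr0.
have := (hat_ord _ _).2 trunc; rewrite hatB => /(_ k l (ltnSn _)) /eqP.
rewrite serB subr_eq0 => /eqP ->.
have -> : hat (\sum_(m < N) A m *: ser_I R ^+ m) =
    \sum_(m < N) (A m / 2 ^+ m)%:C%C *: mono m m.
  rewrite (big_morph _ (@hatD R) (@hat0 R)); apply: eq_bigr => m _.
  rewrite hatZ hatX hat_I exprZn scalerA.
  have -> : mono 1 1 ^+ m = mono m m.
    by elim: (nat_of_ord m) => // m' IH; rewrite exprS IH mono_mul.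
  by rewrite -real_half -(rmorphXn (real_complex R)) -(rmorphM (real_complex R)) exprVn.
rewrite ser_sum; have kN : (k < N)%N by rewrite ltnS leq_addr.
rewrite (bigD1 (Ordinal kN)) //= big1 ?addr0.
  rewrite serZ /ser_mono eqxx /= eq_sym.
  by case: (k == l); rewrite ?mulr1 ?mulr0.
move=> m /eqP mk; rewrite serZ /ser_mono; case: (k =P m) => [E|]; last by rewrite mulr0.
by case: mk; apply/val_inj.
Qed.

Lemma hat_resonant_ham m n A B k l : (0 < n)%N ->
  hat (resonant_ham m n A B) k l =
  (if (k == l) && (m <= k)%N then (A (k - m)%N / 2 ^+ k)%:C%C else 0) +
  (icos n)%:C%C * ((if k == (l + n)%N then (B l / 2 ^+ l)%:C%C else 0) +
                 (if l == (k + n)%N then (B k / 2 ^+ k)%:C%C else 0)).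
Proof.
move=> n0; rewrite /resonant_ham ser_addE hatD serD !ser_mulE !hatM ser_expE.
congr (_ + _).
  rewrite hatX hat_I exprZn -scalerAl serZ mulrC.
  have -> : mono 1 1 ^+ m = mono m m.
    by elim: (m) => // m' IH; rewrite exprS IH mono_mul.
  rewrite [_ * hat _]mulrC mul_mono hat_subst1_I.
  case: (leqP m k) => mk; last by rewrite andbF mul0r.
  rewrite andbT; case: (leqP m l) => ml /=; last first.
    by rewrite mul0r; case: eqP => // E; move: ml; rewrite -E ltnNge mk.
  rewrite -(eqn_add2r m) !subnK //; case: eqP => [E|_]; last by rewrite mul0r.
  rewrite -real_half -(rmorphXn (real_complex R)) -(rmorphM (real_complex R)).
  have -> : (2 : R) ^+ k = 2 ^+ (k - m) * 2 ^+ m by rewrite -exprD subnK.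
  by congr (_%:C)%C; rewrite exprVn invfM mulrA.
rewrite hat_Icos -scalerAl serZ mulrDl serD; congr (_ * (_ + _)).
  rewrite mulrC mul_mono leq0n andbT subn0 hat_subst1_I.
  case: leqP => nk; last first.
    by case: eqP => // E; move: nk; rewrite E ltnNge leq_addl.
  have -> : (k - n == l)%N = (k == l + n)%N by rewrite -(eqn_add2r n) subnK.
  by case: eqP => // ->; rewrite addnK.
rewrite mulrC mul_mono leq0n /= subn0 hat_subst1_I.
case: leqP => nl; last first.
  by case: eqP => // E; move: nl; rewrite E ltnNge leq_addl.
by rewrite -(eqn_add2r n) subnK // eq_sym.
Qed.

Lemma ser_conj_diag f k : hat f k k = (complex.Re (hat f k k))%:C%C.
Proof.
have /serP/(_ k k) := ser_conj_hat f; rewrite /ser_conj.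
case: (hat f k k) => x y [] /eqP; rewrite eq_sym -addr_eq0 -mulr2n mulrn_eq0 /=.
by move=> /eqP ->.
Qed.

Lemma ser_conj_sym f k l : hat f k l = hat f l k ->
  hat f k l = (complex.Re (hat f k l))%:C%C.
Proof.
move=> E; have /serP/(_ k l) := ser_conj_hat f; rewrite /ser_conj -E.
case: (hat f k l) => x y [] /eqP; rewrite eq_sym -addr_eq0 -mulr2n mulrn_eq0 /=.
by move=> /eqP ->.
Qed.

(** The powers of 2 here and in [cos_coef] undo I = z w / 2. *)
Definition diag_coef m f k : R := complex.Re (hat f (k + m)%N (k + m)%N) * 2 ^+ (k + m).
Definition cos_coef n f l : R := complex.Re (hat f (l + n)%N l) * 2 ^+ l / icos n.

(** Symmetric coefficients of a real series are real, so the real parts taken in [diag_coef] and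
    [cos_coef] lose nothing. *)
Lemma resonant_hamP m n f : (0 < n)%N ->
  (forall k l, hat f k l = hat f l k) ->
  (forall k l, (l <= k)%N -> ~~ ((k == l) && (m <= k)%N || (k == (l + n)%N)) ->
     hat f k l = 0) ->
  f = resonant_ham m n (diag_coef m f) (cos_coef n f).
Proof.
move=> n0 sym supp; apply: hat_inj; apply/serP.
have pow2 k : (2 : R) ^+ k != 0 by rewrite expf_neq0 ?pnatr_eq0.
have ic0 : icos n != 0 by rewrite gt_eqF ?icos_gt0.
suff main k l : (l <= k)%N ->
  hat f k l = hat (resonant_ham m n (diag_coef m f) (cos_coef n f)) k l.
  move=> k l; case: (leqP l k) => [/main //|/ltnW kl].
  rewrite sym main // !hat_resonant_ham //; congr (_ + _ * _); last exact: addrC.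
  by rewrite eq_sym; case: eqP => [->|].
move=> lk; rewrite hat_resonant_ham //.
have -> : (l == k + n)%N = false by apply/eqP; lia.
rewrite addr0.
case: (k =P l) => [E|kl] /=.
  have -> : (k == l + n)%N = false by apply/eqP; lia.
  rewrite mulr0 addr0; case: leqP => mk.
    by rewrite /diag_coef subnK // mulfK ?pow2 // -E -ser_conj_diag.
  apply: supp => //; rewrite negb_or; apply/andP; split; last by apply/eqP; lia.
  by rewrite negb_and -ltnNge mk orbT.
rewrite add0r; case: eqP => [E|kln].
  rewrite -(rmorphM (real_complex R)) /cos_coef.
  have -> : icos n * (complex.Re (hat f (l + n)%N l) * 2 ^+ l / icos n / 2 ^+ l) =
      complex.Re (hat f (l + n)%N l).
    by field; rewrite pow2 ic0.
  by rewrite E; apply: ser_conj_sym; exact: sym.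
rewrite mulr0; apply: supp => //; rewrite negb_or negb_and.
by move/eqP: kl => ->; apply/eqP.
Qed.

Lemma resonant_ham_coef m n A B k : (0 < n)%N ->
  hat (resonant_ham m n A B) (k + m)%N (k + m)%N = (A k / 2 ^+ (k + m))%:C%C /\
  hat (resonant_ham m n A B) (k + n)%N k = (icos n * (B k / 2 ^+ k))%:C%C.
Proof.
move=> n0; rewrite !hat_resonant_ham // eqxx leq_addl addnK eqxx.
have -> : (k + m == k + m + n)%N = false by apply/eqP; lia.
have -> : (k + n == k)%N = false by apply/eqP; lia.
have -> : (k == k + n + n)%N = false by apply/eqP; lia.
by rewrite /= !addr0 mulr0 addr0 add0r -(rmorphM (real_complex R)).
Qed.

Lemma resonant_ham_inj m n A B A' B' : (0 < n)%N ->
  resonant_ham m n A B = resonant_ham m n A' B' -> A =1 A' /\ B =1 B'.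
Proof.
move=> n0 E.
have pow2 k : ((2 : R) ^+ k)^-1 != 0 by rewrite invr_eq0 expf_neq0 ?pnatr_eq0.
have ic0 : icos n != 0 by rewrite gt_eqF ?icos_gt0.
split=> k; have [H1 H2] := resonant_ham_coef m A B k n0;
  have [H1' H2'] := resonant_ham_coef m A' B' k n0.
  move: H1; rewrite E H1' => /(fmorph_inj (real_complex R)) /(mulIf (pow2 _)).
  exact: esym.
move: H2; rewrite E H2' => /(fmorph_inj (real_complex R)) /(mulfI ic0).
by move=> /(mulIf (pow2 _)) /esym.
Qed.

Lemma resonant_ham_ord3 m n A B : (2 <= m)%N -> (3 <= n)%N ->
  ord 3 (resonant_ham m n A B).
Proof.
move=> m2 n3; apply/hat_ord => k l kl; rewrite hat_resonant_ham; last by lia.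
rewrite (_ : (k == l) && (m <= k)%N = false); last by apply/negP => /andP[/eqP]; lia.
rewrite (_ : (k == l + n)%N = false); last by apply/eqP; lia.
rewrite (_ : (l == k + n)%N = false); last by apply/eqP; lia.
by rewrite !addr0 mulr0 ?addr0.
Qed.

Lemma resonant_ham_resonant m n p q A B : (0 < n)%N ->
  wfil n p q 0 (hat (resonant_ham m n A B)).
Proof.
move=> n0 k l; rewrite /wok !leq0n !andbT hat_resonant_ham // => kl.
have -> : (k == l) = false by apply: contraNF kl => /eqP ->.
have -> : (k == l + n)%N = false by apply: contraNF kl => /eqP ->; rewrite modnDr.
have -> : (l == k + n)%N = false by apply: contraNF kl => /eqP ->; rewrite modnDr.
by rewrite !addr0 mulr0 ?addr0.
Qed.

End ResonantHam.

(** * Rotations *)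

Section Rotations.
Variable R : rcfType.
Local Notation C := R[i].
Implicit Types (f g : series R) (c s : R) (S : smap R).
Local Notation ord := (@ser_order_ge _).
Local Notation "f \o' P" := (ser_subst f P) (at level 40, left associativity).

Definition rot c s : smap R := smap_linear (rot_mx c s).

Lemma rot_no_constant c s : no_constant (rot c s).
Proof. exact: smap_linear_no_constant. Qed.
Local Hint Resolve rot_no_constant : core.

Lemma rotE c s : rot c s =
  (c *: ser_x R - s *: ser_y R, s *: ser_x R + c *: ser_y R).
Proof.
rewrite /rot /smap_linear !mxE /= !ser_addE !ser_scaleE.
by congr (_, _); apply/serP => i j; rewrite !(serB, serD, serZ, serN); ring.
Qed.

Lemma unit_conj c s : c ^+ 2 + s ^+ 2 = 1 ->
  Complex c s * (Complex c s)^* = 1 :> C.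
Proof.
move=> cs; apply/eqP; rewrite eq_complex /=.
by apply/andP; split; apply/eqP; rewrite -?cs; ring.
Qed.

Lemma unit_complex (z : C) : z * z^* = 1 ->
  exists2 cs, z = Complex cs.1 cs.2 & cs.1 ^+ 2 + cs.2 ^+ 2 = 1.
Proof.
case: z => c s /eqP; rewrite eq_complex /= => /andP[/eqP H _].
by exists (c, s) => //=; rewrite -H; ring.
Qed.

Lemma rotK c s f : c ^+ 2 + s ^+ 2 = 1 -> f \o' rot c s \o' rot c (- s) = f.
Proof.
move=> cs; apply: hat_inj; apply/serP => k l; rewrite !hat_rot.
have -> : Complex c (- s) = (Complex c s)^* :> C by [].
rewrite conjCK; have := unit_conj cs; move: (_^*)%R => w.
set z := Complex c s => zw.
have -> : w ^+ k * z ^+ l * (z ^+ k * w ^+ l * hat f k l) =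
  (z * w) ^+ k * (z * w) ^+ l * hat f k l by rewrite !exprMn; ring.
by rewrite zw !expr1n !mul1r.
Qed.

Lemma rotC c s c' s' f :
  f \o' rot c s \o' rot c' s' = f \o' rot c' s' \o' rot c s.
Proof.
by apply: hat_inj; apply/serP => k l; rewrite !hat_rot; ring.
Qed.

Lemma rot_canonical c s : c ^+ 2 + s ^+ 2 = 1 -> formal_canonical (rot c s).
Proof.
move=> cs; have cs' : c ^+ 2 + (- s) ^+ 2 = 1 by rewrite sqrrN.
split=> //.
  exists (rot c (- s)); split=> //; apply/smapP; apply: smap_ext => //.
  - exact: no_constant_comp.
  - by move=> f; rewrite -ser_subst_comp // rotK // ser_subst_id.
  - exact: no_constant_comp.
  - move=> f; rewrite -ser_subst_comp // ser_subst_id.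
    by have := rotK f cs'; rewrite opprK.
apply/serP; rewrite rotE /= jacDr !jacBl !jacZl !jacZr !jacff (jacC (ser_y R)).
have -> : ser_jac (ser_x R) (ser_y R) = 1.
  by rewrite jacE ser_dx_x ser_dx_y ser_dy_x ser_dy_y mulr0 subr0 mulr1.
apply/serP => k l; rewrite !(serB, serD, serZ, serN, ser0, mulr0).
by rewrite -[RHS]mul1r -cs; ring.
Qed.

Lemma subst_linear_coef1 f (M : 'M[R]_2) :
  (f \o' smap_linear M) 1%N 0%N = f 1%N 0%N * M 0 0 + f 0%N 1%N * M 1 0 /\
  (f \o' smap_linear M) 0%N 1%N = f 1%N 0%N * M 0 1 + f 0%N 1%N * M 1 1.
Proof.
have M0 := smap_linear_no_constant M.
have [L1 L2] := (ord1_no_constant _).1 M0.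
have L12 : ord 2 ((smap_linear M).1 * (smap_linear M).2) by exact: (ordM L1 L2).
by split; rewrite (@ser_substE _ _ M0 2) // !big_ord_recl !big_ord0
  /= !addr0 ?expr0 ?expr1 !mul1r ?mulr1 !serD !serZ ser1 /= L12 // !mulr0
  add0r addr0 addrC !ser_addE !ser_scaleE !serD !serZ /ser_x /ser_y
  /ser_mono /= !(mulr1, mulr0) ?addr0 ?add0r.
Qed.

(** In first order S commutes with a rotation of nonzero sine, which forces its linear part to be a
    multiplication by a complex number; Jacobian 1 gives it modulus 1. *)
Lemma linear_part_rotation ca sa S : sa != 0 -> formal_canonical S ->
  (forall f, f \o' S \o' rot ca sa = f \o' rot ca sa \o' S) ->
  exists c s, c ^+ 2 + s ^+ 2 = 1 /\
    [/\ S.1 1%N 0%N = c, S.1 0%N 1%N = - s, S.2 1%N 0%N = s & S.2 0%N 1%N = c].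
Proof.
move=> sa0 /formal_canonicalP[S0 jS _] comm.
have := comm (ser_x R).
rewrite ser_substx // [ser_x R \o' rot _ _]ser_substx // [in RHS]rotE /=.
rewrite ser_substB // !ser_substZ // ser_substx // ser_substy // => E.
have [H1 H2] := subst_linear_coef1 S.1 (rot_mx ca sa).
have := congr1 (fun u : series R => u 1%N 0%N) E; rewrite /rot H1 !mxE /=.
have := congr1 (fun u : series R => u 0%N 1%N) E; rewrite /rot H2 !mxE /=.
rewrite !serB !serZ => E2 E1.
have := congr1 (fun u : series R => u 0%N 0%N) jS.
rewrite jacE serB !serM !big_ord1 /ser_dx /ser_dy ser1 /= !mulr1n => E3.
move: E1 E2 E3.
set x1 := S.1 1%N 0%N; set y1 := S.1 0%N 1%N.
set x2 := S.2 1%N 0%N; set y2 := S.2 0%N 1%N => E1 E2 E3.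
have Ey1 : y1 = - x2.
  apply: (mulIf sa0); rewrite mulNr [x2 * _]mulrC.
  by move: E1; rewrite [x1 * _]mulrC => /addrI.
have Ey2 : y2 = x1.
  apply: (mulIf sa0); apply/eqP; rewrite -subr_eq0; apply/eqP.
  transitivity ((x1 * - sa + y1 * ca) - (ca * y1 - sa * y2)); first by ring.
  by rewrite E2 subrr.
exists x1, x2; split=> //.
by rewrite -E3 Ey1 Ey2; ring.
Qed.

Lemma ord2_linear f : f 0%N 0%N = 0 -> f 1%N 0%N = 0 -> f 0%N 1%N = 0 -> ord 2 f.
Proof. by move=> f00 f10 f01 [|[|k]] [|[|l]]. Qed.

Section SlotWeights.
Variables (n p q : nat).
Hypothesis pq : (p <= q)%N.
Local Notation FF := (@wfil C n p q).
Local Notation F := (@rfil R n p q).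

(** At the resonant point of parameters j and l the degree is 2 l + n j, so the passage from order
    to weight is an inequality between two linear forms in j and l. *)
Lemma rfil_of_ord W d f : F 0 f -> ord d f ->
  (forall j l, d <= 2 * l + n * j -> W <= (p + q) * l + p * n * j)%N -> F W f.
Proof.
move=> F0 /hat_ord fd HW; apply: wfil_slots => // j l low.
have H : (l + (l + n * j) < d)%N.
  rewrite ltnNge; apply/negP => H; have := HW j l.
  by rewrite mul2n -addnn -addnA H leqNgt low => /(_ isT).
by split; apply: fd; rewrite // addnC.
Qed.

End SlotWeights.

Section Resonance.
Variables (n p q : nat) (ca sa : R).
Hypothesis cs1 : ca ^+ 2 + sa ^+ 2 = 1.
Hypothesis prim : n.-primitive_root (Complex ca sa : C).
Local Notation FF := (@wfil C n p q).
Local Notation F := (@rfil R n p q).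
Local Notation Rm := (rot ca sa).

Let mu0 : (Complex ca sa : C) != 0.
Proof.
by apply/eqP => E; have := unit_conj cs1; rewrite E mul0r => /esym/eqP; rewrite oner_eq0.
Qed.

Lemma rot_invariant f : f \o' Rm = f <-> F 0 f.
Proof.
have E k l : (Complex ca sa : C) ^+ k * (Complex ca sa)^* ^+ l * hat f k l = hat f k l
    <-> hat f k l = 0 \/ k = l %[mod n].
  (* Multiplying by the l-th power cancels the conjugate factor and leaves pure powers, to which
     primitivity applies. *)
  have mul_z : (Complex ca sa : C) ^+ l *
     ((Complex ca sa) ^+ k * (Complex ca sa)^* ^+ l * hat f k l) =
     (Complex ca sa) ^+ k * hat f k l.
    rewrite mulrA [_ * (_ * _^*%R ^+ l)]mulrCA -exprMn unit_conj // expr1n mulr1.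
    by [].
  split=> [H|[->|kl]]; last 2 first.
  - by rewrite !mulr0.
  - apply: (mulfI (expf_neq0 l mu0)); rewrite mul_z; congr (_ * _).
    by apply/eqP; rewrite (eq_prim_root_expr prim); apply/eqP.
  move: mul_z; rewrite H => /eqP; rewrite -subr_eq0 -mulrBl mulf_eq0.
  case/orP => [|/eqP]; last by left.
  rewrite subr_eq0 (eq_prim_root_expr prim) => /eqP H1; right; exact: esym.
split=> [H k l nok|H].
  have H' : (Complex ca sa : C) ^+ k * (Complex ca sa)^* ^+ l * hat f k l = hat f k l.
    by rewrite -hat_rot -/Rm H.
  have [//|kl] := (E k l).1 H'.
  by case/negP: nok; rewrite /wok !leq0n !andbT; apply/eqP.
apply: hat_inj; apply/serP => k l; rewrite hat_rot; apply/E.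
have [/eqP kl|kl] := boolP (k == l %[mod n]); first by right.
by left; apply: H; rewrite /wok !leq0n !andbT.
Qed.

Lemma rot_order f : iter n (fun g => g \o' Rm) f = f.
Proof.
apply: hat_inj; apply/serP => k l.
have -> m : hat (iter m (fun g => g \o' Rm) f) k l =
    (Complex ca sa ^+ m) ^+ k * ((Complex ca sa)^* ^+ m) ^+ l * hat f k l.
  elim: m => [|m IH]; first by rewrite !expr0 !expr1n !mul1r.
  by rewrite iterS hat_rot IH !exprSr !exprMn; ring.
have z1 := prim_expr_order prim.
have w1 : (Complex ca sa : C)^* ^+ n = 1.
  by rewrite -(rmorphXn (@Num.conj C)) z1 rmorph1.
by rewrite z1 w1 !expr1n !mul1r.
Qed.

Lemma rfil_rot w c s f : F w f -> F w (f \o' rot c s).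
Proof. by move=> Ff k l nok; rewrite hat_rot Ff // mulr0. Qed.

Lemma sin_neq0 : (2 < n)%N -> sa != 0.
Proof.
move=> n2; apply/eqP => sa0.
have : (Complex ca sa : C) ^+ 2 = 1.
  rewrite -(unit_conj cs1) sa0 expr2; congr (_ * _).
  by apply/eqP; rewrite eq_complex /= oppr0 !eqxx.
move/eqP; rewrite -(prim_order_dvd prim) => /dvdn_leq.
by move/(_ isT); rewrite leqNgt n2.
Qed.

Hypothesis n_gt2 : (2 < n)%N.
Hypothesis inv_ord3 : forall f, F 0 f -> ord 3 f -> F (1 + (p + q)) f.

(** Removing the linear rotation from S leaves a near-identity map that still commutes with Rm,
    because plane rotations commute; its logarithm is then invariant. *)
Lemma commuting_canonical S : formal_canonical S ->
  (forall f, f \o' S \o' Rm = f \o' Rm \o' S) ->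
  exists c s chi, [/\ c ^+ 2 + s ^+ 2 = 1, F (1 + (p + q)) chi &
    forall f, f \o' S = ser_exp_lie chi (f \o' rot c s)].
Proof.
move=> Scan comm.
have [S0 _ _] := formal_canonicalP Scan.
have [c [s [cs [x1 y1 x2 y2]]]] := linear_part_rotation (sin_neq0 n_gt2) Scan comm.
have cs' : c ^+ 2 + (- s) ^+ 2 = 1 by rewrite sqrrN.
have Mcan := rot_canonical cs'.
pose S' := smap_comp (rot c (- s)) S.
have S'E f : f \o' S' = f \o' rot c (- s) \o' S by rewrite ser_subst_comp.
have [|||f|chi Fchi Echi] := @time_one_log_invariant R n p q Rm
   (rot_canonical cs1) rot_invariant inv_ord3 S'.
- exact: formal_canonical_comp.
- have -> : S'.1 = c *: S.1 + s *: S.2.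
    rewrite /S' rotE /= ser_substB // !ser_substZ // ser_substx // ser_substy //.
    by rewrite scaleNr opprK.
  apply: ord2_linear; rewrite !(serB, serD, serZ) /ser_x /ser_mono /=.
  + by case: S0 => -> ->; ring.
  + by rewrite x1 x2 -cs; ring.
  + by rewrite y1 y2; ring.
- have -> : S'.2 = - s *: S.1 + c *: S.2.
    by rewrite /S' rotE /= ser_substD // !ser_substZ // ser_substx // ser_substy.
  apply: ord2_linear; rewrite !(serB, serD, serZ) /ser_y /ser_mono /=.
  + by case: S0 => -> ->; ring.
  + by rewrite x1 x2; ring.
  + by rewrite y1 y2 -cs; ring.
- by rewrite !S'E comm rotC.
exists c, s, chi; split=> // f; rewrite -Echi S'E; congr (_ \o' S).
by rewrite rotK.
Qed.

End Resonance.
End Rotations.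

(** * Classification *)

Section Classification.
Variable R : rcfType.
Local Notation C := R[i].
Implicit Types (f H chi : series R) (S : smap R) (x y beta : R).
Local Notation ord := (@ser_order_ge _).
Local Notation E := (@ser_exp_lie R).
Local Notation "f \o' P" := (ser_subst f P) (at level 40, left associativity).

Variables (n p q m : nat) (ca sa : R).
Hypotheses (p_gt0 : (0 < p)%N) (pq : (p <= q)%N) (n_gt2 : (2 < n)%N).
Hypotheses (m_gt1 : (1 < m)%N) (cs1 : ca ^+ 2 + sa ^+ 2 = 1).
Hypothesis prim : n.-primitive_root (Complex ca sa : C).
Local Notation FF := (@wfil C n p q).
Local Notation F := (@rfil R n p q).
Local Notation s := (p + q)%N.
Local Notation h := (p * n)%N.
Local Notation Rm := (rot ca sa).

(* [lead x] is the coefficient of (z w)^2 in the leading part when [A 0 = x]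
   (0 if n = 3, where this monomial is of higher weight), and [ext B] lists the
   coefficients of the series B in powers of I. *)
Variables (lead : R -> R) (good : R -> Prop) (allowed : nat -> nat -> bool).
Variables (ext : (nat -> R) -> nat -> R) (cond : (nat -> R) -> (nat -> R) -> Prop).
Local Notation ham x beta := (ham0 n (lead x)%:C%C beta%:C%C : series C).

Hypothesis lead_h : forall x, lead x = 0 \/ h = (2 * s)%N.
Hypothesis good_lead : forall x y, lead x = lead y -> good x -> good y.
Hypothesis solv : forall x beta v, good x -> 0 < beta -> (0 < v)%N ->
  solvable_anti (lead x)%:C%C beta%:C%C v n p q allowed.
Hypothesis inj : forall x beta v, good x -> 0 < beta -> (0 < v)%N ->
  injective_anti (lead x)%:C%C beta%:C%C v n p q allowed.
Hypothesis nf_ham0 : forall x beta w, good x -> nf_below p q allowed w (ham x beta).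
Hypothesis inv_weight : forall j l, (3 <= 2 * l + n * j -> 1 + s <= s * l + h * j)%N.
Hypothesis lead_weight : forall j l,
  (n + 2 <= 2 * l + n * j -> h + 1 <= s * l + h * j)%N.
(** [m' = 2] covers the given leading form and [m' = m] the final one. They differ for n = 3, where
    I^2 and I^3 both lie above weight h. *)
Hypothesis lead_fil : forall (m' : nat) (A B : nat -> R), m' = 2%N \/ m' = m ->
  FF (h + 1) (hat (resonant_ham m' n A B) - ham (A 0%N) (icos R n * B 0%N)).
Hypothesis nf_param : forall f, F 0 f ->
  (forall w, rnf p q allowed w f) ->
  exists A B, cond A B /\ f = resonant_ham m n A (ext B).
Hypothesis param_nf : forall A B, cond A B ->
  forall w, rnf p q allowed w (resonant_ham m n A (ext B)).
Hypothesis ext0 : forall B, ext B 0%N = B 0%N.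
Hypothesis ext_inj : forall B B', ext B =1 ext B' -> B =1 B'.

Let n_gt0 : (0 < n)%N. Proof. by lia. Qed.
Let n_gt1 : (1 < n)%N. Proof. by lia. Qed.
Let Rm_can : formal_canonical Rm. Proof. exact: rot_canonical. Qed.
Let Rm_inv : forall f, f \o' Rm = f <-> F 0 f.
Proof. by move=> f; exact: rot_invariant. Qed.
Let Rm_n f : iter n (fun g => g \o' Rm) f = f. Proof. exact: rot_order. Qed.
Let inv_ord3 f : F 0 f -> ord 3 f -> F (1 + s) f.
Proof. by move=> F0 o3; exact: (rfil_of_ord pq F0 o3 inv_weight). Qed.
Let filF : filtration F s s := @rfil_filtration R n p q p_gt0.

Lemma ham_corner x beta : ham x beta n 0%N = beta%:C%C.
Proof.
have n0 : (0 == n) = false by apply/eqP; lia.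
by rewrite /ham0 serD !serZ serD /ser_mono eqxx n0 /= !andbF !mulr0 add0r addr0 mulr1.
Qed.

Lemma ham_diag x beta : ham x beta 2 2 = (lead x)%:C%C.
Proof.
have n2 : (2 == n) = false by apply/eqP; lia.
by rewrite /ham0 serD !serZ serD /ser_mono eqxx n2 /= !addr0 mulr0 mulr1 addr0.
Qed.

Lemma ham_rotate x beta (z : C) (eps : R) k l : z * z^* = 1 -> z ^+ n = eps%:C%C ->
  z ^+ k * z^* ^+ l * ham x beta k l = ham x (eps * beta) k l.
Proof.
move=> zz zn.
have zcn : z^* ^+ n = eps%:C%C.
  rewrite -(rmorphXn (@Num.conj C)) /= zn.
  by apply/eqP; rewrite eq_complex /= oppr0 !eqxx.
rewrite /ham0 !serD !serZ !serD /ser_mono (rmorphM (real_complex R)) /=.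
have e22 : z ^+ 2 * z^* ^+ 2 = 1 by rewrite -exprMn zz expr1n.
rewrite mulrDr; congr (_ + _).
  case: (k =P 2) => [->|_]; last by rewrite !mulr0.
  case: (l =P 2) => [->|_]; last by rewrite !mulr0.
  by rewrite e22 mul1r.
rewrite mulrCA [eps%:C%C * _]mulrC -[RHS]mulrA; congr (_ * _).
rewrite mulrDr [RHS]mulrDr; congr (_ + _).
  case: (k =P n) => [->|_]; last by rewrite !mulr0.
  case: (l =P 0%N) => [->|_]; last by rewrite !mulr0.
  by rewrite zn expr0 mulr1.
case: (k =P 0%N) => [->|_]; last by rewrite !mulr0.
case: (l =P n) => [->|_]; last by rewrite !mulr0.
by rewrite zcn expr0 mul1r.
Qed.

Definition has_lead H x beta : Prop := FF (h + 1) (hat H - ham x beta).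

Lemma lead_rfil H x beta : has_lead H x beta -> F h H.
Proof.
move=> HL; rewrite /rfil -(subrK (ham x beta) (hat H)); apply: wfilD.
  by apply: wfil_le HL; rewrite leq_addr.
apply: ham0_fil => //.
by case: (lead_h x) => [->|]; [left|right].
Qed.

Lemma lead_corner H x beta : has_lead H x beta -> hat H n 0%N = beta%:C%C.
Proof.
move=> /(_ n 0%N); rewrite serB ham_corner => H0; apply/eqP.
rewrite -subr_eq0; apply/eqP/H0; apply/negP => /and3P[_ + _].
by rewrite muln0 addn0; lia.
Qed.

Lemma lead_diag H x beta : h = (2 * s)%N -> has_lead H x beta ->
  hat H 2 2 = (lead x)%:C%C.
Proof.
move=> hs /(_ 2 2); rewrite serB ham_diag => H0; apply/eqP.
rewrite -subr_eq0; apply/eqP/H0; apply/negP => /and3P[_ + _].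
by rewrite -mulnDl hs; lia.
Qed.

Lemma has_lead_close H H' x beta : has_lead H x beta -> F (h + 1) (H' - H) ->
  has_lead H' x beta.
Proof.
rewrite /rfil hatB => HL HH; rewrite /has_lead -(subrK (hat H) (hat H')) -addrA.
exact: wfilD.
Qed.

Lemma has_lead_rot H x beta (eps c d : R) : c ^+ 2 + d ^+ 2 = 1 ->
  (Complex c d : C) ^+ n = eps%:C%C -> has_lead H x beta ->
  has_lead (H \o' rot c d) x (eps * beta).
Proof.
move=> cd zn HL k l nok; rewrite serB hat_rot -(ham_rotate _ _ _ _ (unit_conj cd) zn).
rewrite -mulrBr -serB [X in _ * X](_ : _ = 0) ?mulr0 //; exact: HL.
Qed.

Lemma has_lead_resonant (m' : nat) A B : m' = 2%N \/ m' = m ->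
  has_lead (resonant_ham m' n A B) (A 0%N) (icos R n * B 0%N).
Proof. exact: lead_fil. Qed.

Lemma rot_fix c d f : c ^+ 2 + d ^+ 2 = 1 -> (Complex c d : C) ^+ n = 1 ->
  F 0 f -> f \o' rot c d = f.
Proof.
move=> cd zn F0; apply: hat_inj; apply/serP => k l; rewrite hat_rot.
have [kl|kl] := boolP (k == l %[mod n]); last first.
  by rewrite F0 ?mulr0 // /wok !leq0n !andbT.
have zz := unit_conj cd; have wn : (Complex c d : C)^* ^+ n = 1.
  by rewrite -(rmorphXn (@Num.conj C)) /= zn rmorph1.
move: zn wn zz; move: (Complex c d : C) => z; move: (z^*) => w zn wn zz.
suff -> : z ^+ k * w ^+ l = 1 by rewrite mul1r.
case: (leqP l k) => [lk|/ltnW lk].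
  have /dvdnP[j E1] : (n %| k - l)%N by rewrite -eqn_mod_dvd.
  rewrite -(subnKC lk) exprD -mulrA mulrCA mulrC -exprMn zz expr1n mul1r.
  by rewrite E1 mulnC exprM zn expr1n.
have /dvdnP[j E1] : (n %| l - k)%N by rewrite -eqn_mod_dvd // eq_sym.
rewrite -(subnKC lk) exprD mulrA -exprMn zz expr1n mul1r.
by rewrite E1 mulnC exprM wn expr1n.
Qed.

(** exp(L_chi) leaves the part of weight h unchanged, so only the rotation acts on it: it keeps the
    coefficient of (z w)^2 and multiplies that of z^n by a number of modulus 1. *)
Lemma compare_leading H H' S x y beta beta' : formal_canonical S ->
  (forall f, f \o' S \o' Rm = f \o' Rm \o' S) -> H \o' S = H' ->
  has_lead H x beta -> has_lead H' y beta' ->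
  lead x = lead y /\ exists c d chi, [/\ c ^+ 2 + d ^+ 2 = 1,
    F (1 + s) chi, forall f, f \o' S = E chi (f \o' rot c d) &
    (Complex c d : C) ^+ n * beta%:C%C = beta'%:C%C].
Proof.
move=> Scan comm HS HL HL'.
have [c [d [chi [cd Fchi SE]]]] :=
  commuting_canonical cs1 prim n_gt2 inv_ord3 Scan comm.
have c3 : ord 3 chi by apply: (rfil_ord p_gt0) Fchi; lia.
have FHM : F h (H \o' rot c d) by apply: rfil_rot; exact: lead_rfil HL.
have := exp_lie_close filF (ltnSn 0) c3 Fchi FHM.
rewrite -SE HS /rfil hatB => D.
have D0 k l : ~~ wok n p q (h + 1) k l ->
    hat H' k l = Complex c d ^+ k * (Complex c d)^* ^+ l * hat H k l.
  by move=> /D; rewrite serB hat_rot => /eqP; rewrite subr_eq0 => /eqP.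
split.
  have diag : h = (2 * s)%N -> lead x = lead y.
    move=> hs; apply: (fmorph_inj (real_complex R)) => /=.
    rewrite -(lead_diag hs HL) -(lead_diag hs HL') D0.
      by rewrite -exprMn unit_conj // expr1n mul1r.
    by apply/negP => /and3P[_ + _]; rewrite -mulnDl hs; lia.
  case: (lead_h x) => [lx|/diag //]; case: (lead_h y) => [ly|/diag //].
  by rewrite lx ly.
exists c, d, chi; split=> //.
rewrite -(lead_corner HL) -(lead_corner HL') D0 ?expr0 ?mulr1 //.
by apply/negP => /and3P[_ + _]; rewrite muln0 addn0; lia.
Qed.

(** Multiplying the equation by its conjugate shows that beta and beta' have equal squares. *)
Lemma unit_pos_real (z : C) beta beta' : z * z^* = 1 -> 0 < beta -> 0 < beta' ->
  z ^+ n * beta%:C%C = beta'%:C%C -> z ^+ n = 1.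
Proof.
move=> zz b0 b'0 E1.
have rc (r : R) : (r%:C%C : C)^* = r%:C%C.
  by apply/eqP; rewrite eq_complex /= oppr0 !eqxx.
have E2 : z^* ^+ n * beta%:C%C = beta'%:C%C.
  have := congr1 (@Num.conj C) E1.
  by rewrite rmorphM /= !rc -(rmorphXn (@Num.conj C)).
have bb : beta = beta'.
  apply/eqP; rewrite -(eqrXn2 (n := 2)) ?ltW //; apply/eqP.
  apply: (fmorph_inj (real_complex R)); rewrite !expr2 !rmorphM /=.
  by rewrite -{1}E1 -E2 mulrACA -exprMn zz expr1n mul1r.
have c0 : (beta'%:C%C : C) != 0 by rewrite (fmorph_eq0 (real_complex R)) gt_eqF.
by apply: (mulIf c0); rewrite mul1r -{1}bb.
Qed.

Variable F0 : smap R.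
Variables (A B : nat -> R) (H1 : series R).
Hypotheses (H1_ord3 : ord 3 H1) (H1_inv : H1 \o' Rm = H1).
Hypothesis H1_lead : ord (n + 2) (H1 - resonant_ham 2 n A B).
Hypothesis F0_conj : formally_conjugate F0 (smap_comp Rm (time_one_map H1)).
Hypotheses (good_A : good (A 0%N)) (B_neq0 : B 0%N != 0).

Let H1_has_lead : has_lead H1 (A 0%N) (icos R n * B 0%N).
Proof.
apply: has_lead_close (has_lead_resonant A B (or_introl erefl)) _.
apply: rfil_of_ord H1_lead lead_weight => //.
by apply: (filB filF); [exact/Rm_inv|exact: resonant_ham_resonant].
Qed.

Let beta1 := icos R n * B 0%N.

(** A negative coefficient is reversed by rotating through an n-th root of -1, which does not affect
    (z w)^2. *)
Let sign_rotation : exists c d (eps : R), [/\ c ^+ 2 + d ^+ 2 = 1,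
  (Complex c d : C) ^+ n = eps%:C%C & 0 < eps * beta1].
Proof.
have b0 : beta1 != 0 by rewrite mulf_neq0 // gt_eqF // icos_gt0.
have [bp|bn|/esym/eqP] := ltgtP 0 beta1; last by rewrite (negbTE b0).
  exists 1, 0, 1; split; rewrite ?mul1r //; first by rewrite expr1n expr0n addr0.
  exact: expr1n.
pose z : C := n.-root (-1).
have zn : z ^+ n = -1 by rewrite rootCK.
have zz : z * z^* = 1.
  have z0 : 0 <= z * z^* by exact: mul_conjC_ge0.
  apply/eqP; rewrite -(pexpr_eq1 n_gt0 z0) exprMn -(rmorphXn (@Num.conj C)) /= zn.
  by rewrite rmorphN1 mulrNN mulr1.
have [[c d] /= zE cd] := unit_complex zz.
exists c, d, (-1); split=> //; last by rewrite mulN1r oppr_gt0.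
by rewrite -zE zn (rmorphN1 (real_complex R)).
Qed.

Let realH x beta : exists H0 : series R, hat H0 = ham x beta := real_ham0 n (lead x) beta.
Let hatI : hat (2%:R *: ser_I R) = ser_mono C 1 1.
Proof.
rewrite hatZ hat_I scalerA (rmorph_nat (real_complex R)) divff ?scale1r //.
by rewrite pnatr_eq0.
Qed.
Let hatZn : hat (2%:R *: (ser_zpow R n).1) = ser_mono C n 0 + ser_mono C 0 n.
Proof.
rewrite hatZ hat_zpow scalerA (rmorph_nat (real_complex R)) divff ?scale1r //.
by rewrite pnatr_eq0.
Qed.

Lemma has_leadP H H0 x beta : hat H0 = ham x beta ->
  has_lead H x beta <-> F (h + 1) (H - H0).
Proof. by move=> E0; rewrite /has_lead /rfil hatB E0. Qed.

Theorem formal_normal_form_exists : exists A' B', [/\ cond A' B',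
  formally_conjugate F0 (smap_comp Rm (time_one_map (resonant_ham m n A' (ext B'))))
  & 0 < B' 0%N].
Proof.
have [c [d [eps [cd zn eb]]]] := sign_rotation.
pose H2 := H1 \o' rot c d.
have Mcan := rot_canonical cd; have [M0 _ _] := formal_canonicalP Mcan.
have H2L : has_lead H2 (A 0%N) (eps * beta1) by exact: has_lead_rot.
have [H0 hatH0] := realH (A 0%N) (eps * beta1).
have [chi Fchi nf] := @normal_form_exists R n p q (lead (A 0%N)) (eps * beta1) allowed
  p_gt0 pq n_gt1 eb (lead_h _) (fun v => @solv _ _ v good_A eb)
  (fun w => @nf_ham0 _ _ w good_A) H0 hatH0 H2 ((has_leadP _ hatH0).1 H2L).
have c3 : ord 3 chi by apply: (rfil_ord p_gt0) Fchi; lia.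
have FH2 : F h H2 by exact: lead_rfil H2L.
set H3 := E chi H2 in nf.
have FH3 : F h H3 by apply: (exp_lie_fil filF).
have [A' [B' [cAB E3]]] := nf_param (fil_le filF (leq0n h) FH3) nf.
exists A', B'; split=> //; last first.
  (* The near-identity change keeps the leading part, so the sign obtained by the rotation is the
     sign of b_0. *)
  have H3L : has_lead H3 (A 0%N) (eps * beta1).
    apply: has_lead_close H2L _; exact: (exp_lie_close filF (ltnSn 0) c3 Fchi FH2).
  have := lead_corner H3L.
  rewrite E3 (lead_corner (has_lead_resonant A' (ext B') (or_intror erefl))).
  move/(fmorph_inj (real_complex R)) => EB.
  by move: eb; rewrite -EB ext0 pmulr_rgt0 // icos_gt0.
pose S := smap_comp (rot c d) (time_one_map chi).
have chi0 := time_one_no_constant c3.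
have SE f : f \o' S = E chi (f \o' rot c d) by rewrite -ser_subst_comp // exp_lieE.
have Scan : formal_canonical S.
  by apply: formal_canonical_comp => //; exact: time_one_canonical.
have H33 : ord 3 H3 by apply: exp_lie_ord => //; exact: ser_subst_ord.
rewrite -E3.
have conj := @hamiltonian_conjugate R Rm Rm_can H1 H3 S H1_ord3 H33 Scan (SE H1).
have {}conj := conj _; case: F0_conj => P [Pcan /smapP FP].
have [P0 _ _] := formal_canonicalP Pcan; have [S0 _ _] := formal_canonicalP Scan.
have [Rm0 _ _] := formal_canonicalP Rm_can.
have R1 : no_constant (smap_comp Rm (time_one_map H1)).
  by apply: no_constant_comp => //; exact: time_one_no_constant.
have R3 : no_constant (smap_comp Rm (time_one_map H3)).
  by apply: no_constant_comp => //; exact: time_one_no_constant.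
exists (smap_comp P S); split; first exact: formal_canonical_comp.
apply/smapP; rewrite -smap_compA // FP smap_compA // conj ?smap_compA //.
move=> f; rewrite !SE (fil_invariant_exp p_gt0 Rm_can Rm_inv) //.
by rewrite rotC.
Qed.

Theorem formal_normal_form_unique A1 B1 A2 B2 :
  cond A1 B1 -> 0 < B1 0%N -> cond A2 B2 -> 0 < B2 0%N ->
  formally_conjugate F0 (smap_comp Rm (time_one_map (resonant_ham m n A1 (ext B1)))) ->
  formally_conjugate F0 (smap_comp Rm (time_one_map (resonant_ham m n A2 (ext B2)))) ->
  A1 =1 A2 /\ B1 =1 B2.
Proof.
move=> c1 B10 c2 B20 conj1 conj2.
set G1 := resonant_ham m n A1 _ in conj1 *.
set G2 := resonant_ham m n A2 _ in conj2 *.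
have [Rm0 _ _] := formal_canonicalP Rm_can.
have ncR H : ord 3 H -> no_constant (smap_comp Rm (time_one_map H)).
  by move=> H3; apply: no_constant_comp => //; exact: time_one_no_constant.
have G13 : ord 3 G1 by exact: resonant_ham_ord3.
have G23 : ord 3 G2 by exact: resonant_ham_ord3.
have FG1 : F 0 G1 by exact: resonant_ham_resonant.
have FG2 : F 0 G2 by exact: resonant_ham_resonant.
have G1R := (Rm_inv G1).2 FG1; have G2R := (Rm_inv G2).2 FG2.
have G1L : has_lead G1 (A1 0%N) (icos R n * ext B1 0%N).
  by apply: has_lead_resonant; right.
have G2L : has_lead G2 (A2 0%N) (icos R n * ext B2 0%N).
  by apply: has_lead_resonant; right.
(* The given nondegeneracy concerns H1; conjugacy with H1 transfers it to this normal form. *)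
have good1 : good (A1 0%N).
  case: F0_conj => P [Pcan /smapP FP].
  have [S Scan SE] := formally_conjugate_transfer (ncR _ H1_ord3) Pcan FP conj1 (ncR _ G13).
  have [HS comm] := conjugate_hamiltonian Rm_can Rm_n n_gt0 H1_ord3 G13 H1_inv G1R Scan SE.
  have [El _] := compare_leading Scan comm HS H1_has_lead G1L.
  exact: good_lead El good_A.
have beta1_gt0 : 0 < icos R n * ext B1 0%N by rewrite ext0 mulr_gt0 ?icos_gt0.
have beta2_gt0 : 0 < icos R n * ext B2 0%N by rewrite ext0 mulr_gt0 ?icos_gt0.
suff EG : G1 = G2.
  have [EA EB] := resonant_ham_inj n_gt0 EG; split=> //; exact: ext_inj.
case: conj1 => P [Pcan /smapP FP].
have [S Scan SE] := formally_conjugate_transfer (ncR _ G13) Pcan FP conj2 (ncR _ G23).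
have [HS comm] := conjugate_hamiltonian Rm_can Rm_n n_gt0 G13 G23 G1R G2R Scan SE.
have [_ [c [d [chi [cd Fchi SEchi zb]]]]] := compare_leading Scan comm HS G1L G2L.
(* Both leading coefficients are positive, so the rotation is by an n-th root of unity and acts
   trivially on resonant series; only exp(L_chi) remains. *)
have zn := unit_pos_real (unit_conj cd) beta1_gt0 beta2_gt0 zb.
have [H0 hatH0] := realH (A1 0%N) (icos R n * ext B1 0%N).
apply: (@normal_form_unique R n p q (lead (A1 0%N)) (icos R n * ext B1 0%N) allowed
  p_gt0 pq n_gt1 beta1_gt0 (lead_h _) (fun v => @inj _ _ v good1 beta1_gt0)
  H0 _ _ hatH0 hatI hatZn Rm Rm_can Rm_inv inv_ord3 G1 G2 chi) => //.
- exact/(has_leadP _ hatH0).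
- exact: param_nf.
- exact: param_nf.
- by rewrite -HS SEchi rot_fix.
Qed.

End Classification.

(** * The classification for n >= 4 and for n = 3 *)

Section Instances.
Variable R : rcfType.
Local Notation C := R[i].
Implicit Types (f : series R) (A B : nat -> R) (x beta : R).
Local Notation "x %:C" := (real_complex R x).

Lemma nf_belowP p q (allowed : nat -> nat -> bool) (u : series C) :
  (forall w, nf_below p q allowed w u) <-> forall k l, nf_at allowed u k l.
Proof.
split=> [nu k l|nu w k l _]; last exact: nu.
by apply: (nu (p * k + q * l).+1); rewrite ltnn.
Qed.

Lemma nf_ham0_allowed n p q (allowed : nat -> nat -> bool) (a b : C) :
  allowed n 0%N -> (a = 0 \/ allowed 2%N 2%N) -> (0 < n)%N ->
  forall w, nf_below p q allowed w (ham0 n a b).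
Proof.
move=> an a2 n0; apply/nf_belowP => k l; split.
  by have /serP/(_ l k) := ser_swap_ham0 n a b.
move=> lk nall; rewrite /ham0 serD !serZ serD /ser_mono.
have -> : a * ((k == 2) && (l == 2))%:R = 0.
  case: a2 => [->|a2]; first by rewrite mul0r.
  case: (k =P 2) => [k2|_]; last by rewrite mulr0.
  case: (l =P 2) => [l2|_]; last by rewrite mulr0.
  by rewrite k2 l2 a2 in nall.
have -> : ((k == 0%N) && (l == n)) = false.
  by apply/negP => /andP[/eqP k0 /eqP l0]; move: lk; rewrite k0 l0; lia.
have -> : ((k == n) && (l == 0%N)) = false; last by rewrite add0r addr0 mulr0.
by apply/negP => /andP[/eqP k0 /eqP l0]; rewrite k0 l0 an in nall.
Qed.

Lemma resonant_ham_nf m n p q (allowed : nat -> nat -> bool) A B : (0 < n)%N ->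
  (forall k, allowed (k + m)%N (k + m)%N \/ A k = 0) ->
  (forall l, allowed (l + n)%N l \/ B l = 0) ->
  forall w, rnf p q allowed w (resonant_ham m n A B).
Proof.
move=> n0 HA HB; apply/nf_belowP => k l; rewrite /nf_at !hat_resonant_ham //.
split.
  congr (_ + _ * _); last exact: addrC.
  by rewrite eq_sym; case: eqP => [->|].
move=> lk nall.
have -> : (l == k + n)%N = false by apply/eqP; lia.
rewrite addr0; have -> : (if (k == l) && (m <= k)%N then (A (k - m)%N / 2 ^+ k)%:C%C
    else 0 : C) = 0.
  case: (k =P l) => //= kl; case: leqP => // mk.
  have [al|->] := HA (k - m)%N; last by rewrite mul0r.
  by move: al; rewrite subnK // {2}kl (negbTE nall).
rewrite add0r; case: (k =P (l + n)%N) => [kl|_]; last by rewrite mulr0.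
have [al|->] := HB l; last by rewrite mul0r mulr0.
by move: al; rewrite -kl (negbTE nall).
Qed.

Lemma rnf_resonant_ham m n p q (allowed : nat -> nat -> bool) f : (0 < n)%N ->
  (forall k l, (l <= k)%N -> allowed k l -> (k == l) && (m <= k)%N || (k == (l + n)%N)) ->
  (forall w, rnf p q allowed w f) ->
  [/\ f = resonant_ham m n (diag_coef m f) (cos_coef n f),
    forall k, ~~ allowed (k + m)%N (k + m)%N -> diag_coef m f k = 0 &
    forall l, ~~ allowed (l + n)%N l -> cos_coef n f l = 0].
Proof.
move=> n0 Hall /nf_belowP nf; split.
- apply: resonant_hamP => // [k l|k l lk nal]; first by have [] := nf k l.
  have [_] := nf k l; apply => //; apply: contra nal; exact: Hall.
- move=> k nal; have [_ H] := nf (k + m)%N (k + m)%N.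
  by rewrite /diag_coef H // mul0r.
- move=> l nal; have [_ H] := nf (l + n)%N l.
  by rewrite /cos_coef H ?leq_addr // !mul0r.
Qed.

Lemma ham_difference_fil m n p q A B (a : R) W : (p <= q)%N -> (0 < n)%N ->
  (forall l, ((p + q) * l < W)%N ->
    (if (m <= l)%N then A (l - m)%N / 2 ^+ l else 0) = a * (l == 2)%:R) ->
  (forall j l, (0 < j)%N -> ((p + q) * l + p * n * j < W)%N -> j = 1%N /\ l = 0%N) ->
  wfil n p q W (hat (resonant_ham m n A B) - ham0 n a%:C (icos R n * B 0%N)%:C).
Proof.
move=> pq n0 Hd Ho; apply: wfil_slots => //.
  apply: wfilB.
    exact: resonant_ham_resonant.
  have [z w] := wfil_mono_n C pq (leq0n (p * n)).
  apply: wfilD; first by apply/wfilZ/wfil_mono; rewrite /wok eqxx.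
  by apply: wfilZ; exact: wfilD.
move=> j l low.
have sym (u : series C) k k' : ser_swap u = u -> u k k' = u k' k.
  by move=> /serP/(_ k' k).
set D := _ - _.
have Ds : ser_swap D = D.
  have -> : ser_swap D = ser_swap (hat (resonant_ham m n A B)) -
    ser_swap (ham0 n a%:C (icos R n * B 0%N)%:C) by [].
  rewrite ser_swap_ham0; congr (_ - _); apply/serP => k k'.
  rewrite /ser_swap !hat_resonant_ham //; congr (_ + _ * _); last exact: addrC.
  by rewrite eq_sym; case: eqP => [->|].
suff D0 : D (l + n * j)%N l = 0 by split; rewrite // sym.
rewrite /D serB hat_resonant_ham // /ham0 serD !serZ serD /ser_mono.
case: j low => [|j] low.
  rewrite muln0 addn0 eqxx /=.
  have -> : (l == l + n)%N = false by apply/eqP; lia.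
  have -> : (l == n) && (l == 0%N) = false by apply/negP => /andP[/eqP -> /eqP]; lia.
  have -> : (l == 0%N) && (l == n) = false by apply/negP => /andP[/eqP -> /eqP]; lia.
  rewrite !addr0 !mulr0 !addr0 andbb.
  have := Hd l; rewrite muln0 addn0 in low; move=> /(_ low) E.
  have -> : (if (m <= l)%N then (A (l - m)%N / 2 ^+ l)%:C else 0 : C) =
    (if (m <= l)%N then A (l - m)%N / 2 ^+ l else 0)%:C by case: ifP.
  by rewrite E (rmorphM (real_complex R)) (rmorph_nat (real_complex R)) subrr.
have [[-> ->]] := Ho j.+1 l isT low.
have -> : (0 + n * 1 = n)%N by rewrite muln1.
have -> : (n == 0%N) = false by apply/eqP; lia.
have -> : (0%N == (n + n)%N) = false by apply/eqP; lia.
rewrite add0n !eqxx expr0 divr1 /= andbF mulr0 !addr0 !add0r mulr1.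
by rewrite -(rmorphM (real_complex R)) subrr.
Qed.

Lemma real_complex_gt0 x : 0 < x -> 0 < x%:C :> C.
Proof. by rewrite ltcE /= eqxx. Qed.

Lemma real_complex_real x : x%:C \is Num.real.
Proof. by apply/complex_realP; exists x. Qed.

Section AtLeastFour.
Variables (n : nat) (ca sa : R).
Hypotheses (n4 : (4 <= n)%N) (cs1 : ca ^+ 2 + sa ^+ 2 = 1).
Hypothesis prim : n.-primitive_root (Complex ca sa : C).

(** I = z w / 2, so I^2 is a quarter of (z w)^2. *)
Let lead x : R := x / 2 ^+ 2.
Let good x : Prop := x != 0.
Let cond (A B : nat -> R) := True.

Let hs : (2 * n)%N = (2 * (2 + (n - 2)))%N. Proof. by lia. Qed.

Let lead_neq0 x : good x -> (lead x)%:C != 0 :> C.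
Proof.
by move=> x0; rewrite (fmorph_eq0 (real_complex R)) mulf_neq0 ?invr_eq0
  ?expf_neq0 ?pnatr_eq0.
Qed.

Let good_lead x y : lead x = lead y -> good x -> good y.
Proof.
move=> E; suff -> : y = x by [].
by apply: (mulIf _ (esym E)); rewrite invr_eq0 expf_neq0 ?pnatr_eq0.
Qed.

Let inv_weight j l : (3 <= 2 * l + n * j ->
  1 + (2 + (n - 2)) <= (2 + (n - 2)) * l + 2 * n * j)%N.
Proof.
rewrite subnKC; last by lia.
case: j => [|j] H; last by rewrite mulnS; have := leq0n (n * l); lia.
by case: l H => [|[|l]] H; rewrite ?mulnS; lia.
Qed.

Let lead_weight j l : (n + 2 <= 2 * l + n * j ->
  2 * n + 1 <= (2 + (n - 2)) * l + 2 * n * j)%N.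
Proof.
rewrite subnKC; last by lia.
case: j => [|[|j]] H; last by rewrite !mulnS; lia.
  by case: l H => [|[|[|l]]] H; rewrite ?mulnS; lia.
by case: l H => [|l] H; rewrite ?mulnS; lia.
Qed.

Let lead_fil (m' : nat) A B : m' = 2%N \/ m' = 2%N ->
  wfil n 2 (n - 2) (2 * n + 1) (hat (resonant_ham m' n A B) -
    ham0 n (lead (A 0%N))%:C (icos R n * B 0%N)%:C).
Proof.
move=> m2; have {m2} -> : m' = 2%N by case: m2.
apply: ham_difference_fil; [lia|lia| |]; rewrite ?subnKC; try lia.
  move=> l; case: l => [|[|[|l]]] H; rewrite ?mulr0 ?mulr1 //.
  by move: H; rewrite !mulnS; lia.
move=> [|[|j]] l // _; last by rewrite !mulnS; have := leq0n (n * l); lia.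
by case: l => // l; rewrite !mulnS; lia.
Qed.

Let nf_param f : rfil n 2 (n - 2) 0 f ->
  (forall w, rnf 2 (n - 2) (allowed_ge4 n) w f) ->
  exists A B, cond A B /\ f = resonant_ham 2 n A (even_coefs B).
Proof.
move=> _ nf.
have [||E _ HB] := @rnf_resonant_ham 2 n 2 (n - 2) _ f _ _ nf; first by lia.
  by move=> k l _; rewrite /allowed_ge4 => /orP[->//|/andP[-> _]]; rewrite orbT.
exists (diag_coef 2 f), (fun k => cos_coef n f k.*2); split=> //.
rewrite [LHS]E; congr resonant_ham; apply/funext => l; rewrite /even_coefs.
case: ifP => ol; last first.
  by congr cos_coef; rewrite -[LHS]odd_double_half ol.
apply: HB; rewrite /allowed_ge4 ol andbF orbF negb_and.
by rewrite (_ : (l + n == l)%N = false) //; apply/eqP; lia.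
Qed.

Let param_nf A B : cond A B ->
  forall w, rnf 2 (n - 2) (allowed_ge4 n) w (resonant_ham 2 n A (even_coefs B)).
Proof.
move=> _; apply: resonant_ham_nf; first by lia.
  by move=> k; left; rewrite /allowed_ge4 eqxx leq_addl.
move=> l; rewrite /allowed_ge4 /even_coefs eqxx.
by case: odd; [right|left; rewrite orbT].
Qed.

Let even_coefs_inj B B' : even_coefs B =1 even_coefs B' -> B =1 B'.
Proof.
by move=> E k; have := E k.*2; rewrite /even_coefs odd_double doubleK.
Qed.

Theorem classification_ge4 (F0 : smap R) A B (H1 : series R) :
  ser_order_ge 3 H1 -> ser_subst H1 (rot ca sa) = H1 ->
  ser_order_ge (n + 2) (H1 - resonant_ham 2 n A B) ->
  formally_conjugate F0 (smap_comp (rot ca sa) (time_one_map H1)) ->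
  A 0%N != 0 -> B 0%N != 0 ->
  let P a b := formally_conjugate F0 (smap_comp (rot ca sa)
    (time_one_map (resonant_ham 2 n a (even_coefs b)))) in
  (exists a b, P a b /\ 0 < b 0%N) /\
  (forall a b a' b', P a b -> 0 < b 0%N -> P a' b' -> 0 < b' 0%N ->
     a =1 a' /\ b =1 b').
Proof.
move=> H13 H1R H1L conj A0 B0 P.
have pq : (2 <= n - 2)%N by lia.
have n_gt2 : (2 < n)%N by lia.
have lead_h x : lead x = 0 \/ (2 * n)%N = (2 * (2 + (n - 2)))%N by right.
have solv x beta v : good x -> 0 < beta -> (0 < v)%N ->
    solvable_anti (lead x)%:C beta%:C v n 2 (n - 2) (allowed_ge4 n).
  move=> gx bp v0; apply: solvable_anti_ge4 => //.
  - exact: real_complex_gt0.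
  - exact: real_complex_real.
  - exact: lead_neq0.
have inj x beta v : good x -> 0 < beta -> (0 < v)%N ->
    injective_anti (lead x)%:C beta%:C v n 2 (n - 2) (allowed_ge4 n).
  move=> gx bp v0; apply: injective_anti_ge4 => //.
  - exact: real_complex_gt0.
  - exact: real_complex_real.
  - exact: lead_neq0.
have nf_ham x beta w : good x ->
    nf_below 2 (n - 2) (allowed_ge4 n) w (ham0 n (lead x)%:C beta%:C).
  move=> _; apply: nf_ham0_allowed; last by lia.
    by rewrite /allowed_ge4 eqxx orbT.
  by right.
split.
  have [a [b [_ Pab b0]]] := @formal_normal_form_exists R n 2 (n - 2) 2 ca sa isT pq
    n_gt2 isT cs1 prim lead good (allowed_ge4 n) (@even_coefs R) cond lead_h
    solv nf_ham lead_weight lead_fil nf_param (fun _ => erefl)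
    F0 A B H1 H13 H1R H1L conj A0 B0.
  by exists a, b.
move=> a b a' b' Pab b0 Pab' b0'.
exact: (@formal_normal_form_unique R n 2 (n - 2) 2 ca sa isT pq
    n_gt2 isT cs1 prim lead good (allowed_ge4 n) (@even_coefs R) cond lead_h
    good_lead inj inv_weight lead_weight lead_fil param_nf
    (fun _ => erefl) even_coefs_inj
    F0 A B H1 H13 H1R H1L conj A0 a b a' b' I b0 I b0' Pab Pab').
Qed.

End AtLeastFour.

Section Three.
Variables (ca sa : R).
Hypothesis cs1 : ca ^+ 2 + sa ^+ 2 = 1.
Hypothesis prim : 3.-primitive_root (Complex ca sa : C).

(** For n = 3 the monomial z^3 has weight 3 and (z w)^2 has weight 4, so A(0) does not reach the
    leading part. *)
Let lead x : R := 0.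
Let good x : Prop := True.
Let cond (A B : nat -> R) : Prop :=
  (forall k, (k %% 3 = 2)%N -> A k = 0) /\ (forall k, (k %% 3 = 2)%N -> B k = 0).

Let inv_weight j l : (3 <= 2 * l + 3 * j -> 1 + (1 + 1) <= (1 + 1) * l + 1 * 3 * j)%N.
Proof. by lia. Qed.
Let lead_weight j l :
  (3 + 2 <= 2 * l + 3 * j -> 1 * 3 + 1 <= (1 + 1) * l + 1 * 3 * j)%N.
Proof. by lia. Qed.

Let lead_fil (m' : nat) A B : m' = 2%N \/ m' = 3%N ->
  wfil 3 1 1 (1 * 3 + 1) (hat (resonant_ham m' 3 A B) -
    ham0 3 (lead (A 0%N))%:C (icos R 3 * B 0%N)%:C).
Proof.
move=> m23; apply: ham_difference_fil => //; last by lia.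
move=> l Hl; rewrite /lead mul0r (_ : (m' <= l)%N = false) //.
by case: m23 => ->; lia.
Qed.

Let nf_param f : rfil 3 1 1 0 f -> (forall w, rnf 1 1 allowed_3 w f) ->
  exists A B, cond A B /\ f = resonant_ham 3 3 A B.
Proof.
move=> _ nf.
have [//||E HA HB] := @rnf_resonant_ham 3 3 1 1 _ f _ _ nf.
  by move=> k l _; rewrite /allowed_3 => /orP[/and3P[-> ->]//|/andP[-> _]]; rewrite orbT.
exists (diag_coef 3 f), (cos_coef 3 f); split=> //; split=> k k3.
  by apply: HA; rewrite /allowed_3; lia.
by apply: HB; rewrite /allowed_3; lia.
Qed.

Let param_nf A B : cond A B -> forall w, rnf 1 1 allowed_3 w (resonant_ham 3 3 A B).
Proof.
case=> HA HB; apply: resonant_ham_nf => // k.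
  case: (k %% 3 =P 2)%N => k3; [by right; exact: HA|left].
  by rewrite /allowed_3; lia.
case: (k %% 3 =P 2)%N => k3; [by right; exact: HB|left].
by rewrite /allowed_3; lia.
Qed.

Theorem classification_3 (F0 : smap R) A B (H1 : series R) :
  ser_order_ge 3 H1 -> ser_subst H1 (rot ca sa) = H1 ->
  ser_order_ge (3 + 2) (H1 - resonant_ham 2 3 A B) ->
  formally_conjugate F0 (smap_comp (rot ca sa) (time_one_map H1)) ->
  B 0%N != 0 ->
  let P a b := [/\ forall k, (k %% 3 = 2)%N -> a k = 0,
    forall k, (k %% 3 = 2)%N -> b k = 0 &
    formally_conjugate F0 (smap_comp (rot ca sa)
      (time_one_map (resonant_ham 3 3 a b)))] in
  (exists a b, P a b /\ 0 < b 0%N) /\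
  (forall a b a' b', P a b -> 0 < b 0%N -> P a' b' -> 0 < b' 0%N ->
     a =1 a' /\ b =1 b').
Proof.
move=> H13 H1R H1L conj B0 P.
have lead_h x : lead x = 0 \/ (1 * 3)%N = (2 * (1 + 1))%N by left.
have lead0 x : (lead x)%:C = 0 :> C by rewrite /lead rmorph0.
have solv x beta v : good x -> 0 < beta -> (0 < v)%N ->
    solvable_anti (lead x)%:C beta%:C v 3 1 1 allowed_3.
  move=> _ bp v0; apply: solvable_anti_3 => //; exact: real_complex_gt0.
have inj x beta v : good x -> 0 < beta -> (0 < v)%N ->
    injective_anti (lead x)%:C beta%:C v 3 1 1 allowed_3.
  move=> _ bp v0; apply: injective_anti_3 => //; exact: real_complex_gt0.
have nf_ham x beta w : good x ->
    nf_below 1 1 allowed_3 w (ham0 3 (lead x)%:C beta%:C).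
  by move=> _; apply: nf_ham0_allowed => //; left.
split.
  have [a [b [[Ha Hb] Pab b0]]] := @formal_normal_form_exists R 3 1 1 3 ca sa isT isT
    isT isT cs1 prim lead good allowed_3 id cond lead_h
    solv nf_ham lead_weight lead_fil nf_param (fun _ => erefl)
    F0 A B H1 H13 H1R H1L conj I B0.
  by exists a, b.
move=> a b a' b' [Ha Hb Pab] b0 [Ha' Hb' Pab'] b0'.
exact: (@formal_normal_form_unique R 3 1 1 3 ca sa isT isT
    isT isT cs1 prim lead good allowed_3 id cond lead_h
    (fun _ _ _ _ => I) inj inv_weight lead_weight lead_fil param_nf
    (fun _ => erefl) (fun _ _ => id)
    F0 A B H1 H13 H1R H1L conj I a b a' b' (Logic.conj Ha Hb) b0 (Logic.conj Ha' Hb') b0' Pab Pab').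
Qed.

End Three.
End Instances.

Theorem theorem1p3 (f g : R -> R -> R) (n : nat) (alpha : R) (A B : {poly R})
    (f_smooth : smooth_near0 f) (g_smooth : smooth_near0 g)
    (area_fg : area_preserving_near0 f g)
    (f0 : f 0 0 = 0) (g0 : g 0 0 = 0)
    (ell : elliptic (jacobian_mx f g 0%R 0%R))
    (angle : rotation_angle (jacobian_mx f g 0%R 0%R) alpha)
    (n_ge3 : (3 <= n)%N)
    (order_n : n.-primitive_root (Complex (cos alpha) (sin alpha)))
    (leading : leading_normal_form (taylor f, taylor g) alpha n A B) :
  ((4 <= n)%N -> A.[0] * B.[0] != 0 ->
     exists_unique_normalised (normal_form_ge4 (taylor f, taylor g) alpha n)) /\
  (n = 3%N -> B.[0] != 0 ->
     exists_unique_normalised (normal_form_3 (taylor f, taylor g) alpha)).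
Proof.
have cs1 : cos alpha ^+ 2 + sin alpha ^+ 2 = 1.
  by rewrite addrC !expr2; exact: (Rtrigo1.sin2_cos2 alpha).
case: leading => H1 [H13 /serP H1R H1L conj].
rewrite !horner_coef0.
split=> [n4|n3].
  rewrite mulf_eq0 negb_or => /andP[A0 B0].
  apply: (classification_ge4 n4 cs1 order_n H13 H1R _ conj A0 B0).
  by rewrite addn2; exact: H1L.
subst n => B0.
exact: (classification_3 cs1 order_n H13 H1R H1L conj B0).
Qed.
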